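(* Let $\mathfrak{K}$ be the ideal of compact operators on $\mathcal{H}$ and let $P:\mathfrak{K}\to\mathfrak{K}$, $P(x)=\sum_{i=1}^{w}p_ixp_i$, be the pinching operator associated with a family $\{p_i\}_1^w$ $(1\le w\le\infty)$ of nonzero mutually orthogonal hermitian projections on $\mathcal{H}$; let $p_0=1-\sum_{i=1}^{w}p_i$. Then $\mathcal{U}_{\mathfrak{K}}(P)$ is a quasi submanifold of $\mathcal{B}(\mathfrak{K})$. Furthermore, $\mathcal{U}_{\mathfrak{K}}(P)$ is a submanifold of $\mathcal{B}(\mathfrak{K})$ if and only if $w<\infty$ and there is only one infinite rank projection in the family $\{p_i\}_0^w$.
   Context: $\mathcal{H}$ is an infinite dimensional separable Hilbert space, $\mathcal{B}(\mathcal{H})$ the bounded operators on it; $\mathfrak{K}$ carries the operator norm $\|\cdot\|$, and $\mathfrak{K}_{sh}=\{x\in\mathfrak{K}:x^*=-x\}$. $\mathcal{U}_{\mathfrak{K}}=\{u\text{ unitary on }\mathcal{H}:u-1\in\mathfrak{K}\}$ is a real Banach-Lie group with the metric $\|u_1-u_2\|$ and Lie algebra $\mathfrak{K}_{sh}$. If $w=\infty$, the index $i$ runs over all positive integers, $\sum_i p_i$ converges strongly and $\sum_i p_ixp_i$ converges in operator norm for $x\in\mathfrak{K}$. The projection $p_0$ may be zero. $\mathcal{B}(\mathfrak{K})$ is the Banach algebra of bounded operators on $\mathfrak{K}$ with the usual operator norm. For $x\in\mathcal{B}(\mathcal{H})$, $L_x:\mathfrak{K}\to\mathfrak{K}$,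 $L_x(y)=xy$. The orbit is $\mathcal{U}_{\mathfrak{K}}(P)=\{L_uPL_{u^*}:u\in\mathcal{U}_{\mathfrak{K}}\}\subseteq\mathcal{B}(\mathfrak{K})$. With the quotient topology from $\mathcal{U}_{\mathfrak{K}}(P)\simeq\mathcal{U}_{\mathfrak{K}}/G$, $G=\{u\in\mathcal{U}_{\mathfrak{K}}:L_uP=PL_u\}$, it is a real analytic manifold such that $u\mapsto L_uPL_{u^*}$ is a real analytic submersion; its tangent space at $Q$ is $\{L_zQ-QL_z:z\in\mathfrak{K}_{sh}\}\subseteq\mathcal{B}(\mathfrak{K})$. (Bourbaki) A topological space $N$ contained in a manifold $M$ is a submanifold (resp. quasi submanifold) of $M$ if for each $x\in N$ there are a Banach space $E$ and a chart $(\mathcal{W},\phi)$ of $M$ at $x$, $\phi:\mathcal{W}\subseteq M\to E$, such that $\phi(\mathcal{W}\cap N)$ is a neighborhood of $0$ in a complemented (resp. closed) subspace of $E$; complemented means closed with a closed complement. For $N=\mathcal{U}_{\mathfrak{K}}(P)$ with its manifold structure above, this is used through the following criterion: $N$ is a submanifold (resp. quasi submanifold) of $M$ if and only if the topology of $N$ coincides with the topology inherited from $M$ and the differential of the inclusion $N\hookrightarrow M$ has complemented (resp. closed) range at every $x\in N$. All structures are real (in particular $\mathcal{B}(\mathfrak{K})$ is regarded as a real Banach space). *)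

(* Defs.v *)
From HB Require Import structures.
From mathcomp Require Import all_boot all_order all_algebra.
From mathcomp Require Import sesquilinear complex.
From mathcomp Require Import all_classical all_reals all_analysis.

Set Implicit Arguments.
Unset Strict Implicit.
Unset Printing Implicit Defensive.

Import Order.TTheory GRing.Theory Num.Theory.
Import numFieldNormedType.Exports.

Local Open Scope classical_set_scope.
Local Open Scope ring_scope.
Local Open Scope complex_scope.

Section Bounded.
Context {R : realType} {E F : normedModType R[i]}.
Implicit Types (f g : E -> F).

Definition bounded_linear : {pred E -> F} := [pred f |
  `[< linear f /\ exists M : R[i], forall x, `|f x| <= M * `|x| >]].

Lemma bounded_linearP f :
  reflect (linear f /\ exists M : R[i], forall x, `|f x| <= M * `|x|)
    (f \in bounded_linear).
Proof. by rewrite inE; exact: asboolP. Qed.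

Lemma bounded_linear_submod : submod_closed bounded_linear.
Proof.
split.
  apply/bounded_linearP; split=> [k x y|]; first by rewrite /= scaler0 addr0.
  by exists 0 => x; rewrite normr0 mul0r.
move=> k f g /bounded_linearP[lf [M Mf]] /bounded_linearP[lg [N Ng]].
apply/bounded_linearP; split=> [c x y|].
  rewrite !fctE lf lg !scalerDr !scalerA (mulrC k c) -!scalerA.
  by rewrite -!addrA; congr (_ + _); rewrite addrCA.
exists (`|k| * M + N) => x; rewrite !fctE.
rewrite (le_trans (ler_normD _ _))// normrZ mulrDl lerD// -mulrA.
by rewrite ler_wpM2l.
Qed.

HB.instance Definition _ :=
  GRing.isSubmodClosed.Build _ _ bounded_linear bounded_linear_submod.

(* Norms of a normed space over [R[i]] are valued in [R[i]] too, whence the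
   detour through the real part to take a supremum. *)
Definition opnorm f : R[i] :=
  (sup [set complex.Re `|f x| | x in [set x : E | `|x| <= 1]])%:C.

End Bounded.

Record bounded_op {R : realType} (E F : normedModType R[i]) := BoundedOp {
  bop_fun :> E -> F;
  bop_bounded_linear : bop_fun \in bounded_linear }.

Notation "''B' ( E )" := (bounded_op E E)
  (at level 8, format "''B' ( E )") : type_scope.

HB.instance Definition _ (R : realType) (E F : normedModType R[i]) :=
  [isSub of bounded_op E F for @bop_fun R E F].
HB.instance Definition _ (R : realType) (E F : normedModType R[i]) :=
  [Choice of bounded_op E F by <:].
HB.instance Definition _ (R : realType) (E F : normedModType R[i]) :=
  [SubChoice_isSubLmodule of bounded_op E F by <:].

Section BoundedTheory.
Context {R : realType} {E F : normedModType R[i]}.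
Implicit Types (f g : bounded_op E F).

Lemma bop_linear f : linear f.
Proof. by have /bounded_linearP[] := bop_bounded_linear f. Qed.

HB.instance Definition _ f := GRing.isLinear.Build _ _ _ _ (bop_fun f)
  (bop_linear f).

Lemma bopP f g : f =1 g -> f = g.
Proof. by move=> fg; apply/val_inj/funext. Qed.

Lemma Re_ge0 (z : R[i]) : 0 <= z -> (complex.Re z)%:C = z.
Proof. by move=> z0; apply: RRe_real; rewrite ger0_real. Qed.

Lemma bop_bounded f :
  exists2 M : R[i], 0 <= M & forall x, `|f x| <= M * `|x|.
Proof.
have /bounded_linearP[_ [M Mf]] := bop_bounded_linear f.
exists `|M| => // x; have [x0|x0] := eqVneq `|x| 0.
  by rewrite x0 mulr0 (le_trans (Mf x))// x0 mulr0.
have xp : 0 < `|x| by rewrite lt_def x0 normr_ge0.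
have M0 : 0 <= M by rewrite -(pmulr_lge0 _ xp) (le_trans _ (Mf x)).
by rewrite (ger0_norm M0).
Qed.

Lemma opnorm_has_sup f :
  has_sup [set complex.Re `|f x| | x in [set x : E | `|x| <= 1]].
Proof.
split; first by exists (complex.Re `|f 0|), 0 => //=; rewrite normr0.
have [M M0 Mf] := bop_bounded f.
exists (complex.Re M) => _ [x /= x1 <-].
by rewrite -lecR !Re_ge0// (le_trans (Mf x))// ler_piMr.
Qed.

Lemma opnorm_ge0 f : 0 <= opnorm f.
Proof.
rewrite /opnorm lecR; apply: (@le_trans _ _ (complex.Re `|f 0|)).
  by rewrite -lecR Re_ge0 ?normr_ge0//; exact: normr_ge0.
apply: ub_le_sup; first by have [] := opnorm_has_sup f.
by exists 0 => //=; rewrite normr0.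
Qed.

Lemma le_opnorm f x : `|f x| <= opnorm f * `|x|.
Proof.
have [->|x0] := eqVneq x 0; first by rewrite linear0 !normr0 mulr0.
have xp : 0 < `|x| by rewrite normr_gt0.
rewrite -ler_pdivrMr// mulrC -[X in X * _](ger0_norm (_ : 0 <= `|x|^-1)).
  rewrite -normrZ -linearZ /opnorm -[leLHS]Re_ge0// lecR; apply: ub_le_sup.
    by have [] := opnorm_has_sup f.
  by exists (`|x|^-1 *: x) => //=; rewrite normfZV.
by rewrite invr_ge0.
Qed.

Lemma opnorm_le f (M : R[i]) :
  0 <= M -> (forall x, `|f x| <= M * `|x|) -> opnorm f <= M.
Proof.
move=> M0 Mf; rewrite -(Re_ge0 M0) /opnorm lecR.
apply: ge_sup; first by have [] := opnorm_has_sup f.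
move=> _ [x /= x1 <-]; rewrite -lecR !Re_ge0//.
by rewrite (le_trans (Mf x))// ler_piMr.
Qed.

Lemma bop0E x : (0 : bounded_op E F) x = 0. Proof. by []. Qed.
Lemma bopDE f g x : (f + g) x = f x + g x. Proof. by []. Qed.
Lemma bopNE f x : (- f) x = - f x. Proof. by []. Qed.
Lemma bopZE (k : R[i]) f x : (k *: f) x = k *: f x. Proof. by []. Qed.

Lemma opnormD f g : opnorm (f + g) <= opnorm f + opnorm g.
Proof.
apply: opnorm_le => [|x]; first by rewrite addr_ge0 ?opnorm_ge0.
by rewrite bopDE (le_trans (ler_normD _ _))// mulrDl lerD ?le_opnorm.
Qed.

Let opnormZ_le (k : R[i]) f : opnorm (k *: f) <= `|k| * opnorm f.
Proof.
apply: opnorm_le => [|x]; first by rewrite mulr_ge0 ?opnorm_ge0.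
by rewrite bopZE normrZ -mulrA ler_wpM2l ?le_opnorm.
Qed.

Lemma opnormZ (k : R[i]) f : opnorm (k *: f) = `|k| * opnorm f.
Proof.
apply/eqP; rewrite eq_le opnormZ_le andTb.
have [->|k0] := eqVneq k 0; first by rewrite normr0 mul0r opnorm_ge0.
rewrite -ler_pdivlMl ?normr_gt0// -normfV.
by rewrite (le_trans _ (opnormZ_le _ _))// scalerA mulVf// scale1r.
Qed.

Lemma opnorm0_eq0 f : opnorm f = 0 -> f = 0.
Proof.
move=> f0; apply: bopP => x; apply/eqP; rewrite -normr_le0.
by rewrite (le_trans (le_opnorm f x))// f0 mul0r.
Qed.

End BoundedTheory.

HB.instance Definition _ (R : realType) (E F : normedModType R[i]) :=
  Lmodule_isNormed.Build R[i] (bounded_op E F)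
    (@opnormD R E F) (@opnormZ R E F) (@opnorm0_eq0 R E F).

Section Composition.
Context {R : realType} {E F G : normedModType R[i]}.

Lemma normE_bop (f : bounded_op E F) : `|f| = opnorm f. Proof. by []. Qed.

Lemma le_norm_bop (f : bounded_op E F) x : `|f x| <= `|f| * `|x|.
Proof. exact: le_opnorm. Qed.

Lemma norm_bop_le (f : bounded_op E F) (M : R[i]) :
  0 <= M -> (forall x, `|f x| <= M * `|x|) -> `|f| <= M.
Proof. exact: opnorm_le. Qed.

Lemma bop_comp_subproof (f : bounded_op F G) (g : bounded_op E F) :
  f \o g \in bounded_linear.
Proof.
apply/bounded_linearP; split=> [k x y|].
  by rewrite /comp (bop_linear g) (bop_linear f).
exists (opnorm f * opnorm g) => x; rewrite /comp.
rewrite (le_trans (le_opnorm _ _))// -mulrA ler_wpM2l ?opnorm_ge0//.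
exact: le_opnorm.
Qed.

Definition bop_comp (f : bounded_op F G) (g : bounded_op E F) :
  bounded_op E G := BoundedOp (bop_comp_subproof f g).

End Composition.

Lemma bop_id_subproof {R : realType} {E : normedModType R[i]} :
  @idfun E \in bounded_linear.
Proof. by apply/bounded_linearP; split=> //; exists 1 => x; rewrite mul1r. Qed.

Definition bop_id {R : realType} {E : normedModType R[i]} : 'B(E) :=
  BoundedOp bop_id_subproof.

Declare Scope bop_scope.
Delimit Scope bop_scope with B.
Bind Scope bop_scope with bounded_op.
Notation "f \* g" := (bop_comp f%B g%B) : bop_scope.

Section Compact.
Context {R : realType} {E : normedModType R[i]}.
Implicit Types (x y : 'B(E)).

Definition compact_op : {pred 'B(E)} := [pred x : 'B(E) |
  `[< precompact (x @` [set e : E | `|e| <= 1]) >]].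

Lemma compact_opP x :
  reflect (precompact (x @` [set e : E | `|e| <= 1])) (x \in compact_op).
Proof. by rewrite inE; exact: asboolP. Qed.

Lemma precompact_image {V W : normedModType R[i]} (h : V -> W) (A : set V) :
  continuous h -> precompact A -> precompact (h @` A).
Proof.
rewrite precompactE => hc Ac; apply: (@precompact_subset _ _ (h @` closure A)).
  by apply: image_subset; exact: subset_closure.
apply: compact_precompact; first exact: norm_hausdorff.
by apply: continuous_compact => //; exact: continuous_subspaceT.
Qed.

Lemma compact_op_submod : submod_closed compact_op.
Proof.
split.
  apply/compact_opP; apply: (@precompact_subset _ _ [set 0]).
    by move=> _ [e _ <-].
  apply: compact_precompact; first exact: norm_hausdorff.
  exact: compact_set1.
move=> k x y /compact_opP xc /compact_opP yc; apply/compact_opP.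
pose B := [set e : E | `|e| <= 1].
pose h (z : E * E) := k *: z.1 + z.2.
have hc : continuous h.
  move=> z; apply: cvgD; last exact: cvg_snd.
  by apply: cvgZr; exact: cvg_fst.
apply: (@precompact_subset _ _
  (h @` (closure (x @` B) `*` closure (y @` B)))).
  move=> _ [e eB <-]; exists (x e, y e) => //=.
  by split; apply: subset_closure; exists e.
apply: compact_precompact; first exact: norm_hausdorff.
apply: continuous_compact; first exact: continuous_subspaceT.
by apply: compact_setX; rewrite -precompactE.
Qed.

HB.instance Definition _ :=
  GRing.isSubmodClosed.Build _ _ compact_op compact_op_submod.

Lemma compact_op_compl (a y : 'B(E)) :
  y \in compact_op -> (a \* y)%B \in compact_op.
Proof.
move=> /compact_opP yc; apply/compact_opP.
rewrite [X in precompact X](_ : _ = a @` (y @` [set e : E | `|e| <= 1])).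
  apply: precompact_image => //.
  apply: bounded_linear_continuous; apply/linear_boundedP.
  have [M M0 Ma] := bop_bounded a; exists M; split; first exact: ger0_real.
  by move=> N /ltW MN e; rewrite (le_trans (Ma e))// ler_wpM2r.
by rewrite image_comp.
Qed.

End Compact.

Record compact_operator {R : realType} (E : normedModType R[i]) := CompactOp {
  cop_bop :> 'B(E);
  cop_compact : cop_bop \in compact_op }.

Notation "''K' ( E )" := (compact_operator E)
  (at level 8, format "''K' ( E )") : type_scope.

HB.instance Definition _ (R : realType) (E : normedModType R[i]) :=
  [isSub of 'K(E) for @cop_bop R E].
HB.instance Definition _ (R : realType) (E : normedModType R[i]) :=
  [Choice of 'K(E) by <:].
HB.instance Definition _ (R : realType) (E : normedModType R[i]) :=
  [SubChoice_isSubLmodule of 'K(E) by <:].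

Section CompactNorm.
Context {R : realType} {E : normedModType R[i]}.
Implicit Types x y : 'K(E).

Let nrm x : R[i] := `|cop_bop x|.

Let nrmD x y : nrm (x + y) <= nrm x + nrm y.
Proof. exact: ler_normD. Qed.

Let nrmZ (k : R[i]) x : nrm (k *: x) = `|k| * nrm x.
Proof. exact: normrZ. Qed.

Let nrm0_eq0 x : nrm x = 0 -> x = 0.
Proof. by move=> /normr0_eq0 x0; exact: val_inj. Qed.

HB.instance Definition _ :=
  Lmodule_isNormed.Build R[i] 'K(E) nrmD nrmZ nrm0_eq0.

End CompactNorm.

Section LeftMultiplication.
Context {R : realType} {E : normedModType R[i]}.

Lemma copPE (k : R[i]) (y z : 'K(E)) e :
  (k *: y + z : 'K(E)) e = k *: y e + z e.
Proof. by []. Qed.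

Lemma bop_compE (x y : 'B(E)) e : (x \* y)%B e = x (y e).
Proof. by []. Qed.

Definition lmul_fun (x : 'B(E)) (y : 'K(E)) : 'K(E) :=
  CompactOp (compact_op_compl x (cop_compact y)).

Lemma lmul_subproof (x : 'B(E)) : lmul_fun x \in bounded_linear.
Proof.
apply/bounded_linearP; split=> [k y z|].
  apply: val_inj; apply: bopP => e.
  by rewrite [RHS]copPE [LHS]bop_compE copPE (bop_linear x).
exists `|x| => y; apply: norm_bop_le; first by rewrite mulr_ge0.
move=> e; rewrite (le_trans (le_norm_bop x (y e)))// -mulrA ler_wpM2l//.
exact: le_norm_bop.
Qed.

Definition lmul (x : 'B(E)) : 'B('K(E)) := BoundedOp (lmul_subproof x).

End LeftMultiplication.

Section FiniteDimension.
Context {R : realType} {V : normedModType R[i]}.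

Definition finite_dimensional (A : set V) := exists n (v : 'I_n -> V),
  forall x, A x -> exists c : 'I_n -> R[i], x = \sum_(i < n) c i *: v i.

Definition infinite_rank (a : 'B(V)) := ~ finite_dimensional (range a).

Definition separable := exists2 D : set V, countable D & dense D.

End FiniteDimension.

Arguments separable {R} V.

Section Hilbert.
Context {R : realType} {H : completeNormedModType R[i]}.
Variable dot : {dot H for Num.conj}.

Definition is_adjoint (a b : 'B(H)) := forall x y, dot (a x) y = dot x (b y).

(* On a Hilbert space there is exactly one [b] with [is_adjoint a b], so that
   the default value [0] is never used. *)
Definition adjoint (a : 'B(H)) : 'B(H) := xget 0 [set b | is_adjoint a b].

Definition hermitian_projection (p : 'B(H)) :=
  adjoint p = p /\ (p \* p)%B = p.

Definition unitary (u : 'B(H)) :=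
  (u \* adjoint u)%B = bop_id /\ (adjoint u \* u)%B = bop_id.

Definition unitary_compact : set 'B(H) :=
  [set u | unitary u /\ u - bop_id \in compact_op].

Definition skew_compact : set 'K(H) :=
  [set z | adjoint z = - (z : 'B(H))].

Definition unitary_orbit_map (P : 'B('K(H))) (u : 'B(H)) : 'B('K(H)) :=
  (lmul u \* P \* lmul (adjoint u))%B.

Definition unitary_orbit (P : 'B('K(H))) : set 'B('K(H)) :=
  unitary_orbit_map P @` unitary_compact.

(* The quotient topology: two unitaries have the same image under
   [unitary_orbit_map P] iff they are in the same left coset of the isotropy
   group G of [P], so that the open sets of the quotient by G correspond to
   the subsets of the orbit with an open preimage in the unitary group. *)
Definition unitary_orbit_open (P : 'B('K(H))) (V : set 'B('K(H))) :=
  V `<=` unitary_orbit P /\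
  open (unitary_orbit_map P @^-1` V : set (subspace unitary_compact)).

Definition unitary_orbit_tangent (Q : 'B('K(H))) : set 'B('K(H)) :=
  [set (lmul z \* Q)%B - (Q \* lmul z)%B | z in skew_compact].

End Hilbert.

Section Submanifold.
Context {R : realType} {M : normedModType R[i]}.

Definition real_subspace (S : set M) :=
  [/\ S 0, forall x y, S x -> S y -> S (x + y) &
      forall (r : R) x, S x -> S (r%:C *: x)].

Definition closed_subspace (S : set M) := real_subspace S /\ closed S.

Definition complemented (S : set M) := closed_subspace S /\
  exists T, [/\ closed_subspace T, S `&` T = [set 0] &
    forall x, exists s t, [/\ S s, T t & x = s + t]].

(* [N] carries a manifold structure of its own, with open sets [openN] and with
   [T Q] the range of the differential at [Q] of the inclusion of [N] in [M].
   For such an [N], (quasi) submanifolds are taken in the following sense: the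
   topology of [N] is the one inherited from [M], and these ranges are
   complemented (resp. closed) subspaces. *)
Section Def.
Variables (N : set M) (openN : set (set M)) (T : M -> set M).

Definition inherited_topology :=
  forall V, V `<=` N -> (openN V <-> open (V : set (subspace N))).

Definition submanifold :=
  inherited_topology /\ forall Q, N Q -> complemented (T Q).

Definition quasi_submanifold :=
  inherited_topology /\ forall Q, N Q -> closed_subspace (T Q).

End Def.
End Submanifold.

(* Families are indexed by 1, 2, and so on up to [w], where [None] stands for
   infinity. *)
Definition index_le (i : nat) (w : option nat) : bool :=
  if w is Some n then (i <= n)%N else true.

(* [p 0] is 1 minus the strong sum of the family; for finite [w] the partial
   sums are eventually constant. *)
Definition projection_family {R : realType} {H : completeNormedModType R[i]}
    (dot : {dot H for Num.conj}) (w : option nat) (p : nat -> 'B(H)) :=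
  [/\ forall i, (0 < i)%N -> index_le i w ->
        hermitian_projection dot (p i) /\ p i <> 0,
      forall i j, (0 < i)%N -> index_le i w -> (0 < j)%N -> index_le j w ->
        i <> j -> (p i \* p j)%B = 0 &
      forall x, \sum_(1 <= i < n.+1 | index_le i w) p i x @[n --> \oo] -->
        x - p 0 x].

Definition pinching {R : realType} {H : completeNormedModType R[i]}
    (w : option nat) (p : nat -> 'B(H)) (P : 'B('K(H))) :=
  forall x : 'K(H),
    \sum_(1 <= i < n.+1 | index_le i w) (p i \* x \* p i)%B @[n --> \oo] -->
    (P x : 'B(H)).

(* Main.v *)
(* Write [delta z = L_z P - P L_z] ([lcomm] below), so that the tangent space
   at P is the image of the skew-adjoint compact operators z under delta.
   Testing delta z on finite sums of rank one projections in the ranges of the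
   p_j bounds the off-diagonal part of z by twice the norm of delta z, while
   delta kills the block diagonal part. Thus the tangent spaces are closed. The
   same estimate, applied to u - 1 for a unitary u, shows that u is close to a
   block diagonal operator when [L_u P L_{u^*}] is close to P; the polar part
   of the latter operator lies in the isotropy group of P, so the orbit map is
   open onto the orbit.

   If w is finite and a single p_i has infinite rank, the off-diagonal part of
   z is determined by finitely many columns z p_j with p_j of finite rank, and
   these columns can be read off from the values of delta z at rank one
   operators. The resulting formula makes sense on all of B(K) and yields a
   bounded projection onto the tangent space. Otherwise, there are orthonormal
   sequences f_n and g_n, orthogonal to each other, with f_n and g_n in the
   ranges of different projections. The operators mapping f_n to a_n g_n and
   g_n to - a_n f_n embed the bounded sequences a in B(K), in such a way that a
   complement of the tangent space would give a complement of the null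
   sequences in the bounded ones, against the theorem of Phillips. *)

Require Import Defs.
From mathcomp Require Import all_boot all_order all_algebra.
From mathcomp Require Import sesquilinear complex.
From mathcomp Require Import all_classical all_reals all_analysis.
From mathcomp Require Import ring lra.
Import Order.TTheory GRing.Theory Num.Theory.
Import numFieldNormedType.Exports.
Set Implicit Arguments.
Unset Strict Implicit.
Unset Printing Implicit Defensive.
Local Open Scope classical_set_scope.
Local Open Scope ring_scope.
Local Open Scope complex_scope.
Local Notation "f ∙ g" := (bop_comp f g) (at level 40, left associativity).

(** * Real-valued norms and completeness *)

(** The tangent space at [P] is a copy of the off-diagonal parts of skew-adjoint compact operators,
    whereas [lcomm] makes sense for every bounded [z]. This decides the dichotomy. If there are
    finitely many off-diagonal blocks and each has a side of finite rank, the off-diagonal part of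
    any bounded operator is compact, so that reading blocks off an arbitrary element of ['B('K(H))]
    still produces a tangent vector. In the other cases some bounded off-diagonal operators are not
    compact. Two obstacles shape the details. The test operators for [lcomm] live in the ranges of
    the [p j] with [0 < j] and miss the column of [p 0], which has to be recovered from the adjoint
    or from the sum of the projections. And [adjoint] has a default value, so an operator is
    accompanied by a second one related to it by [is_adjoint], produced in each case by a limit, a
    finite rank construction or an inverse. Finally, skew-adjointness is preserved by real scalars
    only: projections onto the tangent space are real linear functions and not bounded operators in
    the complex sense. *)

Definition cabs {R : realType} (z : R[i]) : R := complex.Re `|z|.
(** Real-valued versions of the [R[i]]-valued norms, within reach of [lra] and [nra]. *)
Definition nrm {R : realType} {V : normedModType R[i]} (x : V) : R :=
  complex.Re `|x|.

Section RealNorm.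
Context {R : realType}.

Lemma cabsE (z : R[i]) : `|z| = (cabs z)%:C.
Proof. by rewrite /cabs Re_ge0. Qed.

Lemma cabs_ge0 (z : R[i]) : 0 <= cabs z.
Proof. by rewrite -lecR -cabsE; exact: normr_ge0. Qed.

Lemma cabsM (z t : R[i]) : cabs (z * t) = cabs z * cabs t.
Proof. by apply: complexI; rewrite rmorphM /= -!cabsE normrM. Qed.

Lemma cabsD (z t : R[i]) : cabs (z + t) <= cabs z + cabs t.
Proof. by rewrite -lecR rmorphD /= -!cabsE ler_normD. Qed.

Lemma cabs_real (r : R) : cabs r%:C = `|r|.
Proof. by apply: complexI; rewrite -cabsE normc_def /= expr0n /= addr0 sqrtr_sqr. Qed.

Lemma cabs_eq0 (z : R[i]) : cabs z = 0 -> z = 0.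
Proof. by move=> z0; apply/normr0_eq0; rewrite cabsE z0. Qed.

Lemma Re_le_cabs (z : R[i]) : `|complex.Re z| <= cabs z.
Proof.
by rewrite /cabs normc_def /= -sqrtr_sqr ler_wsqrtr// lerDl sqr_ge0.
Qed.

Section Norm.
Context {V : normedModType R[i]}.
Implicit Types x y : V.

Lemma nrmE x : `|x| = (nrm x)%:C.
Proof. by rewrite /nrm Re_ge0. Qed.

Lemma nrm_ge0 x : 0 <= nrm x.
Proof. by rewrite -lecR -nrmE; exact: normr_ge0. Qed.

Lemma nrm0 : nrm (0 : V) = 0.
Proof. by rewrite /nrm normr0. Qed.

Lemma nrm_eq0 x : nrm x = 0 -> x = 0.
Proof. by move=> x0; apply/normr0_eq0; rewrite nrmE x0. Qed.

Lemma nrm_gt0 x : x <> 0 -> 0 < nrm x.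
Proof. by move=> x0; rewrite lt_neqAle nrm_ge0 andbT eq_sym; apply/eqP => /nrm_eq0. Qed.

Lemma nrmD x y : nrm (x + y) <= nrm x + nrm y.
Proof. by rewrite -lecR rmorphD /= -!nrmE ler_normD. Qed.

Lemma nrmN x : nrm (- x) = nrm x.
Proof. by rewrite /nrm normrN. Qed.

Lemma nrmB x y : nrm (x - y) <= nrm x + nrm y.
Proof. by rewrite -(nrmN y) nrmD. Qed.

Lemma nrmC x y : nrm (x - y) = nrm (y - x).
Proof. by rewrite -nrmN opprB. Qed.

Lemma nrm_tri y x z : nrm (x - z) <= nrm (x - y) + nrm (y - z).
Proof. by rewrite (le_trans _ (nrmD _ _))// addrA subrK. Qed.

Lemma nrmZ (c : R[i]) x : nrm (c *: x) = cabs c * nrm x.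
Proof. by apply: complexI; rewrite rmorphM /= -!nrmE -cabsE normrZ. Qed.

Lemma nrmZr (r : R) x : nrm (r%:C *: x) = `|r| * nrm x.
Proof. by rewrite nrmZ cabs_real. Qed.

Lemma nrm_sum I (s : seq I) (Q : pred I) (F : I -> V) :
  nrm (\sum_(i <- s | Q i) F i) <= \sum_(i <- s | Q i) nrm (F i).
Proof.
elim/big_ind2 : _ => //; first by rewrite nrm0.
by move=> x r y t xr yt; rewrite (le_trans (nrmD _ _))// lerD.
Qed.

Lemma nrm_small x : (forall e : R, 0 < e -> nrm x <= e) -> x = 0.
Proof.
move=> xe; apply: nrm_eq0; apply/eqP; rewrite eq_le nrm_ge0 andbT.
by apply/ler_addgt0Pl => e /xe; rewrite addr0.
Qed.

End Norm.

Section Topology.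
Context {V : normedModType R[i]}.
Implicit Types x y : V.

Lemma nbhs_nrmP x (A : set V) :
  nbhs x A <-> exists2 e : R, 0 < e & forall y, nrm (y - x) < e -> A y.
Proof.
split.
  move=> /nbhs_normP[e /= e0 eA]; exists (complex.Re e).
    by rewrite -ltcR Re_ge0// ltW.
  move=> y yx; apply: eA; rewrite /= distrC nrmE -(Re_ge0 (ltW e0)).
  by rewrite ltcR.
move=> [e e0 eA]; apply/nbhs_normP; exists e%:C; first by rewrite /= ltcR.
by move=> y /=; rewrite distrC nrmE ltcR; exact: eA.
Qed.

Lemma cvg_nrmP (u : nat -> V) l : u n @[n --> \oo] --> l <->
  forall e : R, 0 < e -> exists N, forall n, (N <= n)%N -> nrm (u n - l) < e.
Proof.
split.
  move=> ul e e0.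
  have /ul [N _ Nu] : nbhs l [set y | nrm (y - l) < e].
    by apply/nbhs_nrmP; exists e.
  by exists N => n /Nu.
move=> ul A /nbhs_nrmP[e /ul[N Nu] eA].
by exists N => // n /= /Nu; exact: eA.
Qed.

Lemma closed_nrmP (A : set V) : closed A <->
  forall x, (forall e : R, 0 < e -> exists2 y, A y & nrm (y - x) < e) -> A x.
Proof.
split=> [cA x xA|cA x xA].
  apply: cA => B /nbhs_nrmP[e e0 eB].
  by have [y Ay yx] := xA _ e0; exists y; split=> //; exact: eB.
apply: cA => e e0.
have [|y [Ay yx]] := xA [set y | nrm (y - x) < e]; last by exists y.
by apply/nbhs_nrmP; exists e.
Qed.

(** The points outside [N] are isolated in [subspace N], so openness is a condition at the points of
    [A] in [N] only. *)
Lemma open_subspace_nrmP (N A : set V) : open (A : set (subspace N)) <->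
  forall x, A x -> N x ->
    exists2 e : R, 0 < e & forall y, N y -> nrm (y - x) < e -> A y.
Proof.
have inE x : N x -> nbhs (x : subspace N) = within N (nbhs x).
  by move=> Nx; rewrite (nbhs_subspace_in Nx).
have outE x : ~ N x -> nbhs (x : subspace N) = globally [set x].
  by move=> Nx; rewrite (nbhs_subspace_out Nx).
rewrite openE; split=> [oA x Ax Nx|oA x Ax].
  have /= := oA x Ax; rewrite /interior inE// => /nbhs_nrmP[e e0 eA].
  by exists e => // y Ny /eA; exact.
rewrite /interior /=; case: (pselect (N x)) => Nx.
  rewrite inE//; have [e e0 eA] := oA x Ax Nx.
  by apply/nbhs_nrmP; exists e => // y yx Ny; exact: eA.
by rewrite outE// => _ ->.
Qed.

End Topology.
End RealNorm.

Section Operators.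
Context {R : realType} {E F : normedModType R[i]}.

Lemma nrm_bop (f : bounded_op E F) x : nrm (f x) <= nrm f * nrm x.
Proof. by rewrite -lecR rmorphM /= -!nrmE; exact: le_norm_bop. Qed.

Lemma nrm_bop_le (f : bounded_op E F) (M : R) :
  0 <= M -> (forall x, nrm (f x) <= M * nrm x) -> nrm f <= M.
Proof.
move=> M0 fM; rewrite -lecR -nrmE; apply: norm_bop_le; first by rewrite lecR.
by move=> x; rewrite !nrmE -rmorphM /= lecR.
Qed.

Lemma bop_of_linear (f : E -> F) (M : R) : linear f ->
  (forall x, nrm (f x) <= M * nrm x) ->
  exists T : bounded_op E F, forall x, T x = f x.
Proof.
move=> lf fM; have bf : f \in bounded_linear.
  apply/bounded_linearP; split=> //; exists M%:C => x.
  by rewrite !nrmE -rmorphM /= lecR.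
by exists (BoundedOp bf).
Qed.

End Operators.

Lemma nrm_comp {R : realType} {E F G : normedModType R[i]}
  (f : bounded_op F G) (g : bounded_op E F) :
  nrm (f ∙ g) <= nrm f * nrm g.
Proof.
apply: nrm_bop_le => [|x]; first by rewrite mulr_ge0 ?nrm_ge0.
rewrite (le_trans (nrm_bop f (g x)))// -mulrA ler_wpM2l ?nrm_ge0//.
exact: nrm_bop.
Qed.

Section Completeness.
Context {R : realType}.

Definition seq_cauchy {V : normedModType R[i]} (u : nat -> V) :=
  forall e : R, 0 < e -> exists N, forall m n, (N <= m)%N -> (N <= n)%N ->
    nrm (u m - u n) < e.

(** Completeness is a predicate on normed modules, to be proved below for ['B(E)] and ['K(E)], which
    are not declared as complete spaces. *)
Definition seq_complete (V : normedModType R[i]) :=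
  forall u : nat -> V, seq_cauchy u -> exists l : V, u n @[n --> \oo] --> l.

Lemma complete_seq_complete (V : completeNormedModType R[i]) : seq_complete V.
Proof.
move=> u cu; apply/cvg_ex; apply: cauchy_cvg; apply/cauchyP => e e0.
have /cu[N Nu] : 0 < complex.Re e by rewrite -ltcR Re_ge0// ltW.
exists (u N), N => // n /= Nn; rewrite -ball_normE /ball_ /= nrmE.
by rewrite -(Re_ge0 (ltW e0)) ltcR Nu.
Qed.

Lemma seq_complete_bop (E F : normedModType R[i]) :
  seq_complete F -> seq_complete (bounded_op E F).
Proof.
move=> Fc u cu.
have cux x : seq_cauchy (fun n => u n x).
  move=> e e0; have x1 : 0 < nrm x + 1 by rewrite ltr_wpDl ?nrm_ge0.
  have [|N Nu] := cu (e / (nrm x + 1)); first by rewrite divr_gt0.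
  exists N => m n Nm Nn; have := nrm_bop (u m - u n) x.
  move=> /le_lt_trans; apply; rewrite -[ltRHS](divfK (lt0r_neq0 x1)).
  have := Nu m n Nm Nn; have := nrm_ge0 (u m - u n); have := nrm_ge0 x.
  move: (nrm x) (nrm _) (e / _) => a b c *; nra.
have /choice[f fE] x := Fc _ (cux x).
(* Letting one index of the Cauchy estimate go to infinity makes the pointwise convergence uniform
   on bounded sets; this yields both the boundedness of [f] and the convergence in norm. *)
have fe e : 0 < e -> exists N, forall n, (N <= n)%N -> forall x,
    nrm (u n x - f x) <= e * nrm x.
  move=> e0; have [N Nu] := cu e e0; exists N => n Nn x.
  apply/ler_addgt0Pl => d d0.
  have /cvg_nrmP/(_ d d0)[N' N'u] := fE x.
  have := N'u (maxn N N') (leq_maxr _ _).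
  have := nrm_bop (u n - u (maxn N N')) x.
  have := Nu n (maxn N N') Nn (leq_maxl _ _).
  have := nrm_tri (u (maxn N N') x) (u n x) (f x); have := nrm_ge0 x.
  rewrite !bopDE !bopNE.
  move: (nrm _) (nrm _) (nrm _) (nrm _) (nrm _) => a b c d1 f1 *; nra.
have lf : linear f.
  move=> k x y; have := fE (k *: x + y).
  have -> : (fun n => u n (k *: x + y)) = (fun n => k *: u n x + u n y).
    by apply/funext => n; rewrite linearP.
  move/(cvg_unique (@norm_hausdorff _ F)); apply.
  by apply: cvgD; [apply: cvgZr|]; exact: fE.
have [N Nu] := fe 1 ltr01.
have [T TE] : exists T : bounded_op E F, forall x, T x = f x.
  apply: (@bop_of_linear _ _ _ f (nrm (u N) + 1)) => // x.
  rewrite -[f x](subKr (u N x)) (le_trans (nrmB _ _))// mulrDl lerD ?nrm_bop//.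
  exact: Nu.
exists T; apply/cvg_nrmP => e e0; have [|N' N'u] := fe (e / 2).
  by rewrite divr_gt0.
exists N' => n N'n; apply: (@le_lt_trans _ _ (e / 2)); last by lra.
apply: nrm_bop_le => [|x]; first by rewrite divr_ge0// ltW.
by rewrite bopDE bopNE TE N'u.
Qed.

End Completeness.

(** * Compact operators *)

Section CompactOperators.
Context {R : realType}.

Lemma ultra_has (T : Type) (U : eqType) (F : set_system T) (B : U -> set T)
    (s : seq U) : UltraFilter F ->
  F [set x | exists2 y, y \in s & B y x] -> exists y, F (B y).
Proof.
move=> FU; elim: s => [|y s IH] Fs.
  suff /filter_not_empty : F set0 by [].
  by apply: filterS Fs => x [].
have [FB|FB] := in_ultra_setVsetC (B y) FU; first by exists y.
apply: IH; apply: filterS (filterI Fs FB) => x [[z + Bz] nB].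
by rewrite in_cons => /orP[/eqP zy|zs]; [case: nB; rewrite -zy|exists z].
Qed.

Definition totally_bounded {V : normedModType R[i]} (A : set V) :=
  forall e : R, 0 < e -> exists s : seq V, forall x, A x ->
    exists2 y, y \in s & nrm (x - y) < e.

Lemma precompact_totally_bounded {V : normedModType R[i]} (A : set V) :
  precompact A -> totally_bounded A.
Proof.
rewrite precompactE compact_cover => cA e e0.
have [||D _ DA] := cA V setT (fun y => ball y e%:C).
- by move=> y _; exact: ball_open.
- by move=> x _; exists x => //; apply: ballxx; rewrite ltcR.
exists (finmap.enum_fset D) => x Ax.
have [y /= yD] := DA x (subset_closure Ax).
rewrite -ball_normE /ball_ /= distrC nrmE ltcR => xy.
by exists y.
Qed.

(** An ultrafilter on the closure contains one of the finitely many balls of radius [e] that cover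
    it; hence it is Cauchy and converges. *)
Lemma totally_bounded_precompact {V : completeNormedModType R[i]}
    (A : set V) : totally_bounded A -> precompact A.
Proof.
move=> tA; rewrite precompactE compact_ultra => F FU FA.
have /cauchy_cvg Fc : cauchy F.
  apply: cauchy_exP => e e0.
  have /tA[s sA] : 0 < complex.Re e / 2.
    by rewrite divr_gt0// -ltcR Re_ge0// ltW.
  apply: (@ultra_has _ _ F (fun y => ball y e) s); apply: filterS FA => x Ax.
  have [|z [Az zx]] := Ax [set z | nrm (z - x) < complex.Re e / 2].
    apply/nbhs_nrmP; exists (complex.Re e / 2) => //.
    by rewrite divr_gt0// -ltcR Re_ge0// ltW.
  have [y ys zy] := sA z Az; exists y => //.
  rewrite -ball_normE /ball_ /= distrC nrmE -(Re_ge0 (ltW e0)) ltcR.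
  have := nrm_tri z x y; rewrite (nrmC x z); move: zx => /= ? ?; lra.
exists (lim F); split=> //.
by apply: (@closed_cvg _ _ F _ id (closure A)) => //; exact: closed_closure.
Qed.

Lemma compact_op_tb {E : normedModType R[i]} (x : 'B(E)) : x \in compact_op ->
  totally_bounded (x @` [set e : E | `|e| <= 1]).
Proof. by move=> /compact_opP; exact: precompact_totally_bounded. Qed.

Lemma le1_nrm {E : normedModType R[i]} (x : E) : (`|x| <= 1) = (nrm x <= 1).
Proof. by rewrite nrmE -lecR. Qed.

Lemma compact_op_compr {E : normedModType R[i]} (x y : 'B(E)) :
  x \in compact_op -> x ∙ y \in compact_op.
Proof.
move=> /compact_opP cx; apply/compact_opP.
pose M := nrm y + 1; have M0 : 0 < M by rewrite ltr_wpDl ?nrm_ge0.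
apply: (@precompact_subset _ _
  ((fun z => M%:C *: z) @` (x @` [set e : E | `|e| <= 1]))).
  move=> _ [e /= e1 <-]; exists (x (M^-1%:C *: y e)).
    exists (M^-1%:C *: y e) => //=; rewrite le1_nrm nrmZr gtr0_norm ?invr_gt0//.
    rewrite mulrC ler_pdivrMr// mul1r (le_trans (nrm_bop _ _))//.
    move: e1; rewrite le1_nrm => e1; rewrite /M.
    by have := nrm_ge0 y; have := nrm_ge0 e; move: (nrm e) (nrm y) e1 => *; nra.
  by rewrite linearZ /= scalerA -rmorphM /= divff ?lt0r_neq0// scale1r.
apply: precompact_image => //.
by move=> z; apply: cvgZr; exact: cvg_id.
Qed.

Lemma compact_op_closed {E : completeNormedModType R[i]} (x : 'B(E)) :
  (forall e : R, 0 < e -> exists2 y, y \in compact_op & nrm (y - x) < e) ->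
  x \in compact_op.
Proof.
move=> xc; apply/compact_opP/totally_bounded_precompact => e e0.
have /xc[y /compact_op_tb yc yx] : 0 < e / 2 by rewrite divr_gt0.
have /yc[s sy] : 0 < e / 2 by rewrite divr_gt0.
exists s => _ [h /= h1 <-]; have [|z zs yz] := sy (y h); first by exists h.
exists z => //; rewrite (le_lt_trans (nrm_tri (y h) _ _))// (nrmC (x h)).
have : nrm (y h - x h) <= nrm (y - x).
  rewrite (le_trans (nrm_bop (y - x) h))// ler_piMr ?nrm_ge0//.
  by rewrite -le1_nrm.
by move: yx yz; lra.
Qed.

Lemma seq_complete_cop (E : completeNormedModType R[i]) : seq_complete 'K(E).
Proof.
move=> u cu.
have [x xE] := @seq_complete_bop R E E (@complete_seq_complete _ E)
  (fun n => u n : 'B(E)) cu.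
have xc : x \in compact_op.
  apply: compact_op_closed => e e0; have /cvg_nrmP/(_ e e0)[N Nx] := xE.
  by exists (u N); [exact: cop_compact|exact: Nx].
by exists (CompactOp xc); apply/cvg_nrmP => e e0; have /cvg_nrmP/(_ e e0) := xE.
Qed.

(** On the unit ball the coefficient [c] is at most [nrm x / nrm v], so the image lies in that of a
    compact square of real and imaginary parts. *)
Lemma compact_op_rank1 {E : completeNormedModType R[i]} (x : 'B(E)) (v : E) :
  (forall h, exists c, x h = c *: v) -> x \in compact_op.
Proof.
move=> xv; have [v0|/eqP v0] := eqVneq v 0.
  apply/compact_opP; apply: (@precompact_subset _ _ [set 0]).
    by move=> _ [h _ <-] /=; have [c ->] := xv h; rewrite v0 scaler0.
  by apply: compact_precompact; [exact: norm_hausdorff|exact: compact_set1].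
have /nrm_gt0 vp := v0.
pose M := nrm x / nrm v.
pose f (z : R * R) : E := z.1%:C *: v + ('i%C * z.2%:C) *: v.
have cC : continuous (fun r : R => r%:C *: v).
  move=> r A /nbhs_nrmP[e e0 eA]; apply/nbhs_normP.
  exists (e / nrm v); first by rewrite /= divr_gt0.
  move=> t /=; rewrite distrC ltr_pdivlMr// => rt; apply: eA.
  by rewrite -scalerBl -rmorphB /= nrmZr.
have cf : continuous f.
  move=> z; apply: cvgD.
    exact: (@cvg_comp _ _ _ fst (fun r : R => r%:C *: v) (nbhs z) (nbhs z.1) _
      cvg_fst (cC z.1)).
  under eq_fun do rewrite -scalerA.
  rewrite -scalerA; apply: cvgZr.
  exact: (@cvg_comp _ _ _ snd (fun r : R => r%:C *: v) (nbhs z) (nbhs z.2) _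
    cvg_snd (cC z.2)).
apply/compact_opP; apply: (@precompact_subset _ _ (f @` (`[- M, M] `*` `[- M, M]))).
  move=> _ [h /= h1 <-]; have [c xc] := xv h.
  have cM : cabs c <= M.
    rewrite /M ler_pdivlMr// -nrmZ -xc (le_trans (nrm_bop _ _))//.
    by move: h1; rewrite le1_nrm => h1; rewrite ler_piMr ?nrm_ge0.
  exists (complex.Re c, complex.Im c) => /=; last first.
    by rewrite /f /= -scalerDl -complexE xc.
  rewrite !in_itv /= -!ler_norml; split.
    exact: le_trans (Re_le_cabs c) cM.
  have -> : complex.Im c = complex.Re (- ('i%C * c)).
    by case: c {xc cM} => a b; rewrite /=; ring.
  by rewrite (le_trans (Re_le_cabs _))// /cabs normrN normrM normCi mul1r.
apply: compact_precompact; first exact: norm_hausdorff.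
apply: continuous_compact; first exact: continuous_subspaceT.
by apply: compact_setX; exact: segment_compact.
Qed.

End CompactOperators.

(** * Inner products and adjoints *)

Lemma conj_conjc {R : realType} (z : R[i]) : Num.conj z = z^*.
Proof. by []. Qed.

Section InnerProduct.
Context {R : realType} {H : completeNormedModType R[i]}.
Variable dot : {dot H for Num.conj}.
Hypothesis norm_dot : forall x : H, `|x| ^+ 2 = dot x x.
Implicit Types (x y z : H) (a b c : 'B(H)).

Lemma dotC x y : dot x y = Num.conj (dot y x).
Proof. by rewrite hermC expr0 mul1r. Qed.

Lemma dotDl x y z : dot (x + y) z = dot x z + dot y z.
Proof. exact: linearDl. Qed.

Lemma dotDr x y z : dot x (y + z) = dot x y + dot x z.
Proof. exact: linearDr. Qed.

Lemma dotNl x y : dot (- x) y = - dot x y.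
Proof. exact: linearNl. Qed.

Lemma dotNr x y : dot x (- y) = - dot x y.
Proof. exact: linearNr. Qed.

Lemma dotBl x y z : dot (x - y) z = dot x z - dot y z.
Proof. exact: linearBl. Qed.

Lemma dotBr x y z : dot x (y - z) = dot x y - dot x z.
Proof. exact: linearBr. Qed.

Lemma dot0l x : dot 0 x = 0.
Proof. exact: linear0l. Qed.

Lemma dot0r x : dot x 0 = 0.
Proof. exact: linear0r. Qed.

Lemma dotZl (k : R[i]) x y : dot (k *: x) y = k * dot x y.
Proof. exact: linearZl_LR. Qed.

Lemma dotZr (k : R[i]) x y : dot x (k *: y) = Num.conj k * dot x y.
Proof. exact: linearZr_LR. Qed.

Lemma dot_suml I (r : seq I) (Q : pred I) (F : I -> H) y :
  dot (\sum_(i <- r | Q i) F i) y = \sum_(i <- r | Q i) dot (F i) y.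
Proof. exact: linear_sumlz. Qed.

Lemma dot_sumr I (r : seq I) (Q : pred I) (F : I -> H) y :
  dot y (\sum_(i <- r | Q i) F i) = \sum_(i <- r | Q i) dot y (F i).
Proof. exact: linear_sumr. Qed.

Lemma dot_nrm x : dot x x = (nrm x ^+ 2)%:C.
Proof. by rewrite -norm_dot nrmE -rmorphXn. Qed.

Lemma dot_eq0C x y : dot x y = 0 -> dot y x = 0.
Proof. by move=> xy; rewrite dotC xy rmorph0. Qed.

Lemma pythagoras x y : dot x y = 0 -> nrm (x + y) ^+ 2 = nrm x ^+ 2 + nrm y ^+ 2.
Proof.
move=> xy; apply: complexI; rewrite rmorphD /= -!dot_nrm.
by rewrite dotDl !dotDr xy (dot_eq0C xy) addr0 add0r.
Qed.

Lemma cauchy_schwarz x y : cabs (dot x y) <= nrm x * nrm y.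
Proof.
have [->|y0] := eqVneq y 0; first by rewrite dot0r nrm0 mulr0 /cabs normr0.
have yp : 0 < nrm y by apply: nrm_gt0; apply/eqP.
pose k := dot x y / (nrm y ^+ 2)%:C.
have o : dot (x - k *: y) (k *: y) = 0.
  rewrite dotZr dotBl dotZl dot_nrm divfK ?subrr ?mulr0//.
  by rewrite -(rmorph0 (real_complex R)) (inj_eq (@complexI R)) lt0r_neq0 ?exprn_gt0.
have := pythagoras o; rewrite subrK => xE.
have : nrm (k *: y) <= nrm x.
  by rewrite -ler_sqr ?nnegrE ?nrm_ge0// xE lerDr sqr_ge0.
rewrite nrmZ /k cabsM -rmorphV /= ?unitfE ?lt0r_neq0 ?exprn_gt0//.
rewrite cabs_real gtr0_norm ?invr_gt0 ?exprn_gt0// expr2 invfM mulrA.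
by rewrite divfK ?lt0r_neq0// ler_pdivrMr.
Qed.

Lemma dot_ext x y : (forall z, dot x z = dot y z) -> x = y.
Proof.
move=> xy; apply/eqP; rewrite -subr_eq0 -(@dnorm_eq0 _ _ dot) dotBl.
by rewrite xy subrr.
Qed.

Lemma adj_sym a b : is_adjoint dot a b -> is_adjoint dot b a.
Proof. by move=> ab x y; rewrite dotC -ab -dotC. Qed.

Lemma adj_uniq a b c : is_adjoint dot a b -> is_adjoint dot a c -> b = c.
Proof.
move=> ab ac; apply: bopP => x; apply: dot_ext => y.
by rewrite (adj_sym ab) (adj_sym ac).
Qed.

Lemma adjointE a b : is_adjoint dot a b -> adjoint dot a = b.
Proof.
move=> ab; apply: (@adj_uniq a) => //.
by rewrite /adjoint; case: xgetP => [_ -> //|/(_ b)].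
Qed.

Lemma adj0 : is_adjoint dot 0 0.
Proof. by move=> x y; rewrite !bop0E dot0l dot0r. Qed.

(* [adjoint] takes the value [0] on operators without an adjoint, so that an
   operator with another value has one. *)
Lemma adjointP a : adjoint dot a <> 0 -> is_adjoint dot a (adjoint dot a).
Proof. by rewrite /adjoint; case: xgetP => [_ -> //|_ []]. Qed.

Lemma adj_id : is_adjoint dot bop_id bop_id.
Proof. by []. Qed.

Lemma adjD a a' b b' : is_adjoint dot a b -> is_adjoint dot a' b' ->
  is_adjoint dot (a + a') (b + b').
Proof. by move=> ab ab' x y; rewrite !bopDE dotDl dotDr ab ab'. Qed.

Lemma adjN a b : is_adjoint dot a b -> is_adjoint dot (- a) (- b).
Proof. by move=> ab x y; rewrite !bopNE dotNl dotNr ab. Qed.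

Lemma adjB a a' b b' : is_adjoint dot a b -> is_adjoint dot a' b' ->
  is_adjoint dot (a - a') (b - b').
Proof. by move=> ab ab'; apply: adjD => //; exact: adjN. Qed.

Lemma adjZr (r : R) a b : is_adjoint dot a b ->
  is_adjoint dot (r%:C *: a) (r%:C *: b).
Proof.
by move=> ab x y; rewrite !bopZE dotZl dotZr ab conj_conjc conjc_real.
Qed.

Lemma adj_comp a a' b b' : is_adjoint dot a b -> is_adjoint dot a' b' ->
  is_adjoint dot (a ∙ a') (b' ∙ b).
Proof. by move=> ab ab' x y; rewrite !bop_compE ab ab'. Qed.

(** Cauchy-Schwarz for [dot (a x) (a x) = dot x (b (a x))]. With [adj_sym] it gives equality of the
    norms. *)
Lemma nrm_adj a b : is_adjoint dot a b -> nrm a <= nrm b.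
Proof.
move=> ab; apply: nrm_bop_le => [|x]; first exact: nrm_ge0.
have [->|/eqP/nrm_gt0 ax] := eqVneq (a x) 0.
  by rewrite nrm0 mulr_ge0 ?nrm_ge0.
have h : nrm (a x) ^+ 2 <= nrm b * nrm x * nrm (a x).
  rewrite (_ : _ ^+ 2 = cabs (dot (a x) (a x))).
    rewrite ab (le_trans (cauchy_schwarz _ _))//.
    rewrite (mulrC (nrm b)) -mulrA ler_wpM2l ?nrm_ge0//.
    exact: nrm_bop.
  by rewrite dot_nrm cabs_real ger0_norm ?sqr_ge0.
by rewrite -(ler_pM2r ax) -expr2.
Qed.

(** The limit argument behind the adjoints of [p 0], of norm limits and of diagonal operators;
    strong convergence on both sides suffices. *)
Lemma dot_lim (u v : nat -> H) x y l m :
  (forall n, dot (u n) y = dot x (v n)) -> u n @[n --> \oo] --> l ->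
  v n @[n --> \oo] --> m -> dot l y = dot x m.
Proof.
move=> uv /cvg_nrmP ul /cvg_nrmP vm; apply/eqP; rewrite -subr_eq0.
apply/eqP/cabs_eq0/eqP; rewrite eq_le cabs_ge0 andbT.
apply/ler_addgt0Pl => e e0; rewrite addr0.
pose M := nrm x + nrm y + 1.
have M0 : 0 < M by rewrite ltr_wpDl ?addr_ge0 ?nrm_ge0.
have d0 : 0 < e / M by rewrite divr_gt0.
have [N Nu] := ul _ d0.
have [N' Nv] := vm _ d0; pose n := maxn N N'.
have -> : dot l y - dot x m = dot x (v n - m) - dot (u n - l) y.
  by rewrite dotBl dotBr uv; ring.
rewrite (le_trans (cabsD _ _))// {2}/cabs normrN -/(cabs _).
have h1 := cauchy_schwarz x (v n - m).
have h2 := cauchy_schwarz (u n - l) y.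
have h3 : nrm x * nrm (v n - m) <= nrm x * (e / M).
  by rewrite ler_wpM2l ?nrm_ge0// ltW// Nv// leq_maxr.
have h4 : nrm (u n - l) * nrm y <= (e / M) * nrm y.
  by rewrite ler_wpM2r ?nrm_ge0// ltW// Nu// leq_maxl.
have : e = e / M * M by rewrite divfK// lt0r_neq0.
rewrite {2}/M; nra.
Qed.

Lemma bop_cvg (a : nat -> 'B(H)) a0 x :
  a n @[n --> \oo] --> a0 -> a n x @[n --> \oo] --> a0 x.
Proof.
move=> /cvg_nrmP aa; apply/cvg_nrmP => e e0.
have x0 : 0 < nrm x + 1 by rewrite ltr_wpDl ?nrm_ge0.
have [|N Na] := aa (e / (nrm x + 1)); first by rewrite divr_gt0.
exists N => n /Na; rewrite ltr_pdivlMr// => ax.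
rewrite (le_lt_trans (nrm_bop (a n - a0) x))// (le_lt_trans _ ax)//.
by rewrite ler_wpM2l ?nrm_ge0// lerDl.
Qed.

Lemma bop_cvgr {V W : normedModType R[i]} (a : bounded_op V W) (u : nat -> V) l :
  u n @[n --> \oo] --> l -> a (u n) @[n --> \oo] --> a l.
Proof.
move=> /cvg_nrmP ul; apply/cvg_nrmP => e e0.
have x0 : 0 < nrm a + 1 by rewrite ltr_wpDl ?nrm_ge0.
have [|N Na] := ul (e / (nrm a + 1)); first by rewrite divr_gt0.
exists N => n /Na; rewrite ltr_pdivlMr// mulrC -linearB => ax.
rewrite (le_lt_trans (nrm_bop _ _))// (le_lt_trans _ ax)//.
by rewrite ler_wpM2r ?nrm_ge0// lerDl.
Qed.

Lemma adj_lim (a b : nat -> 'B(H)) a0 b0 :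
  (forall n, is_adjoint dot (a n) (b n)) -> a n @[n --> \oo] --> a0 ->
  b n @[n --> \oo] --> b0 -> is_adjoint dot a0 b0.
Proof.
move=> ab aa bb x y; apply: (dot_lim (fun n => ab n x y)); exact: bop_cvg.
Qed.

Lemma adj_sum I (s : seq I) (Q : pred I) (F G : I -> 'B(H)) :
  (forall i, Q i -> is_adjoint dot (F i) (G i)) ->
  is_adjoint dot (\sum_(i <- s | Q i) F i) (\sum_(i <- s | Q i) G i).
Proof. by move=> FG; elim/big_ind2 : _ => //; [exact: adj0|move=> *; exact: adjD]. Qed.

Lemma nrm_proj q : is_adjoint dot q q -> q ∙ q = q -> nrm q <= 1.
Proof.
move=> qa qq; apply: nrm_bop_le => // x; rewrite mul1r.
have [->|/eqP/nrm_gt0 qx] := eqVneq (q x) 0; first by rewrite nrm0 nrm_ge0.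
rewrite -(ler_pM2r qx) -expr2.
rewrite (_ : _ ^+ 2 = cabs (dot x (q x))); first exact: cauchy_schwarz.
by rewrite -[in RHS]qq bop_compE -qa dot_nrm cabs_real ger0_norm ?sqr_ge0.
Qed.

Lemma rank1_ex x y : exists T : 'B(H), forall z, T z = dot z y *: x.
Proof.
apply: (@bop_of_linear _ _ _ _ (nrm x * nrm y)) => [k u v|z].
  by rewrite dotDl dotZl scalerDl scalerA.
by rewrite nrmZ mulrC -mulrA ler_wpM2l ?nrm_ge0// mulrC cauchy_schwarz.
Qed.

Definition rank1 x y : 'B(H) := projT1 (cid (rank1_ex x y)).

Lemma rank1E x y z : rank1 x y z = dot z y *: x.
Proof. by rewrite /rank1; case: cid. Qed.

Lemma rank1_compact x y : rank1 x y \in compact_op.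
Proof.
by apply: (@compact_op_rank1 _ _ _ x) => h; exists (dot h y); rewrite rank1E.
Qed.

Definition crank1 x y : 'K(H) := CompactOp (rank1_compact x y).

Lemma crank1E x y z : crank1 x y z = dot z y *: x.
Proof. exact: rank1E. Qed.

Lemma nrm_rank1 x y : nrm (rank1 x y) <= nrm x * nrm y.
Proof.
apply: nrm_bop_le => [|z]; first by rewrite mulr_ge0 ?nrm_ge0.
rewrite rank1E nrmZ mulrC -mulrA ler_wpM2l ?nrm_ge0// mulrC.
exact: cauchy_schwarz.
Qed.

Lemma rank1_adj x y : is_adjoint dot (rank1 x y) (rank1 y x).
Proof.
move=> u v; rewrite !rank1E dotZl dotZr [dot v x]dotC conjCK mulrC.
by rewrite mulrC.
Qed.

Lemma comp_rank1 a x y : a ∙ rank1 x y = rank1 (a x) y.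
Proof. by apply: bopP => z; rewrite bop_compE !rank1E linearZ. Qed.

Lemma rank1Zl (k : R[i]) x y : rank1 (k *: x) y = k *: rank1 x y.
Proof. by apply: bopP => z; rewrite bopZE !rank1E scalerA mulrC -scalerA. Qed.

Lemma rank10r x : rank1 x 0 = 0.
Proof. by apply: bopP => z; rewrite rank1E dot0r scale0r bop0E. Qed.

Lemma rank1_comp a b x y : is_adjoint dot a b -> rank1 x y ∙ a = rank1 x (b y).
Proof. by move=> ab; apply: bopP => z; rewrite bop_compE !rank1E ab. Qed.

(** The orthogonal projection onto the span of [x], which is the zero operator for [x = 0]. *)
Definition line x := rank1 ((nrm x ^- 2)%:C *: x) x.

Lemma line_id x : line x x = x.
Proof.
rewrite /line rank1E dot_nrm scalerA -rmorphM /=.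
have [->|/eqP/nrm_gt0 xp] := eqVneq x 0; first by rewrite scaler0.
by rewrite divff ?scale1r// lt0r_neq0// exprn_gt0.
Qed.

Lemma line_adj x : is_adjoint dot (line x) (line x).
Proof. by rewrite /line rank1Zl; apply: adjZr; exact: rank1_adj. Qed.

Lemma comp_line_ortho x y : dot x y = 0 -> line x ∙ line y = 0.
Proof.
move=> xy; apply: bopP => z; rewrite /line bop_compE !rank1E dotZl dotZl.
by rewrite (dot_eq0C xy) !mulr0 scale0r.
Qed.

Lemma line_idem x : line x ∙ line x = line x.
Proof.
apply: bopP => z; rewrite bop_compE.
have -> : line x z = dot z x *: ((nrm x ^- 2)%:C *: x) by rewrite /line rank1E.
by rewrite linearZ /= linearZ /= line_id.
Qed.

End InnerProduct.

(** * The algebra of bounded operators, and limits of sequences *)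

Section CompositionAlgebra.
Context {R : realType} {E : normedModType R[i]}.
Implicit Types a b c : 'B(E).

Lemma compA a b c : a ∙ (b ∙ c) = a ∙ b ∙ c.
Proof. exact: bopP. Qed.

Lemma comp1l a : bop_id ∙ a = a.
Proof. exact: bopP. Qed.

Lemma comp1r a : a ∙ bop_id = a.
Proof. exact: bopP. Qed.

Lemma comp0l a : (0 : 'B(E)) ∙ a = 0.
Proof. exact: bopP. Qed.

Lemma comp0r a : a ∙ (0 : 'B(E)) = 0.
Proof. by apply: bopP => x; rewrite bop_compE bop0E linear0. Qed.

Lemma compDl a b c : (a + b) ∙ c = a ∙ c + b ∙ c.
Proof. exact: bopP. Qed.

Lemma compDr a b c : a ∙ (b + c) = a ∙ b + a ∙ c.
Proof. by apply: bopP => x; rewrite bopDE !bop_compE bopDE linearD. Qed.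

Lemma compNl a b : (- a) ∙ b = - (a ∙ b).
Proof. exact: bopP. Qed.

Lemma compNr a b : a ∙ (- b) = - (a ∙ b).
Proof. by apply: bopP => x; rewrite bopNE !bop_compE bopNE linearN. Qed.

Lemma compBl a b c : (a - b) ∙ c = a ∙ c - b ∙ c.
Proof. by rewrite compDl compNl. Qed.

Lemma compBr a b c : a ∙ (b - c) = a ∙ b - a ∙ c.
Proof. by rewrite compDr compNr. Qed.

Lemma compZl k a b : (k *: a) ∙ b = k *: (a ∙ b).
Proof. exact: bopP. Qed.

Lemma compZr k a b : a ∙ (k *: b) = k *: (a ∙ b).
Proof. by apply: bopP => x; rewrite bopZE !bop_compE bopZE linearZ. Qed.

Lemma comp_suml I (s : seq I) (Q : pred I) (F : I -> 'B(E)) a :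
  (\sum_(i <- s | Q i) F i) ∙ a = \sum_(i <- s | Q i) (F i ∙ a).
Proof. by elim/big_ind2 : _ => [|x x' y y' <- <-|//]; rewrite ?comp0l ?compDl. Qed.

Lemma comp_sumr I (s : seq I) (Q : pred I) (F : I -> 'B(E)) a :
  a ∙ (\sum_(i <- s | Q i) F i) = \sum_(i <- s | Q i) (a ∙ F i).
Proof. by elim/big_ind2 : _ => [|x x' y y' <- <-|//]; rewrite ?comp0r ?compDr. Qed.

Lemma sum_idem (I : eqType) (s : seq I) (Q : pred I) (F : I -> 'B(E)) : uniq s ->
  (forall i, Q i -> F i ∙ F i = F i) ->
  (forall i j, Q i -> Q j -> i != j -> F i ∙ F j = 0) ->
  (\sum_(i <- s | Q i) F i) ∙ (\sum_(i <- s | Q i) F i) = \sum_(i <- s | Q i) F i.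
Proof.
move=> us FF F0; rewrite comp_suml big_seq_cond [RHS]big_seq_cond.
apply: eq_bigr => i /andP[si Qi]; rewrite comp_sumr big_mkcond (bigD1_seq i)//= Qi FF//.
by rewrite big1 ?addr0// => j ji; case: ifP => // Qj; rewrite F0// eq_sym.
Qed.

End CompositionAlgebra.

Lemma bop_sumE {R : realType} {E F : normedModType R[i]} I (s : seq I)
    (Q : pred I) (f : I -> bounded_op E F) x :
  (\sum_(i <- s | Q i) f i) x = \sum_(i <- s | Q i) f i x.
Proof. by elim/big_ind2 : _ => // a b c d <- <-. Qed.

Lemma copBE {R : realType} {E : normedModType R[i]} (k k' : 'K(E)) :
  (k - k' : 'K(E)) = (k : 'B(E)) - (k' : 'B(E)) :> 'B(E).
Proof. by []. Qed.

Lemma nrm_cop {R : realType} {E : normedModType R[i]} (k : 'K(E)) :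
  nrm k = nrm (k : 'B(E)).
Proof. by []. Qed.

Lemma bopZ {R : realType} {E F : normedModType R[i]} (f : bounded_op E F) c x :
  f (c *: x) = c *: f x.
Proof. exact: linearZ. Qed.

Section Limits.
Context {R : realType} {V : normedModType R[i]}.
Implicit Types (u v : nat -> V) (l m : V).

Lemma cvg_uniq u l m : u n @[n --> \oo] --> l -> u n @[n --> \oo] --> m -> l = m.
Proof. by move=> ul um; exact: (cvg_unique (@norm_hausdorff _ V) ul um). Qed.

Lemma cvg_eventually u l N :
  (forall n, (N <= n)%N -> u n = l) -> u n @[n --> \oo] --> l.
Proof.
move=> uN; apply/cvg_nrmP => e e0; exists N => n /uN ->.
by rewrite subrr nrm0.
Qed.

Lemma nrm_lim_le u l (M : R) :
  (forall n, nrm (u n) <= M) -> u n @[n --> \oo] --> l -> nrm l <= M.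
Proof.
move=> uM /cvg_nrmP ul; apply/ler_addgt0Pl => e /ul[N /(_ N (leqnn _)) Nu].
have := uM N; have := nrm_tri (u N) l 0; rewrite !subr0 (nrmC l) => *; lra.
Qed.

End Limits.

(** * Pinching operators *)

Section Pinching.
Context {R : realType} {H : completeNormedModType R[i]}.
Variable dot : {dot H for Num.conj}.
Hypothesis norm_dot : forall x : H, `|x| ^+ 2 = dot x x.
Variables (w : option nat) (p : nat -> 'B(H)) (P : 'B('K(H))).
Hypothesis p_family : projection_family dot w p.
Hypothesis P_pinching : pinching w p P.
Implicit Types (k : 'K(H)) (a b c : 'B(H)) (x y : H).

(** [index_le i w] admits the complementary projection [p 0], while [idx i] only admits members of
    the family. *)
Definition idx i := (0 < i)%N && index_le i w.

Definition psum n : 'B(H) := \sum_(1 <= i < n.+1 | index_le i w) p i.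
Definition pinch n a : 'B(H) := \sum_(1 <= i < n.+1 | index_le i w) (p i ∙ a ∙ p i).

Lemma idx_sum (V : nmodType) n (F : nat -> V) :
  \sum_(1 <= i < n.+1 | index_le i w) F i = \sum_(1 <= i < n.+1 | idx i) F i.
Proof.
rewrite big_nat_cond [RHS]big_nat_cond; apply: eq_bigl => i.
by rewrite /idx; case: i.
Qed.

Lemma proj_adj i : idx i -> is_adjoint dot (p i) (p i).
Proof.
move=> /andP[i0 iw]; have [/(_ i i0 iw)[[pa _] pn0] _ _] := p_family.
by rewrite -{2}pa; apply: adjointP; rewrite pa.
Qed.

Lemma proj_idem i : idx i -> p i ∙ p i = p i.
Proof. by move=> /andP[i0 iw]; have [/(_ i i0 iw)[[]]] := p_family. Qed.

Lemma proj_neq0 i : idx i -> p i <> 0.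
Proof. by move=> /andP[i0 iw]; have [/(_ i i0 iw)[]] := p_family. Qed.

Lemma proj_ortho i j : idx i -> idx j -> i != j -> p i ∙ p j = 0.
Proof.
move=> /andP[i0 iw] /andP[j0 jw] /eqP ij.
by have [_ /(_ i j i0 iw j0 jw ij)] := p_family.
Qed.

Lemma psum_cvg x : psum n x @[n --> \oo] --> x - p 0%N x.
Proof.
have [_ _ /(_ x)] := p_family.
suff -> : (fun n => psum n x) =
  (fun n => \sum_(1 <= i < n.+1 | index_le i w) p i x) by [].
by apply/funext => n; rewrite bop_sumE.
Qed.

Lemma pinch_cvg k : pinch n k @[n --> \oo] --> (P k : 'B(H)).
Proof. exact: P_pinching. Qed.

Lemma pinch_cvgx k x : pinch n k x @[n --> \oo] --> P k x.
Proof. by apply: (@bop_cvg _ _ (fun n => pinch n k)); exact: pinch_cvg. Qed.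

Lemma psum_adj n : is_adjoint dot (psum n) (psum n).
Proof. by rewrite /psum idx_sum; apply: adj_sum => i; exact: proj_adj. Qed.

Lemma mem_range i n : idx i -> (i < n)%N -> i \in index_iota 1 n.
Proof. by move=> /andP[i0 _] ni; rewrite mem_index_iota i0. Qed.

Lemma sum_select (V : nmodType) n (F : nat -> V) i : idx i -> (i <= n)%N ->
  (forall j, idx j -> j != i -> F j = 0) ->
  \sum_(1 <= j < n.+1 | index_le j w) F j = F i.
Proof.
move=> ii ni F0; rewrite idx_sum big_mkcond (bigD1_seq i) ?iota_uniq ?mem_range//=.
by rewrite ii big1 ?addr0// => j ji; case: ifP => // /F0->.
Qed.

Lemma proj_psum i n : idx i -> (i <= n)%N -> p i ∙ psum n = p i.
Proof.
move=> ii ni; rewrite /psum comp_sumr (@sum_select _ _ _ i)//.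
  exact: proj_idem.
by move=> j jj ji; rewrite proj_ortho// eq_sym.
Qed.

Lemma proj_pinch i n a : idx i -> (i <= n)%N -> p i ∙ pinch n a = p i ∙ a ∙ p i.
Proof.
move=> ii ni; rewrite /pinch comp_sumr (@sum_select _ _ _ i)//.
  by rewrite -compA compA proj_idem.
by move=> j jj ji; rewrite -compA compA proj_ortho ?comp0l// eq_sym.
Qed.

Lemma pinch_proj i n a : idx i -> (i <= n)%N -> pinch n a ∙ p i = p i ∙ a ∙ p i.
Proof.
move=> ii ni; rewrite /pinch comp_suml (@sum_select _ _ _ i)//.
  by rewrite -compA proj_idem.
by move=> j jj ji; rewrite -compA proj_ortho ?comp0r.
Qed.

(** As [p 0] is given by a strong limit of partial sums, this and the next algebraic properties are
    read off from the partial sums and passed to the limit. *)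
Lemma proj0_adj : is_adjoint dot (p 0%N) (p 0%N).
Proof.
move=> x y.
have := dot_lim norm_dot (fun n => psum_adj n x y) (@psum_cvg x) (@psum_cvg y).
by rewrite dotBl dotBr => /addrI/oppr_inj.
Qed.

Lemma proj_proj0 i : idx i -> p i ∙ p 0%N = 0.
Proof.
move=> ii; apply: bopP => x.
have h1 : p i (psum n x) @[n --> \oo] --> p i (x - p 0%N x).
  exact: bop_cvgr (@psum_cvg x).
have h2 : p i (psum n x) @[n --> \oo] --> p i x.
  apply: (@cvg_eventually _ _ _ _ i) => n ni.
  by rewrite -bop_compE proj_psum.
have := cvg_uniq h1 h2; rewrite linearB => /eqP.
by rewrite -subr_eq0 addrAC subrr add0r oppr_eq0 => /eqP.
Qed.

Lemma proj0_proj i : idx i -> p 0%N ∙ p i = 0.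
Proof.
move=> ii; have := adj_comp (proj_adj ii) proj0_adj.
by rewrite proj_proj0// => /adj_uniq/(_ (adj0 dot)).
Qed.

Lemma psum_proj0 n : psum n ∙ p 0%N = 0.
Proof.
by rewrite /psum idx_sum comp_suml big1// => i; exact: proj_proj0.
Qed.

Lemma proj0_idem : p 0%N ∙ p 0%N = p 0%N.
Proof.
apply: bopP => x; have h1 := @psum_cvg (p 0%N x).
have h2 : psum n (p 0%N x) @[n --> \oo] --> (0 : H).
  by apply: (@cvg_eventually _ _ _ _ 0) => n _; rewrite -bop_compE psum_proj0.
by apply/esym/eqP; rewrite -subr_eq0; apply/eqP; exact: cvg_uniq h1 h2.
Qed.

Lemma family_ortho i j : index_le i w -> index_le j w -> i != j -> p i ∙ p j = 0.
Proof.
case: i => [|i] iw; case: j => [|j] jw ij //.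
- by apply: proj0_proj; rewrite /idx jw.
- by apply: proj_proj0; rewrite /idx iw.
- by apply: proj_ortho; rewrite /idx ?iw ?jw.
Qed.

Lemma family_adj i : index_le i w -> is_adjoint dot (p i) (p i).
Proof.
by case: i => [|i] iw; [exact: proj0_adj|apply: proj_adj; rewrite /idx iw].
Qed.

Lemma family_idem i : index_le i w -> p i ∙ p i = p i.
Proof.
by case: i => [|i] iw; [exact: proj0_idem|apply: proj_idem; rewrite /idx iw].
Qed.

Lemma proj_P i k : idx i -> p i ∙ P k = p i ∙ k ∙ p i.
Proof.
move=> ii; apply: bopP => x; apply: (@cvg_uniq _ _ (fun n => p i (pinch n k x))).
  exact: bop_cvgr (@pinch_cvgx k x).
apply: (@cvg_eventually _ _ _ _ i) => n ni.
by rewrite -bop_compE proj_pinch.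
Qed.

Lemma P_proj i k : idx i -> P k ∙ p i = p i ∙ k ∙ p i.
Proof.
move=> ii; apply: bopP => x; apply: (@cvg_uniq _ _ (fun n => pinch n k (p i x))).
  exact: pinch_cvgx.
apply: (@cvg_eventually _ _ _ _ i) => n ni.
by rewrite -bop_compE pinch_proj.
Qed.

Lemma P_adj k k' : is_adjoint dot k k' -> is_adjoint dot (P k) (P k').
Proof.
move=> kk'; apply: adj_lim (@pinch_cvg k) (@pinch_cvg k') => // n.
rewrite /pinch !idx_sum; apply: adj_sum => i ii; rewrite -compA.
by apply: adj_comp; [exact: proj_adj|apply: adj_comp => //; exact: proj_adj].
Qed.

Lemma proj0_P k : p 0%N ∙ P k = 0.
Proof.
apply: bopP => x; apply: (@cvg_uniq _ _ (fun n => p 0%N (pinch n k x))).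
  exact: bop_cvgr (@pinch_cvgx k x).
apply: (@cvg_eventually _ _ _ _ 0) => n _; rewrite -bop_compE.
rewrite /pinch idx_sum comp_sumr big1// => i ii.
by rewrite -compA compA proj0_proj// comp0l.
Qed.

Lemma P_proj0 k : P k ∙ p 0%N = 0.
Proof.
apply: bopP => x; apply: (@cvg_uniq _ _ (fun n => pinch n k (p 0%N x))).
  exact: pinch_cvgx.
apply: (@cvg_eventually _ _ _ _ 0) => n _; rewrite -bop_compE.
rewrite /pinch idx_sum comp_suml big1// => i ii.
by rewrite -compA proj_proj0// comp0r.
Qed.

(** Multiplication by [p j] on the right kills the operator for [j != i], so one term of the
    pinching survives. These operators are the test elements for [lcomm]. *)
Lemma P_rank1 i x y : idx i -> p i y = y ->
  P (crank1 norm_dot x y) = rank1 norm_dot (p i x) y :> 'B(H).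
Proof.
move=> ii piy.
apply: (@cvg_uniq _ _ (fun n => pinch n (crank1 norm_dot x y))).
  exact: pinch_cvg.
apply: (@cvg_eventually _ _ _ _ i) => n ni.
have pj j : idx j ->
    p j ∙ crank1 norm_dot x y ∙ p j = rank1 norm_dot (p j x) (p j y).
  by move=> jj; rewrite comp_rank1 (rank1_comp _ _ _ (proj_adj jj)).
rewrite /pinch (@sum_select _ _ _ i)//; first by rewrite pj// piy.
move=> j jj ji; rewrite pj// -piy -(bop_compE (p j)) proj_ortho// bop0E.
by rewrite rank10r.
Qed.

(* [z |-> lcomm z] is the differential of the orbit map at the identity, and
   [lcomm u] has the norm of [L_u P L_{u^*} - P] when [u] is unitary. *)
Definition lcomm a : 'B('K(H)) := lmul a ∙ P - P ∙ lmul a.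

Lemma lcommE a k : lcomm a k = a ∙ P k - P (lmul a k) :> 'B(H).
Proof. by []. Qed.

Lemma lmulP (r : R[i]) a b : lmul (r *: a + b) = r *: lmul a + lmul b.
Proof. by apply: bopP => k; apply: val_inj; exact: bopP. Qed.

Lemma lmul_comp a b : lmul (a ∙ b) = lmul a ∙ lmul b.
Proof. by apply: bopP => k; apply: val_inj; exact: bopP. Qed.

Lemma lmul1 : lmul bop_id = bop_id :> 'B('K(H)).
Proof. by apply: bopP => k; apply: val_inj; exact: bopP. Qed.

Lemma nrm_lmul a : nrm (lmul a) <= nrm a.
Proof. by apply: nrm_bop_le => [|k]; [exact: nrm_ge0|exact: nrm_comp]. Qed.

Lemma lcommP (r : R[i]) a b : lcomm (r *: a + b) = r *: lcomm a + lcomm b.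
Proof.
rewrite /lcomm lmulP compDl compZl compDr compZr scalerBr opprD.
by rewrite addrACA.
Qed.

Lemma lcommD a b : lcomm (a + b) = lcomm a + lcomm b.
Proof. by rewrite -[a]scale1r lcommP !scale1r. Qed.

Lemma lcomm0 : lcomm 0 = 0.
Proof. by apply: (addrI (lcomm 0)); rewrite -lcommD !addr0. Qed.

Lemma lcommZ (r : R[i]) a : lcomm (r *: a) = r *: lcomm a.
Proof. by rewrite -[r *: a]addr0 lcommP lcomm0 addr0. Qed.

Lemma lcommN a : lcomm (- a) = - lcomm a.
Proof. by rewrite -scaleN1r lcommZ scaleN1r. Qed.

Lemma lcommB a b : lcomm (a - b) = lcomm a - lcomm b.
Proof. by rewrite lcommD lcommN. Qed.

Lemma nrm_lcomm a : nrm (lcomm a) <= 2 * nrm P * nrm a.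
Proof.
rewrite /lcomm (le_trans (nrmB _ _))//.
rewrite -mulrA mulr_natl mulr2n lerD//.
  by rewrite (le_trans (nrm_comp _ _))// mulrC ler_wpM2l ?nrm_ge0// nrm_lmul.
by rewrite (le_trans (nrm_comp _ _))// ler_wpM2l ?nrm_ge0// nrm_lmul.
Qed.

(** For unitary [c] this says that block diagonal unitaries are in the isotropy group of [P]. *)
Lemma lmul_commute c : (forall i, idx i -> c ∙ p i = p i ∙ c) ->
  lmul c ∙ P = P ∙ lmul c.
Proof.
move=> cp; apply: bopP => k; apply: val_inj; apply: bopP => x /=.
apply: (@cvg_uniq _ _ (fun n => c (pinch n k x))).
  by apply: bop_cvgr; exact: pinch_cvgx.
suff -> : (fun n => c (pinch n k x)) = (fun n => pinch n (lmul c k) x).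
  exact: pinch_cvgx.
apply/funext => n; rewrite -bop_compE /pinch !idx_sum comp_sumr.
congr (bop_fun _ x); apply: eq_bigr => i ii.
by rewrite !compA cp// -!compA.
Qed.

Lemma lcomm_commute c : (forall i, idx i -> c ∙ p i = p i ∙ c) -> lcomm c = 0.
Proof. by move=> /lmul_commute cP; rewrite /lcomm cP subrr. Qed.

(* Test [lcomm k] on the sum [t] of the projections onto the lines spanned by
   the [p_j x], [1 <= j <= n]: [P t = t], [t] has norm at most 1, and
   [lcomm k t x] is the sum of the [k p_j x - p_j k p_j x]. *)
Lemma lcomm_off_diag k : nrm (k ∙ (bop_id - p 0%N) - P k) <= nrm (lcomm k).
Proof.
apply: nrm_bop_le => [|x]; first exact: nrm_ge0.
have kx : k (psum n x) - pinch n k x @[n --> \oo] -->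
    k (x - p 0%N x) - P k x.
  have h1 : k (psum n x) @[n --> \oo] --> k (x - p 0%N x).
    exact: (@bop_cvgr _ _ _ (k : 'B(H)) _ _ (@psum_cvg x)).
  exact: (@cvgB _ _ _ _ _ _ _ _ _ h1 (@pinch_cvgx k x)).
apply: (nrm_lim_le _ kx).
move=> n.
pose xi j := p j x.
pose L j := line norm_dot (xi j).
pose t : 'K(H) := \sum_(1 <= j < n.+1 | idx j)
  crank1 norm_dot ((nrm (xi j) ^- 2)%:C *: xi j) (xi j).
have cop_sum (F : nat -> 'K(H)) : (\sum_(1 <= j < n.+1 | idx j) F j : 'K(H))
    = \sum_(1 <= j < n.+1 | idx j) (F j : 'B(H)) :> 'B(H).
  by elim/big_ind2 : _ => // a a' b b' <- <-.
have tE : t = \sum_(1 <= j < n.+1 | idx j) L j :> 'B(H) by exact: cop_sum.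
have t1 : nrm t <= 1.
  rewrite nrm_cop tE; apply: (nrm_proj norm_dot).
    by apply: adj_sum => j _; exact: line_adj.
  apply: sum_idem; first exact: iota_uniq.
    by move=> j _; exact: line_idem.
  move=> i j ii jj ij; apply: comp_line_ortho; rewrite /xi.
  by rewrite (proj_adj ii) -bop_compE proj_ortho// bop0E dot0r.
have pxi j : idx j -> p j (xi j) = xi j.
  by move=> jj; rewrite /xi -bop_compE proj_idem.
have Psum (F : nat -> 'K(H)) : (P (\sum_(1 <= j < n.+1 | idx j) F j) : 'B(H))
    = \sum_(1 <= j < n.+1 | idx j) (P (F j) : 'B(H)).
  by rewrite linear_sum cop_sum.
have Pt : P t = t.
  apply: val_inj; rewrite [LHS]Psum [RHS]tE; apply: eq_bigr => j jj.
  rewrite (P_rank1 _ jj (pxi j jj)) /L /line; congr (rank1 _ _ _).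
  by rewrite bopZ pxi.
have kt : lmul k t = \sum_(1 <= j < n.+1 | idx j)
    crank1 norm_dot (k ((nrm (xi j) ^- 2)%:C *: xi j)) (xi j).
  apply: val_inj; rewrite [RHS]cop_sum [LHS](_ : _ = k ∙ t)// tE comp_sumr.
  by apply: eq_bigr => j jj; rewrite /L /line comp_rank1.
have Pkt : P (lmul k t) =
    \sum_(1 <= j < n.+1 | idx j) (p j ∙ k ∙ L j) :> 'B(H).
  rewrite kt Psum; apply: eq_bigr => j jj.
  by rewrite (P_rank1 _ jj (pxi j jj)) -compA /L /line !comp_rank1.
have Lx j : idx j -> L j x = xi j.
  move=> jj; rewrite -[RHS](line_id norm_dot) /L /line !rank1E.
  congr (_ *: _); rewrite /xi [RHS](proj_adj jj).
  by rewrite -(bop_compE (p j)) proj_idem.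
have -> : k (psum n x) - pinch n k x = lcomm k t x.
  have -> : (lcomm k t : 'B(H)) =
      k ∙ t - \sum_(1 <= j < n.+1 | idx j) (p j ∙ k ∙ L j).
    by rewrite lcommE Pt; congr (_ - _); exact: Pkt.
  rewrite [RHS]bopDE bopNE; congr (_ - _).
    rewrite bop_compE tE; congr (k _); rewrite /psum idx_sum !bop_sumE.
    by apply: eq_bigr => j jj; rewrite Lx.
  rewrite /pinch idx_sum !bop_sumE; apply: eq_bigr => j jj.
  by rewrite !bop_compE Lx.
apply: le_trans (nrm_bop (lcomm k t : 'B(H)) x) _.
apply: ler_wpM2r; first exact: nrm_ge0.
rewrite -nrm_cop; apply: le_trans (nrm_bop (lcomm k) t) _.
by apply: ler_piMr => //; exact: nrm_ge0.
Qed.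

Definition rmul k a : 'K(H) := CompactOp (compact_op_compr a (cop_compact k)).

(** [P k] has no block at [p 0]. That corner is added since [lcomm] vanishes on it too:
    [k - block_diag k] is what [lcomm] can control. *)
Definition block_diag k : 'K(H) := P k + rmul (lmul (p 0%N) k) (p 0%N).

Lemma diagE k : (block_diag k : 'B(H)) = (P k : 'B(H)) + p 0%N ∙ k ∙ p 0%N.
Proof. by []. Qed.

Lemma proj_diag i k : index_le i w -> p i ∙ block_diag k = p i ∙ k ∙ p i.
Proof.
rewrite diagE compDr; case: i => [|i] iw.
  by rewrite proj0_P add0r !compA proj0_idem.
have ii : idx i.+1 by [].
by rewrite proj_P// !compA proj_proj0// !comp0l addr0.
Qed.

Lemma diag_proj i k : index_le i w -> block_diag k ∙ p i = p i ∙ k ∙ p i.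
Proof.
rewrite diagE compDl; case: i => [|i] iw.
  by rewrite P_proj0 add0r -!compA proj0_idem.
have ii : idx i.+1 by [].
by rewrite P_proj// -!compA proj0_proj// !comp0r addr0.
Qed.

Lemma diag_commute i k : index_le i w -> block_diag k ∙ p i = p i ∙ block_diag k.
Proof. by move=> iw; rewrite diag_proj// proj_diag. Qed.

Lemma lcomm_block_diag k : lcomm (block_diag k) = 0.
Proof. by apply: lcomm_commute => i /andP[_ iw]; exact: diag_commute. Qed.

Lemma diag_adj k k' : is_adjoint dot k k' ->
  is_adjoint dot (block_diag k) (block_diag k').
Proof.
move=> kk'; rewrite !diagE; apply: adjD; first exact: P_adj.
rewrite -[X in is_adjoint _ _ X]compA.
by apply: adj_comp; [apply: adj_comp => //|]; exact: proj0_adj.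
Qed.

(* [lcomm_off_diag] does not see the part [(1 - p_0) k p_0] of the column 0,
   which is the adjoint of the part [p_0 k' (1 - p_0)] of the row 0 of [k']. *)
Lemma nrm_off_diag k k' : is_adjoint dot k k' ->
  nrm (k - block_diag k) <= nrm (lcomm k) + nrm (lcomm k').
Proof.
move=> kk'; have p1 : nrm (p 0%N) <= 1.
  exact: (nrm_proj norm_dot proj0_adj proj0_idem).
have kE : (k - block_diag k : 'K(H)) = (k ∙ (bop_id - p 0%N) - P k) +
    (bop_id - p 0%N) ∙ k ∙ p 0%N :> 'B(H).
  rewrite copBE diagE compBr comp1r !compBl comp1l opprD !addrA.
  by congr (_ - _); rewrite [RHS]addrAC subrK.
rewrite nrm_cop kE (le_trans (nrmD _ _))// lerD ?lcomm_off_diag//.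
(* The product [p 0 ∙ P k'] is zero; it is inserted to match the operator estimated in
   [lcomm_off_diag]. *)
have a0 : is_adjoint dot ((bop_id - p 0%N) ∙ k ∙ p 0%N)
    (p 0%N ∙ (k' ∙ (bop_id - p 0%N) - P k')).
  rewrite (compBr _ (k' ∙ _)) proj0_P subr0; apply: adj_comp; last exact: proj0_adj.
  by apply: adj_comp => //; apply: adjB; [exact: adj_id|exact: proj0_adj].
rewrite (le_trans (nrm_adj norm_dot a0))// (le_trans (nrm_comp _ _))//.
by rewrite (le_trans _ (lcomm_off_diag k'))// ler_piMl// nrm_ge0.
Qed.

End Pinching.

(** * Polar decomposition near the unitaries *)

Section Geometric.
Context {R : realType}.

Lemma half_exp_small (c e : R) : 0 < e -> exists N, c * 2^-1 ^+ N < e.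
Proof.
move=> e0; have [c0|c0] := leP c 0.
  by exists 0%N; rewrite expr0 mulr1 (le_lt_trans c0).
exists (Num.bound (c / e)); rewrite exprVn ltr_pdivrMr ?exprn_gt0//.
rewrite mulrC -ltr_pdivrMr//.
rewrite (lt_trans (archi_boundP (ltW (divr_gt0 c0 e0))))//.
by rewrite -natrX ltr_nat ltn_expl.
Qed.

Context {V : normedModType R[i]}.

(** The subtracted term [2^-1 ^+ (n + m)] is what makes the induction on [m] close; dropping it
    gives the usual estimate of the tail. *)
Lemma geometric_dist (u : nat -> V) (c : R) :
  (forall n, nrm (u n.+1 - u n) <= c * 2^-1 ^+ n) ->
  forall m n, nrm (u (n + m)%N - u n) <= 2 * c * (2^-1 ^+ n - 2^-1 ^+ (n + m)).
Proof.
move=> uc m n; elim: m => [|m IH]; first by rewrite addn0 !subrr nrm0 mulr0.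
rewrite addnS (le_trans (nrm_tri (u (n + m)%N) _ _))//.
by have := uc (n + m)%N; rewrite exprS; lra.
Qed.

Lemma geometric_limit (u : nat -> V) (c : R) : seq_complete V ->
  (forall n, nrm (u n.+1 - u n) <= c * 2^-1 ^+ n) ->
  exists2 l : V, u n @[n --> \oo] --> l & nrm (l - u 0%N) <= 2 * c.
Proof.
move=> cV uc; have c0 : 0 <= c.
  by have := uc 0%N; rewrite expr0 mulr1; exact: le_trans (nrm_ge0 _).
have dist n m : (n <= m)%N -> nrm (u m - u n) <= 2 * c * 2^-1 ^+ n.
  move=> nm; have := geometric_dist uc (m - n) n; rewrite subnKC//.
  move=> /le_trans; apply; rewrite ler_wpM2l ?mulr_ge0// gerBl.
  by rewrite exprn_ge0// invr_ge0.
have [l ul] : exists l : V, u n @[n --> \oo] --> l.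
  apply: cV => e e0; have [N Ne] := half_exp_small (4 * c) e0.
  exists N => m n Nm Nn; rewrite (le_lt_trans (nrm_tri (u N) _ _))//.
  have := dist _ _ Nm; have := dist _ _ Nn; rewrite (nrmC (u n)); lra.
exists l => //; have h : u n - u 0%N @[n --> \oo] --> l - u 0%N.
  by apply: cvgB => //; exact: cvg_cst.
by apply: (nrm_lim_le _ h) => n; rewrite (le_trans (dist 0%N n _))// expr0 mulr1.
Qed.

Lemma cvg_cauchy (u : nat -> V) (l : V) : u n @[n --> \oo] --> l -> seq_cauchy u.
Proof.
move=> /cvg_nrmP ul e e0; have [|N Nu] := ul (e / 2); first by rewrite divr_gt0.
exists N => m n /Nu um /Nu un; have := nrm_tri l (u m) (u n).
rewrite (nrmC l); lra.
Qed.

End Geometric.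

Lemma comp_cvg {R : realType} {V : normedModType R[i]} (a b : nat -> 'B(V))
    (a0 b0 : 'B(V)) (M : R) : (forall n, nrm (a n) <= M) ->
  a n @[n --> \oo] --> a0 -> b n @[n --> \oo] --> b0 ->
  a n ∙ b n @[n --> \oo] --> a0 ∙ b0.
Proof.
move=> aM /cvg_nrmP aa /cvg_nrmP bb; apply/cvg_nrmP => e e0.
pose K := `|M| + nrm b0 + 1.
have K0 : 0 < K by rewrite ltr_wpDl// addr_ge0 ?nrm_ge0.
have d0 : 0 < e / K by rewrite divr_gt0.
have [N Na] := aa _ d0; have [N' Nb] := bb _ d0.
exists (maxn N N') => n; rewrite geq_max => /andP[/Na an /Nb bn].
have -> : a n ∙ b n - a0 ∙ b0 = a n ∙ (b n - b0) + (a n - a0) ∙ b0.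
  by rewrite compBr compBl addrA subrK.
rewrite (le_lt_trans (nrmD _ _))//.
have h1 : nrm (a n ∙ (b n - b0)) <= `|M| * (e / K).
  rewrite (le_trans (nrm_comp _ _))// ler_pM ?nrm_ge0//; last exact: ltW.
  by rewrite (le_trans (aM n))// ler_norm.
have h2 : nrm ((a n - a0) ∙ b0) <= e / K * nrm b0.
  by rewrite (le_trans (nrm_comp _ _))// ler_wpM2r ?nrm_ge0// ltW.
have : e / K * K = e by rewrite divfK// lt0r_neq0.
rewrite /K; nra.
Qed.

Section Polar.
Context {R : realType} {H : completeNormedModType R[i]}.
Variable dot : {dot H for Num.conj}.
Hypothesis norm_dot : forall x : H, `|x| ^+ 2 = dot x x.
Implicit Types a b t v : 'B(H).

Lemma nrm_sqr_adj a b : is_adjoint dot a b -> nrm a ^+ 2 <= nrm (b ∙ a).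
Proof.
move=> ab; rewrite -[leRHS]sqr_sqrtr ?nrm_ge0// ler_sqr ?nnegrE ?nrm_ge0 ?sqrtr_ge0//.
apply: nrm_bop_le => [|x]; first exact: sqrtr_ge0.
rewrite -ler_sqr ?nnegrE ?mulr_ge0 ?sqrtr_ge0 ?nrm_ge0//.
rewrite exprMn sqr_sqrtr ?nrm_ge0//.
have -> : nrm (a x) ^+ 2 = cabs (dot x ((b ∙ a) x)).
  by rewrite bop_compE -ab dot_nrm// cabs_real ger0_norm ?sqr_ge0.
rewrite (le_trans (cauchy_schwarz norm_dot _ _))// expr2 mulrA mulrC.
by rewrite ler_wpM2r ?nrm_ge0// nrm_bop.
Qed.

Let h2 : R[i] := 2^-1.

Let h2E : h2 = (2^-1 : R)%:C.
Proof. by rewrite /h2 fmorphV rmorph_nat. Qed.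

(** With [t] the defect [1 - b a], replacing [a] by [a (1 + t / 2)] leaves the defect
    [(3 t^2 + t^3) / 4], which is quadratic in [t]. *)
Let newton_id t : bop_id - (bop_id + h2 *: t) ∙ (bop_id - t) ∙ (bop_id + h2 *: t)
  = h2 *: (h2 *: (3%:R *: (t ∙ t) + t ∙ t ∙ t)).
Proof.
apply: bopP => x.
rewrite !(bopDE, bopNE, bopZE, bop_compE) /=.
rewrite !(linearD, linearN, linearZ, bopDE, bopNE, bopZE) /=.
rewrite !(linearD, linearN, linearZ) /=.
(* Pairing with [z] turns the identity of vectors into one of scalars, where [field] applies. *)
apply: (@dot_ext _ _ dot) => z; rewrite !(dotDl, dotNl, dotZl) /h2; by field.
Qed.

Let newton_step a b t : b ∙ a = bop_id - t ->
  bop_id - (bop_id + h2 *: t) ∙ b ∙ (a ∙ (bop_id + h2 *: t)) =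
  h2 *: (h2 *: (3%:R *: (t ∙ t) + t ∙ t ∙ t)).
Proof. by move=> ba; rewrite -newton_id compA -(compA _ b a) ba. Qed.

(** Below the threshold one half, [t^2] and [t^3] have norm at most [nrm t / 2], and the weights 3/4
    and 1/4 add up to 1. So the defect halves and stays below the threshold. *)
Let newton_nrm t : nrm t <= 2^-1 ->
  nrm (h2 *: (h2 *: (3%:R *: (t ∙ t) + t ∙ t ∙ t))) <= nrm t / 2.
Proof.
move=> t2; rewrite h2E !nrmZr ger0_norm ?invr_ge0//.
have : nrm (t ∙ t) <= nrm t / 2.
  by rewrite (le_trans (nrm_comp _ _))// ler_wpM2l ?nrm_ge0.
have : nrm (t ∙ t ∙ t) <= nrm (t ∙ t).
  rewrite (le_trans (nrm_comp _ _))// ler_piMr ?nrm_ge0//.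
  by rewrite (le_trans t2)// invf_le1 ?ler1n.
have := nrmD (3%:R *: (t ∙ t)) (t ∙ t ∙ t).
rewrite -(rmorph_nat (real_complex R)) nrmZr ger0_norm//.
lra.
Qed.

(* Newton's iteration v <- v (3 - v* v) / 2 for the polar part of v. *)
Lemma polar_newton (S : 'B(H) -> 'B(H) -> Prop) v v' :
  (forall a b, S a b -> is_adjoint dot a b) ->
  (forall a b, S a b -> let t := bop_id - b ∙ a in
    S (a ∙ (bop_id + (2^-1 : R)%:C *: t)) ((bop_id + (2^-1 : R)%:C *: t) ∙ b)) ->
  (forall (a b : nat -> 'B(H)) a0 b0, (forall n, S (a n) (b n)) ->
    a n @[n --> \oo] --> a0 -> b n @[n --> \oo] --> b0 -> S a0 b0) ->
  S v v' -> nrm (bop_id - v' ∙ v) <= 2^-1 -> nrm (bop_id - v ∙ v') <= 2^-1 ->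
  exists g g', [/\ S g g', g' ∙ g = bop_id, g ∙ g' = bop_id &
    nrm (g - v) <= 2 * nrm (bop_id - v' ∙ v)].
Proof.
move=> Sadj Sstep Slim Sv tv sv.
pose T (z : 'B(H) * 'B(H)) := bop_id - z.2 ∙ z.1.
(* Both defects are tracked: in infinite dimension [g' g = 1] alone would only make [g] an
   isometry. *)
pose T' (z : 'B(H) * 'B(H)) := bop_id - z.1 ∙ z.2.
pose step z := (z.1 ∙ (bop_id + h2 *: T z), (bop_id + h2 *: T z) ∙ z.2).
pose z n := iter n step (v, v').
have zS n : S (z n).1 (z n).2.
  by elim: n => //= n IH; have /= := Sstep _ _ IH; rewrite -h2E.
(* The factor [1 + t / 2] can be moved across [a], with the defect of the other product; the same
   iterates are thus Newton steps for both defects. *)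
have swap a b : a ∙ (bop_id + h2 *: (bop_id - b ∙ a)) =
    (bop_id + h2 *: (bop_id - a ∙ b)) ∙ a.
  rewrite compDr compDl comp1l comp1r compZr compZl compBr compBl.
  by rewrite comp1l comp1r compA.
have swap' a b : (bop_id + h2 *: (bop_id - b ∙ a)) ∙ b =
    b ∙ (bop_id + h2 *: (bop_id - a ∙ b)).
  rewrite compDr compDl comp1l comp1r compZr compZl compBr compBl.
  by rewrite comp1l comp1r compA.
have TS z1 : T (step z1) =
    h2 *: (h2 *: (3%:R *: (T z1 ∙ T z1) + T z1 ∙ T z1 ∙ T z1)).
  by apply: newton_step; rewrite opprB addrC subrK.
have TS' z1 : T' (step z1) =
    h2 *: (h2 *: (3%:R *: (T' z1 ∙ T' z1) + T' z1 ∙ T' z1 ∙ T' z1)).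
  rewrite -(newton_step (a := z1.2) (b := z1.1)); last first.
    by rewrite opprB addrC subrK.
  by congr (_ - _ ∙ _); [exact: swap|exact: swap'].
have Tn n : nrm (T (z n)) <= nrm (T (v, v')) * 2^-1 ^+ n /\ nrm (T (z n)) <= 2^-1.
  elim: n => [|n [IH1 IH2]]; first by rewrite expr0 mulr1.
  rewrite /z iterS TS -/(z n); have := newton_nrm IH2.
  by rewrite exprS; split; move: (nrm_ge0 (T (z n))); lra.
have Tn' n : nrm (T' (z n)) <= nrm (T' (v, v')) * 2^-1 ^+ n /\ nrm (T' (z n)) <= 2^-1.
  elim: n => [|n [IH1 IH2]]; first by rewrite expr0 mulr1.
  rewrite /z iterS TS' -/(z n); have := newton_nrm IH2.
  by rewrite exprS; split; move: (nrm_ge0 (T' (z n))); lra.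
have le2 a b : is_adjoint dot a b -> nrm (bop_id - b ∙ a) <= 2^-1 -> nrm a <= 2.
  move=> ab h; have := nrm_sqr_adj ab.
  have : nrm (b ∙ a) <= 3 / 2.
    rewrite -[b ∙ a](subKr bop_id) (le_trans (nrmB _ _))//.
    have : nrm (bop_id : 'B(H)) <= 1.
      by apply: nrm_bop_le => // x; rewrite mul1r.
    by move: h; lra.
  by have := nrm_ge0 a; move: (nrm a) => r *; nra.
(* An increment is [z t / 2] with [nrm z <= 2], hence at most [nrm t], which decays geometrically;
   summation costs the factor 2. *)
have [g zg gv] : exists2 g : 'B(H), (z n).1 @[n --> \oo] --> g &
    nrm (g - (z 0%N).1) <= 2 * nrm (T (v, v')).
  apply: geometric_limit; first exact/seq_complete_bop/complete_seq_complete.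
  move=> n; have [+ Tz] := Tn n; apply: le_trans.
  rewrite /= compDr comp1r compZr addrC addKr h2E nrmZr ger0_norm ?invr_ge0//.
  have := nrm_comp (z n).1 (T (z n)); have := le2 _ _ (Sadj _ _ (zS n)) Tz.
  by have := nrm_ge0 (T (z n)); move: (nrm _) (nrm _) (nrm _) => *; nra.
have [g' zg' _] : exists2 g : 'B(H), (z n).2 @[n --> \oo] --> g &
    nrm (g - (z 0%N).2) <= 2 * nrm (T (v, v')).
  apply: geometric_limit; first exact/seq_complete_bop/complete_seq_complete.
  move=> n; have [+ Tz] := Tn n; apply: le_trans.
  rewrite /= compDl comp1l compZl addrC addKr h2E nrmZr ger0_norm ?invr_ge0//.
  have := nrm_comp (T (z n)) (z n).2.
  have := nrm_adj norm_dot (adj_sym (Sadj _ _ (zS n))).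
  have := le2 _ _ (Sadj _ _ (zS n)) Tz.
  by have := nrm_ge0 (T (z n)); move: (nrm _) (nrm _) (nrm _) (nrm _) => *; nra.
have inv (a b : nat -> 'B(H)) a0 b0 c : (forall n, nrm (a n) <= 2) ->
    (forall n, nrm (bop_id - a n ∙ b n) <= c * 2^-1 ^+ n) ->
    a n @[n --> \oo] --> a0 -> b n @[n --> \oo] --> b0 -> a0 ∙ b0 = bop_id.
  move=> a2 ab aa bb; apply: (@cvg_uniq _ _ (fun n => a n ∙ b n)).
    exact: comp_cvg a2 aa bb.
  apply/cvg_nrmP => e e0; have [N Ne] := half_exp_small c e0.
  exists N => n Nn; rewrite nrmC (le_lt_trans (ab n))// (le_lt_trans _ Ne)//.
  have c0 : 0 <= c by rewrite -[c]mulr1 -(expr0 2^-1) (le_trans (nrm_ge0 _) (ab 0%N)).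
  by rewrite ler_wpM2l// ler_wiXn2l// ?invr_ge0// invf_le1 ?ler1n.
exists g, g'; split => //; first exact: Slim zS zg zg'.
  apply: (inv (fun n => (z n).2) (fun n => (z n).1)) zg' zg => n.
    apply: le_trans (le2 _ _ (Sadj _ _ (zS n)) (Tn n).2).
    by apply: (nrm_adj norm_dot); apply: adj_sym; exact: Sadj.
  exact: (Tn n).1.
apply: (inv (fun n => (z n).1) (fun n => (z n).2)) zg zg' => n.
  exact: (le2 _ _ (Sadj _ _ (zS n)) (Tn n).2).
exact: (Tn' n).1.
Qed.

End Polar.

Lemma cop_cvg {R : realType} {E : normedModType R[i]} (u : nat -> 'K(E)) (l : 'K(E)) :
  u n @[n --> \oo] --> l -> (u n : 'B(E)) @[n --> \oo] --> (l : 'B(E)).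
Proof. by move=> /cvg_nrmP ul; apply/cvg_nrmP => e /ul. Qed.

Lemma subrACA (V : zmodType) (a b c d : V) : (a - b) - (c - d) = (a - c) - (b - d).
Proof. by rewrite opprD addrACA -opprD. Qed.

(** * Topology and tangent spaces of the orbit *)

Section Unitaries.
Context {R : realType} {H : completeNormedModType R[i]}.
Variable dot : {dot H for Num.conj}.
Hypothesis norm_dot : forall x : H, `|x| ^+ 2 = dot x x.
Implicit Types (k : 'K(H)) (a b u : 'B(H)).

Definition compact_pert a := exists k : 'K(H), a = bop_id + k.

Lemma compact_pertP a : compact_pert a <-> a - bop_id \in compact_op.
Proof.
split=> [[k ->]|ac]; first by rewrite addrC addKr; exact: cop_compact.
by exists (CompactOp ac); rewrite /= addrC subrK.
Qed.

Lemma compact_pertM a b : compact_pert a -> compact_pert b -> compact_pert (a ∙ b).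
Proof.
move=> [k ->] [k' ->]; exists (k' + k + lmul k k').
have -> : ((k' + k + lmul k k' : 'K(H)) : 'B(H)) =
  (k' : 'B(H)) + (k : 'B(H)) + k ∙ k' by [].
by rewrite compDl !compDr !comp1l comp1r !addrA.
Qed.

Lemma compact_pertS (r : R[i]) a : compact_pert a ->
  compact_pert (bop_id + r *: (bop_id - a)).
Proof.
move=> [k ->]; exists (- (r *: k)); congr (_ + _).
by rewrite opprD addrA subrr add0r scalerN.
Qed.

Lemma compact_pert_lim (a : nat -> 'B(H)) (a0 : 'B(H)) :
  (forall n, compact_pert (a n)) -> a n @[n --> \oo] --> a0 -> compact_pert a0.
Proof.
move=> ac /cvg_nrmP aa; apply/compact_pertP/compact_op_closed => e /aa[N Na].
exists (a N - bop_id); first exact/compact_pertP.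
by rewrite opprB addrA subrK; exact: Na.
Qed.

Definition commute a b := a ∙ b = b ∙ a.

Lemma commute1 b : commute bop_id b.
Proof. by rewrite /commute comp1l comp1r. Qed.

Lemma commuteM a a' b : commute a b -> commute a' b -> commute (a ∙ a') b.
Proof. by rewrite /commute => ab a'b; rewrite -compA a'b compA ab compA. Qed.

Lemma commuteD a a' b : commute a b -> commute a' b -> commute (a + a') b.
Proof. by rewrite /commute => ab a'b; rewrite compDl compDr ab a'b. Qed.

Lemma commuteZ (r : R[i]) a b : commute a b -> commute (r *: a) b.
Proof. by rewrite /commute => ab; rewrite compZl compZr ab. Qed.

Lemma commuteB a a' b : commute a b -> commute a' b -> commute (a - a') b.
Proof. by rewrite /commute => ab a'b; rewrite compBl compBr ab a'b. Qed.

Lemma commute_lim (a : nat -> 'B(H)) (a0 b : 'B(H)) :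
  (forall n, commute (a n) b) -> a n @[n --> \oo] --> a0 -> commute a0 b.
Proof.
move=> ab aa; apply: bopP => x.
apply: (@cvg_uniq _ _ (fun n => a n (b x))); first exact: (@bop_cvg _ _ a).
have -> : (fun n => a n (b x)) = (fun n => b (a n x)).
  by apply/funext => n; rewrite -!bop_compE ab.
by apply: bop_cvgr; exact: (@bop_cvg _ _ a).
Qed.

(* The second operator stands for the adjoint of the first one, which avoids
   the default value of [adjoint]. *)
Definition unitary_pair u u' := [/\ is_adjoint dot u u', u ∙ u' = bop_id,
  u' ∙ u = bop_id & compact_pert u].

(** The compactness of [u' - 1] comes from the identity [u' - 1 = - u' (u - 1)]. *)
Lemma unitary_pair_sym u u' : unitary_pair u u' -> unitary_pair u' u.
Proof.
move=> [a uu' u'u [k uk]]; split => //; first exact: adj_sym.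
exists (- lmul u' k).
have -> : ((- lmul u' k : 'K(H)) : 'B(H)) = - (u' ∙ (u - bop_id)).
  by rewrite uk addrC addKr.
by rewrite compBr u'u comp1r opprB addrC subrK.
Qed.

Lemma unitary_pairM u u' v v' : unitary_pair u u' -> unitary_pair v v' ->
  unitary_pair (u ∙ v) (v' ∙ u').
Proof.
move=> [a uu' u'u uk] [b vv' v'v vk]; split.
- exact: adj_comp.
- by rewrite compA -(compA u) vv' comp1r.
- by rewrite compA -(compA v') u'u comp1r.
- exact: compact_pertM.
Qed.

Lemma unitary_pair1 : unitary_pair bop_id bop_id.
Proof.
split; [exact: adj_id|exact: comp1l|exact: comp1l|].
by exists 0; rewrite [X in _ + X](_ : _ = 0) ?addr0.
Qed.

Lemma unitary_pair_adjoint u u' : unitary_pair u u' -> adjoint dot u = u'.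
Proof. by case=> a _ _ _; exact: (adjointE a). Qed.

Lemma unitary_pairP u : unitary_compact dot u <-> unitary_pair u (adjoint dot u).
Proof.
split=> [[[uu' u'u] /compact_pertP uc]|[_ uu' u'u /compact_pertP]] //.
split=> //; have [u0|/eqP/adjointP//] := eqVneq (adjoint dot u) 0.
(* Here the value 0 of [adjoint] may be the default one; but then [adjoint u ∙ u = 1] makes [H]
   trivial. *)
have zE (x : H) : x = 0.
  by have := congr1 (fun a : 'B(H) => a x) u'u; rewrite u0 comp0l.
by move=> x y; rewrite (zE x) linear0 !dot0l.
Qed.

Lemma unitary_pair_unitary u u' : unitary_pair u u' -> unitary_compact dot u.
Proof. by move=> uu'; apply/unitary_pairP; rewrite (unitary_pair_adjoint uu'). Qed.

Lemma nrm_unitary u u' : unitary_pair u u' -> nrm u <= 1.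
Proof.
move=> [a _ u'u _]; have := nrm_sqr_adj norm_dot a; rewrite u'u.
have : nrm (bop_id : 'B(H)) <= 1 by apply: nrm_bop_le => // x; rewrite mul1r.
by have := nrm_ge0 u; move: (nrm _) (nrm _) => *; nra.
Qed.

Lemma nrm_unitaryM u u' v v' a : unitary_pair u u' -> unitary_pair v v' ->
  nrm (u ∙ a ∙ v) <= nrm a.
Proof.
move=> uu' vv'; apply: le_trans (nrm_comp _ _) _.
apply: le_trans (ler_piMr (nrm_ge0 _) (nrm_unitary vv')) _.
apply: le_trans (nrm_comp _ _) _.
exact: ler_piMl (nrm_ge0 _) (nrm_unitary uu').
Qed.

(** If [adjoint] takes the value 0, by default or not, skewness gives [k = 0], whose adjoint is
    indeed 0. *)
Lemma skew_adj (k : 'K(H)) : skew_compact dot k <-> is_adjoint dot k (- (k : 'B(H))).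
Proof.
split; last exact: adjointE.
rewrite /skew_compact /= => kk.
have [k0|/eqP/adjointP] := eqVneq (adjoint dot k) 0; last by rewrite kk.
have -> : (k : 'B(H)) = 0 by apply/oppr_inj; rewrite -kk k0 oppr0.
by rewrite oppr0; exact: adj0.
Qed.

End Unitaries.

Lemma eta_small {R : realType} (x : R) : x <= 12^-1 -> 2 * x <= 1 /\ 6 * x <= 2^-1.
Proof. by move=> ?; split; lra. Qed.

Lemma lt_div15 {R : realType} (r e : R) : r < e / 15 -> 0 <= r -> 14 * r < e.
Proof. lra. Qed.

Section Quasi.
Context {R : realType} {H : completeNormedModType R[i]}.
Variable dot : {dot H for Num.conj}.
Hypothesis norm_dot : forall x : H, `|x| ^+ 2 = dot x x.
Variables (w : option nat) (p : nat -> 'B(H)) (P : 'B('K(H))).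
Hypothesis p_family : projection_family dot w p.
Hypothesis P_pinching : pinching w p P.
Implicit Types (k : 'K(H)) (a b c u : 'B(H)) (x y : H).

Local Notation delta := (lcomm P).
Local Notation diag := (block_diag p P).
Local Notation pi := (unitary_orbit_map dot P).

Lemma diagB k k' : diag (k - k') = diag k - diag k'.
Proof.
rewrite /block_diag linearB /= opprD addrACA; congr (_ + _).
by apply: val_inj; rewrite /= -compBl -compBr.
Qed.

Lemma tangentP A : unitary_orbit_tangent dot P A <->
  exists2 k : 'K(H), is_adjoint dot k (- (k : 'B(H))) & A = delta k.
Proof.
split=> [[k /skew_adj ks <-]|[k /skew_adj ks ->]]; first by exists k.
by exists k.
Qed.

Lemma skewB (k l : 'K(H)) : is_adjoint dot k (- (k : 'B(H))) ->
  is_adjoint dot l (- (l : 'B(H))) ->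
  is_adjoint dot (k - l : 'K(H)) (- ((k - l : 'K(H)) : 'B(H))).
Proof.
move=> ks ls; have -> : - ((k - l : 'K(H)) : 'B(H)) = - (k : 'B(H)) - (- (l : 'B(H))).
  by rewrite copBE opprD.
exact: (adjB ks ls).
Qed.

Lemma skew_diag k : is_adjoint dot k (- (k : 'B(H))) ->
  is_adjoint dot (diag k) (- (diag k : 'B(H))).
Proof.
move=> ks; have d0 : diag 0 = 0 by rewrite -[X in diag X](subrr k) diagB subrr.
have dN : diag (- k) = - diag k by rewrite -(sub0r k) diagB d0 sub0r.
have -> : - (diag k : 'B(H)) = (- diag k : 'K(H)) by [].
by rewrite -dN; exact: (diag_adj norm_dot p_family P_pinching).
Qed.

Lemma skew_off_diag k : is_adjoint dot k (- (k : 'B(H))) ->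
  nrm (k - diag k) <= 2 * nrm (delta k).
Proof.
move=> ks; have := @nrm_off_diag _ _ _ norm_dot _ _ _ p_family P_pinching k (- k) ks.
have e : delta (- k : 'K(H)) = - delta k by exact: lcommN.
rewrite e nrmN.
by move: (nrm _) (nrm _) => *; lra.
Qed.

Lemma tangent_closed : closed_subspace (unitary_orbit_tangent dot P).
Proof.
split.
  split.
  - apply/tangentP; exists 0; last by rewrite lcomm0.
    by rewrite oppr0; exact: adj0.
  - move=> A B /tangentP[k ks ->] /tangentP[l ls ->]; apply/tangentP.
    by exists (k + l); [rewrite opprD; exact: adjD|rewrite -lcommD].
  - move=> r A /tangentP[k ks ->]; apply/tangentP.
    by exists (r%:C *: k); [rewrite -scalerN; exact: adjZr|rewrite -lcommZ].
apply/closed_nrmP => A TA.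
have /choice[k kP] n : exists k : 'K(H), is_adjoint dot k (- (k : 'B(H))) /\
    nrm (delta k - A) < n.+1%:R^-1.
  have [|_ /tangentP[k ks ->]] := TA n.+1%:R^-1; first by rewrite invr_gt0.
  by exists k.
have kA : delta (k n) @[n --> \oo] --> A.
  apply/cvg_nrmP => e e0; exists (Num.bound e^-1) => n en.
  rewrite (lt_trans (kP n).2)// invf_plt ?posrE//.
  rewrite (lt_le_trans (archi_boundP _)) ?invr_ge0 ?(ltW e0)//.
  by rewrite ler_nat leqW.
(* The [k n] need not converge. Without their block diagonal parts they have the same image under
   [delta] and form a Cauchy sequence by [skew_off_diag]. *)
pose y n := k n - diag (k n).
have ys n : is_adjoint dot (y n) (- (y n : 'B(H))).
  by apply: skewB; [exact: (kP n).1|exact: skew_diag (kP n).1].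
have dy n : delta (y n) = delta (k n).
  by rewrite /y copBE lcommB (lcomm_block_diag norm_dot p_family P_pinching) subr0.
have [l yl] : exists l : 'K(H), y n @[n --> \oo] --> l.
  apply: seq_complete_cop => e e0.
  have /(_ (e / 2))[|N Nk] := @cvg_cauchy _ _ _ _ kA; first by rewrite divr_gt0.
  exists N => m n /Nk mk /mk.
  have -> : y m - y n = (k m - k n) - diag (k m - k n).
    by rewrite diagB; exact: subrACA.
  have := @skew_off_diag (k m - k n).
  rewrite -lcommB => /(_ _)/le_lt_trans H1 H2; apply: H1.
    by apply: skewB; [exact: (kP m).1|exact: (kP n).1].
  by move: H2; lra.
apply/tangentP; exists l.
  apply: (adj_lim norm_dot ys); first exact: cop_cvg.
  by apply: cvgN; exact: cop_cvg.
have dl : delta (y n) @[n --> \oo] --> delta l.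
  apply/cvg_nrmP => e e0; have c0 : 0 < 2 * nrm P + 1.
    by rewrite ltr_wpDl ?mulr_ge0 ?nrm_ge0.
  have /cvg_nrmP/(_ (e / (2 * nrm P + 1)))[|N Nl] := yl; first by rewrite divr_gt0.
  exists N => n /Nl; rewrite ltr_pdivlMr// => h.
  rewrite -lcommB (le_lt_trans (nrm_lcomm P _))// (le_lt_trans _ h)//.
  by rewrite mulrC -copBE -nrm_cop ler_wpM2l ?nrm_ge0// lerDl.
by apply: cvg_uniq dl; under eq_fun do rewrite dy.
Qed.

Lemma orbit_mapE u u' : unitary_pair dot u u' -> pi u = lmul u ∙ P ∙ lmul u'.
Proof. by move=> /unitary_pair_adjoint <-. Qed.

Lemma lmulB a b : lmul (a - b) = lmul a - lmul b :> 'B('K(H)).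
Proof.
by rewrite addrC -scaleN1r lmulP scaleN1r addrC.
Qed.

Lemma lmulK u u' : unitary_pair dot u u' -> lmul u ∙ lmul u' = bop_id :> 'B('K(H)).
Proof. by case=> _ uu' _ _; rewrite -lmul_comp uu' lmul1. Qed.

Lemma lcomm1 : delta bop_id = 0.
Proof. by rewrite /lcomm lmul1 comp1l comp1r subrr. Qed.

Lemma nrm_conj u u' u0 u0' (A : 'B('K(H))) :
  unitary_pair dot u u' -> unitary_pair dot u0 u0' ->
  nrm (lmul u ∙ A ∙ lmul u0) <= nrm A.
Proof.
move=> uu' u0u0'; rewrite (le_trans (nrm_comp _ _))//.
have h1 := nrm_comp (lmul u) A; have h2 := nrm_lmul u.
have h3 := nrm_unitary norm_dot uu'.
have h4 := nrm_lmul u0; have h5 := nrm_unitary norm_dot u0u0'.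
have := nrm_ge0 A; have := nrm_ge0 (lmul u0); have := nrm_ge0 (lmul u : 'B('K(H))).
have := nrm_ge0 (lmul u ∙ A).
have h6 : nrm (lmul u : 'B('K(H))) <= 1 by exact: le_trans h2 h3.
have h7 : nrm (lmul u0 : 'B('K(H))) <= 1 by exact: le_trans h4 h5.
move: h1 h6 h7; move: (nrm _) (nrm _) (nrm _) (nrm _) => *; nra.
Qed.

(** Reduction to the base point: the left side is the difference of the two orbit points, multiplied
    by [lmul u0'] on the left and [lmul u] on the right, which does not increase norms. *)
Lemma lcomm_orbit u u' u0 u0' : unitary_pair dot u u' -> unitary_pair dot u0 u0' ->
  nrm (delta (u0' ∙ u)) <= nrm (pi u - pi u0).
Proof.
move=> uu' u0u0'; rewrite (orbit_mapE uu') (orbit_mapE u0u0').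
suff -> : delta (u0' ∙ u) =
    lmul u0' ∙ (lmul u ∙ P ∙ lmul u' - lmul u0 ∙ P ∙ lmul u0') ∙ lmul u.
  exact: nrm_conj (unitary_pair_sym u0u0') uu'.
rewrite /lcomm lmul_comp compBr compBl; congr (_ - _).
  by rewrite -!compA (lmulK (unitary_pair_sym uu')) comp1r.
by rewrite !compA (lmulK (unitary_pair_sym u0u0')) comp1l.
Qed.

(** The block diagonal operator [v = 1 + diag (a - 1)] is within [2 * eta] of [a]. Since
    [nrm v <= 2], the defect of [v] is at most [2 * eta + 2 * (2 * eta) = 6 * eta], which has to be
    at most one half for Newton's iteration; hence [12^-1]. The iteration moves [v] by at most twice
    the defect, and [14 = 2 + 12]. *)
Lemma near_isotropy a a' (eta : R) : unitary_pair dot a a' -> eta <= 12^-1 ->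
  nrm (delta a) <= eta -> nrm (delta a') <= eta ->
  exists g g', [/\ unitary_pair dot g g', forall i, idx w i -> g ∙ p i = p i ∙ g &
    nrm (a - g) <= 14 * eta].
Proof.
move=> aa' eta12 da da'.
have [_ _ _ [k ak]] := aa'; have [_ _ _ [k' ak']] := unitary_pair_sym aa'.
have kk' : is_adjoint dot k k'.
  have -> : (k : 'B(H)) = a - bop_id by rewrite ak addrC addKr.
  have -> : (k' : 'B(H)) = a' - bop_id by rewrite ak' addrC addKr.
  by apply: adjB; [case: aa'|exact: adj_id].
pose v := bop_id + (diag k : 'B(H)); pose v' := bop_id + (diag k' : 'B(H)).
have dk : delta k = delta a by rewrite ak lcommD lcomm1 add0r.
have dk' : delta k' = delta a' by rewrite ak' lcommD lcomm1 add0r.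
have av : nrm (a - v) <= 2 * eta.
  have -> : a - v = (k - diag k : 'K(H)) :> 'B(H).
    by rewrite ak /v opprD addrACA subrr add0r.
  have := nrm_off_diag norm_dot p_family P_pinching kk'.
  rewrite dk dk' nrm_cop => /le_trans; apply.
  by rewrite mulr_natl mulr2n; exact: lerD da da'.
have av' : nrm (a' - v') <= 2 * eta.
  have -> : a' - v' = (k' - diag k' : 'K(H)) :> 'B(H).
    by rewrite ak' /v' opprD addrACA subrr add0r.
  have := nrm_off_diag norm_dot p_family P_pinching (adj_sym kk').
  rewrite dk dk' nrm_cop => /le_trans; apply.
  by rewrite mulr_natl mulr2n; exact: lerD da' da.
have eta0 : 0 <= eta by exact: le_trans (nrm_ge0 _) da.
have prod (b b' c c' : 'B(H)) : unitary_pair dot b b' -> unitary_pair dot b' b ->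
    nrm (b - c) <= 2 * eta -> nrm (b' - c') <= 2 * eta ->
    nrm (bop_id - c' ∙ c) <= 6 * eta.
  move=> bb' b'b bc bc'; have [_ _ <- _] := bb'.
  have -> : b' ∙ b - c' ∙ c = b' ∙ (b - c) + (b' - c') ∙ c.
    by rewrite compBl compBr addrA subrK.
  have h1 := nrm_comp b' (b - c); have h2 := nrm_comp (b' - c') c.
  have h4 := nrm_unitary norm_dot bb'; have h5 := nrm_unitary norm_dot b'b.
  have h6 : nrm c <= 2.
    rewrite -[c](subKr b) (le_trans (nrmB _ _))// -[leRHS]/(1 + 1) lerD//.
    exact: le_trans bc (eta_small eta12).1.
  rewrite (le_trans (nrmD _ _))//.
  have h7 : nrm (b' ∙ (b - c)) <= 2 * eta.
    by rewrite (le_trans h1)// (le_trans _ bc)// ler_piMl ?nrm_ge0.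
  have h8 : nrm ((b' - c') ∙ c) <= 2 * eta * 2.
    by rewrite (le_trans h2)// ler_pM ?nrm_ge0.
  by rewrite (_ : 6 * eta = 2 * eta + 2 * eta * 2); [exact: lerD|ring].
(* Newton's iteration and its limit stay among the block diagonal compact perturbations of the
   identity; this puts the polar part in the isotropy group. *)
pose S b b' := [/\ is_adjoint dot b b', compact_pert b, compact_pert b' &
  forall i, idx w i -> commute b (p i) /\ commute b' (p i)].
have vd (l : 'K(H)) i : idx w i -> commute (bop_id + (diag l : 'B(H))) (p i).
  move=> /andP[_ iw]; rewrite /commute compDl compDr comp1l comp1r.
  by rewrite (diag_commute norm_dot p_family P_pinching).
have Sv : S v v'.
  split; [|by exists (diag k)|by exists (diag k')|by move=> i ii; split; exact: vd].
  apply: adjD; first exact: adj_id.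
  exact: (diag_adj norm_dot p_family P_pinching).
have v2 : nrm (bop_id - v' ∙ v) <= 6 * eta.
  by apply: prod aa' (unitary_pair_sym aa') _ _.
have v2' : nrm (bop_id - v ∙ v') <= 6 * eta.
  by apply: prod (unitary_pair_sym aa') aa' _ _.
have step (b b' : 'B(H)) : S b b' -> let t := bop_id - b' ∙ b in
    S (b ∙ (bop_id + (2^-1 : R)%:C *: t)) ((bop_id + (2^-1 : R)%:C *: t) ∙ b').
  move=> [bb' bc b'c bp] t.
  have tt : is_adjoint dot t t.
    by apply: adjB; [exact: adj_id|apply: adj_comp => //; exact: adj_sym].
  have tc : compact_pert (bop_id + (2^-1 : R)%:C *: t).
    by apply: compact_pertS; exact: compact_pertM.
  split.
  - apply: adj_comp => //; apply: adjD; [exact: adj_id|exact: adjZr].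
  - exact: compact_pertM.
  - exact: compact_pertM.
  - move=> i /bp[cb cb'].
    have ct : commute (bop_id + (2^-1 : R)%:C *: t) (p i).
      apply: commuteD; first exact: commute1.
      apply: commuteZ; apply: commuteB; first exact: commute1.
      exact: commuteM.
    by split; exact: commuteM.
have lim (b b' : nat -> 'B(H)) (b0 b0' : 'B(H)) : (forall n, S (b n) (b' n)) ->
    b n @[n --> \oo] --> b0 -> b' n @[n --> \oo] --> b0' -> S b0 b0'.
  move=> bb bl bl'; split.
  - by apply: (adj_lim norm_dot _ bl bl') => n; have [] := bb n.
  - by apply: (compact_pert_lim _ bl) => n; have [] := bb n.
  - by apply: (compact_pert_lim _ bl') => n; have [] := bb n.
  - move=> i ii; split; [apply: (commute_lim _ bl)|apply: (commute_lim _ bl')].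
      by move=> n; have [_ _ _ /(_ i ii)[]] := bb n.
    by move=> n; have [_ _ _ /(_ i ii)[]] := bb n.
have v3 : nrm (bop_id - v' ∙ v) <= 2^-1 by exact: le_trans v2 (eta_small eta12).2.
have v3' : nrm (bop_id - v ∙ v') <= 2^-1 by exact: le_trans v2' (eta_small eta12).2.
have Sadj (b b' : 'B(H)) : S b b' -> is_adjoint dot b b' by case.
have [g [g' [[gg' gc _ gp] g'g gg1 gv]]] :=
  polar_newton norm_dot Sadj step lim Sv v3 v3'.
exists g, g'; split; [by split|by move=> i /gp[]|].
have vg : nrm (v - g) <= 2 * (6 * eta).
  by rewrite nrmC (le_trans gv)// ler_wpM2l.
rewrite (_ : 14 * eta = 2 * eta + 2 * (6 * eta)); last by ring.
exact: le_trans (nrm_tri v a g) (lerD av vg).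
Qed.

Lemma orbit_mapM u u' g g' : unitary_pair dot u u' -> unitary_pair dot g g' ->
  (forall i, idx w i -> commute g (p i)) -> pi (u ∙ g') = pi u.
Proof.
move=> uu' gg' gp; have hg := unitary_pairM uu' (unitary_pair_sym gg').
have e : lmul g' ∙ P ∙ lmul g = P.
  rewrite -compA -(lmul_commute P_pinching gp) compA.
  by rewrite (lmulK (unitary_pair_sym gg')) comp1l.
by rewrite (orbit_mapE hg) (orbit_mapE uu') !lmul_comp -[in RHS]e !compA.
Qed.

(** If the orbit points of [u] and [u0] are close, [adjoint u0 ∙ u] is close to some [g] in the
    isotropy group; then [u ∙ g'] has the same orbit point as [u] and is close to [u0]. The other
    direction is the Lipschitz continuity of the orbit map, with constant [2 * nrm P]. *)
Lemma orbit_topology :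
  inherited_topology (unitary_orbit dot P) (unitary_orbit_open dot P).
Proof.
move=> V VN; split.
  move=> [_ /open_subspace_nrmP oV]; apply/open_subspace_nrmP => Q VQ [u0 uc0 uQ].
  have u0u0' := (unitary_pairP dot u0).1 uc0.
  have [|e e0 eV] := oV u0 _ uc0; first by rewrite /preimage /= uQ.
  (* [12^-1] is the range of [near_isotropy], and a distance below [e / 15] turns its bound with
     factor 14 into a strict one by [e]. *)
  exists (Num.min 12^-1 (e / 15)); first by rewrite lt_min invr_gt0 divr_gt0//= ltr0n.
  move=> _ [u uc <-]; rewrite lt_min -uQ => /andP[d1 d2].
  have uu' := (unitary_pairP dot u).1 uc.
  have aa' := unitary_pairM (unitary_pair_sym u0u0') uu'.
  have da := lcomm_orbit uu' u0u0'.
  have da' := lcomm_orbit u0u0' uu'; rewrite (nrmC (pi u0)) in da'.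
  have [g [g' [gg' gp ag]]] := near_isotropy aa' (ltW d1) da da'.
  rewrite -(orbit_mapM uu' gg' gp); apply: eV.
    exact: unitary_pair_unitary (unitary_pairM uu' (unitary_pair_sym gg')).
  have -> : u ∙ g' - u0 = u0 ∙ (adjoint dot u0 ∙ u - g) ∙ g'.
    have [_ u0u0a _ _] := u0u0'; have [_ gg _ _] := gg'.
    by rewrite compBr compBl compA u0u0a comp1l -(compA u0) gg comp1r.
  apply: le_lt_trans (nrm_unitaryM norm_dot _ u0u0' (unitary_pair_sym gg')) _.
  exact: le_lt_trans ag (lt_div15 d2 (nrm_ge0 _)).
move=> /open_subspace_nrmP oV; split=> //; apply/open_subspace_nrmP => u0 Vu0 uc0.
have [|e e0 eV] := oV _ Vu0; first by exists u0.
have c0 : 0 < 2 * nrm P + 1 by rewrite ltr_wpDl ?mulr_ge0 ?nrm_ge0.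
exists (e / (2 * nrm P + 1)); first by rewrite divr_gt0.
move=> u uc; rewrite ltr_pdivlMr// => ue; apply: eV; first by exists u.
have u0u0' := (unitary_pairP dot u0).1 uc0; have uu' := (unitary_pairP dot u).1 uc.
rewrite (orbit_mapE u0u0') (orbit_mapE uu').
move: (adjoint dot u) (adjoint dot u0) uu' u0u0' => u' u0' uu' u0u0'.
have -> : lmul u ∙ P ∙ lmul u' - lmul u0 ∙ P ∙ lmul u0' =
    lmul (u - u0) ∙ P ∙ lmul u' + lmul u0 ∙ P ∙ lmul (u' - u0').
  by rewrite !lmulB !compBl compBr addrA subrK.
have t1 : nrm (lmul (u - u0) ∙ P ∙ lmul u') <= nrm (u - u0) * nrm P.
  apply: le_trans (nrm_comp _ _) _; rewrite -[leRHS]mulr1 ler_pM ?nrm_ge0//.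
    by apply: le_trans (nrm_comp _ _) _; rewrite ler_wpM2r ?nrm_ge0 ?nrm_lmul.
  exact: le_trans (nrm_lmul _) (nrm_unitary norm_dot (unitary_pair_sym uu')).
have t2 : nrm (lmul u0 ∙ P ∙ lmul (u' - u0')) <= nrm P * nrm (u - u0).
  apply: le_trans (nrm_comp _ _) _; rewrite ler_pM ?nrm_ge0//.
    apply: le_trans (nrm_comp _ _) _; rewrite -[leRHS]mul1r ler_wpM2r ?nrm_ge0//.
    exact: le_trans (nrm_lmul _) (nrm_unitary norm_dot u0u0').
  apply: le_trans (nrm_lmul _) _; apply: (nrm_adj norm_dot).
  by apply: adjB; [case: (unitary_pair_sym uu')|case: (unitary_pair_sym u0u0')].
apply: le_lt_trans (nrmD _ _) _; apply: le_lt_trans (lerD t1 t2) _.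
apply: le_lt_trans ue; rewrite (mulrC (nrm P)) -mulrDr ler_wpM2l ?nrm_ge0//.
by rewrite mulr_natl mulr2n lerDl.
Qed.

Lemma conj_op u u' : unitary_pair dot u u' -> exists C : 'B('B('K(H))),
  forall A, C A = lmul u' ∙ A ∙ lmul u.
Proof.
move=> uu'; apply: (@bop_of_linear _ _ _ _ 1) => [r A B|A].
  by rewrite compDr compDl compZr compZl.
by rewrite mul1r; exact: nrm_conj (unitary_pair_sym uu') uu'.
Qed.

Lemma skew_conj u u' k : unitary_pair dot u u' -> is_adjoint dot k (- (k : 'B(H))) ->
  is_adjoint dot (rmul (lmul u k) u') (- (rmul (lmul u k) u' : 'B(H))).
Proof.
move=> [uu' _ _ _] ks.
have -> : - (rmul (lmul u k) u' : 'B(H)) = u ∙ (- (k : 'B(H)) ∙ u').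
  by rewrite compNl compNr compA.
by apply: adj_comp; [exact: adj_comp|exact: adj_sym].
Qed.

Lemma tangent_conj u u' A : unitary_pair dot u u' ->
  unitary_orbit_tangent dot (pi u) A <->
  unitary_orbit_tangent dot P (lmul u' ∙ A ∙ lmul u).
Proof.
move=> uu'; rewrite tangentP (orbit_mapE uu'); split.
  move=> [k /skew_adj ks <-]; exists (rmul (lmul u' k) u).
    exact: skew_conj (unitary_pair_sym uu') ks.
  rewrite /lcomm (compBr (lmul u')) compBl.
  rewrite (_ : lmul (rmul (lmul u' k) u : 'B(H)) = lmul u' ∙ lmul k ∙ lmul u).
    congr (_ - _); last by rewrite !compA (lmulK (unitary_pair_sym uu')) comp1l.
    by rewrite -!compA (lmulK (unitary_pair_sym uu')) comp1r.
  by rewrite -!lmul_comp.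
move=> [k ks Ak]; exists (rmul (lmul u k) u').
  by apply/skew_adj; exact: skew_conj uu' ks.
rewrite (_ : lmul (rmul (lmul u k) u' : 'B(H)) =
  lmul u ∙ lmul k ∙ lmul u'); last first.
  by rewrite -!lmul_comp.
have -> : A = lmul u ∙ delta k ∙ lmul u'.
  by rewrite -Ak -!compA (lmulK uu') comp1r compA (lmulK uu') comp1l.
rewrite /lcomm compBr compBl; congr (_ - _).
  rewrite -!compA; congr (_ ∙ (_ ∙ _)).
  by rewrite (compA (lmul u')) (lmulK (unitary_pair_sym uu')) comp1l.
rewrite -!compA; congr (_ ∙ (_ ∙ _)).
by rewrite (compA (lmul u')) (lmulK (unitary_pair_sym uu')) comp1l.
Qed.

End Quasi.

(** * Closed and complemented subspaces under isomorphisms *)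

Section Preimage.
Context {R : realType} {V : normedModType R[i]}.

Lemma preimage_closed_subspace (C : 'B(V)) (S : set V) :
  closed_subspace S -> closed_subspace (C @^-1` S).
Proof.
move=> [[S0 SD SZ] /closed_nrmP cS]; split.
  split; rewrite /preimage /=.
  - by rewrite linear0.
  - by move=> x y Sx Sy; rewrite linearD; exact: SD.
  - by move=> r x Sx; rewrite linearZ; exact: SZ.
apply/closed_nrmP => x xS; apply: cS => e e0.
have c0 : 0 < nrm C + 1 by rewrite ltr_wpDl ?nrm_ge0.
have [|y Sy yx] := xS (e / (nrm C + 1)); first by rewrite divr_gt0.
exists (C y) => //; rewrite -linearB (le_lt_trans (nrm_bop _ _))//.
move: yx; rewrite ltr_pdivlMr// mulrC; apply: le_lt_trans.
by rewrite ler_wpM2r ?nrm_ge0// lerDl.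
Qed.

Lemma preimage_complemented (C D : 'B(V)) (S : set V) :
  C ∙ D = bop_id -> D ∙ C = bop_id -> complemented S -> complemented (C @^-1` S).
Proof.
move=> CD DC [cS [T [cT ST all]]].
have CDx x : C (D x) = x by rewrite -bop_compE CD.
have DCx x : D (C x) = x by rewrite -[LHS]bop_compE DC.
split; first exact: preimage_closed_subspace.
exists (C @^-1` T); split; first exact: preimage_closed_subspace.
  apply/seteqP; split=> [x [Sx Tx]|_ ->] /=.
    have : (S `&` T) (C x) by [].
    by rewrite ST /= => Cx; rewrite -(DCx x) Cx linear0.
  by case: cS => -[S0 _ _] _; case: cT => -[T0 _ _] _; rewrite /preimage /= linear0.
move=> x; have [s [t [Ss Tt Cx]]] := all (C x).
exists (D s), (D t); split; rewrite /preimage /= ?CDx//.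
by rewrite -[LHS]DCx Cx linearD.
Qed.

End Preimage.

(** * A complement of the tangent space *)

Section Projection.
Context {R : realType} {V : normedModType R[i]}.

(** The complement is the kernel of [F]. The projection is a bare function because the one needed
    below involves adjoints and is only real linear. *)
Lemma complemented_proj (F : V -> V) (M : R) (S : set V) : closed_subspace S ->
  (forall x y, F (x + y) = F x + F y) ->
  (forall (r : R) x, F (r%:C *: x) = r%:C *: F x) ->
  (forall x, nrm (F x) <= M * nrm x) -> (forall x, S (F x)) ->
  (forall x, S x -> F x = x) -> complemented S.
Proof.
move=> cS FD FZ FM FS Fid; split => //; exists [set x | F x = 0].
have F0 : F 0 = 0 by apply: (addrI (F 0)); rewrite -FD !addr0.
have FN x : F (- x) = - F x.
  by apply: (addrI (F x)); rewrite -FD !subrr F0.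
split.
- split.
    split=> [//|x y /= Fx Fy|r x /= Fx]; first by rewrite FD Fx Fy addr0.
    by rewrite FZ Fx scaler0.
  apply/closed_nrmP => x xT; apply: nrm_small => e e0.
  have c0 : 0 < `|M| + 1 by rewrite ltr_wpDl.
  have [|y /= Fy yx] := xT (e / (`|M| + 1)); first by rewrite divr_gt0.
  have -> : F x = F (x - y) by rewrite FD FN Fy subr0.
  rewrite (le_trans (FM _))// nrmC; move: yx; rewrite ltr_pdivlMr// mulrC => yx.
  rewrite (le_trans _ (ltW yx))// ler_wpM2r ?nrm_ge0//.
  by rewrite (le_trans (ler_norm _))// lerDl.
- apply/seteqP; split=> [x [/Fid Fx /= F0x]|_ ->] /=; first by rewrite -Fx.
  by split=> //; case: cS => -[].
- move=> x; exists (F x), (x - F x); split; [exact: FS| |by rewrite addrC subrK].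
  by rewrite /= FD FN (Fid _ (FS x)) subrr.
Qed.

End Projection.

(** * Finite rank operators and their adjoints *)

Section FiniteRank.
Context {R : realType} {H : completeNormedModType R[i]}.
Variable dot : {dot H for Num.conj}.
Hypothesis norm_dot : forall x : H, `|x| ^+ 2 = dot x x.
Implicit Types (a b c q : 'B(H)).

(** Gram-Schmidt: the projection grows by the line of the component [y] of the last vector
    orthogonal to the previous ones, possibly zero. The induction also builds an adjoint of [c ∙ q]
    as a sum of rank one operators. *)
Lemma fin_cover n (v : 'I_n -> H) : exists q : 'B(H),
  [/\ is_adjoint dot q q, q ∙ q = q, q \in compact_op,
      forall c : 'B(H), exists b, is_adjoint dot (c ∙ q) b &
      forall i, q (v i) = v i].
Proof.
elim: n v => [|n IH] v.
  exists 0; split; [exact: adj0|by rewrite comp0l|exact: rpred0| |by case].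
  by move=> c; exists 0; rewrite comp0r; exact: adj0.
have [q [qa qq qc qT qv]] := IH (fun i => v (lift ord_max i)).
pose y := v ord_max - q (v ord_max).
have qy : q y = 0 by rewrite linearB /= -(bop_compE q) qq subrr.
pose l := line norm_dot y.
have ql : q ∙ l = 0.
  rewrite /l /line comp_rank1 bopZ qy scaler0; apply: bopP => x.
  by rewrite rank1E scaler0 bop0E.
have lq : l ∙ q = 0 by rewrite /l /line (rank1_comp _ _ _ qa) qy rank10r.
exists (q + l); split.
- by apply: adjD => //; exact: line_adj.
- by rewrite compDl !compDr qq ql lq line_idem addr0 add0r.
- by apply: rpredD => //; exact: rank1_compact.
- move=> c; have [b cb] := qT c.
  exists (b + rank1 norm_dot y (c ((nrm y ^- 2)%:C *: y))).
  by rewrite compDr; apply: adjD => //; rewrite comp_rank1; exact: rank1_adj.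
- move=> i; rewrite bopDE; case: (unliftP ord_max i) => [j|] ->.
    by rewrite qv -(qv j) -(bop_compE l) lq bop0E addr0.
  have -> : l (v ord_max) = y.
    have e : v ord_max = y + q (v ord_max) by rewrite subrK.
    have lqv : l (q (v ord_max)) = 0 by rewrite -(bop_compE l q) lq.
    by rewrite e linearD /= lqv addr0; exact: line_id.
  by rewrite addrC subrK.
Qed.

Definition compact_adj a := a \in compact_op /\
  exists2 b, is_adjoint dot a b & b \in compact_op.

Lemma compact_adj_sum I (s : seq I) (Q : pred I) (F : I -> 'B(H)) :
  (forall i, Q i -> compact_adj (F i)) -> compact_adj (\sum_(i <- s | Q i) F i).
Proof.
move=> FQ; elim/big_ind : _ => //.
  by split; [exact: rpred0|exists 0; [exact: adj0|exact: rpred0]].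
move=> a a' [ac [b ab bc]] [ac' [b' ab' bc']]; split; first exact: rpredD.
by exists (b + b'); [exact: adjD|exact: rpredD].
Qed.

(** Factor [a = q ∙ a] through a projection given by [fin_cover]. If [b] is the adjoint of [c ∙ q],
    then [c ∙ a] has the adjoint [a ∙ b], compact because [a] is. *)
Lemma fin_rank a c : is_adjoint dot a a -> finite_dimensional (range a) ->
  compact_adj (c ∙ a).
Proof.
move=> aa [n [v av]]; have [q [qa qq qc qT qv]] := fin_cover v.
have qaE : q ∙ a = a.
  apply: bopP => x; rewrite bop_compE; have [|d ->] := av (a x); first by exists x.
  by rewrite linear_sum; apply: eq_bigr => i _; rewrite linearZ /= qv.
have ac : a \in compact_op by rewrite -qaE; exact: compact_op_compr.
split; first exact: compact_op_compl.
have [b cb] := qT c; exists (a ∙ b); last exact: compact_op_compr.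
have -> : c ∙ a = c ∙ q ∙ a by rewrite -compA qaE.
exact: adj_comp.
Qed.

Definition has_adj a := exists b, is_adjoint dot a b.

Lemma has_adjP a : has_adj a -> is_adjoint dot a (adjoint dot a).
Proof. by move=> [b ab]; rewrite (adjointE ab). Qed.

Lemma adjoint_lin (r : R) a b : has_adj a -> has_adj b ->
  adjoint dot (r%:C *: a + b) = r%:C *: adjoint dot a + adjoint dot b.
Proof.
move=> /has_adjP aa /has_adjP bb; apply: adjointE.
by apply: adjD => //; exact: adjZr.
Qed.

End FiniteRank.

(** * Reading blocks off operators on ['K(H)] *)

Section Coefficients.
Context {R : realType} {H : completeNormedModType R[i]}.
Variable dot : {dot H for Num.conj}.
Hypothesis norm_dot : forall x : H, `|x| ^+ 2 = dot x x.
Implicit Types (A B : 'B('K(H))) (x y e : H).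

Lemma crank1_lin (r : R[i]) x y e :
  crank1 norm_dot (r *: x + y) e = r *: crank1 norm_dot x e + crank1 norm_dot y e.
Proof.
apply: val_inj; apply: bopP => z.
rewrite [RHS]bopDE [X in _ = X + _]bopZE !crank1E scalerDr !scalerA.
by rewrite mulrC.
Qed.

Lemma nrm_crank1 x e : nrm (crank1 norm_dot x e) <= nrm x * nrm e.
Proof. by rewrite nrm_cop; exact: nrm_rank1. Qed.

Lemma slice_ex A e : exists T : 'B(H), forall x, T x = A (crank1 norm_dot x e) e.
Proof.
apply: (@bop_of_linear _ _ _ _ (nrm A * nrm e * nrm e)) => [r x y|x].
  by rewrite crank1_lin linearP.
apply: le_trans (nrm_bop _ _) _; rewrite mulrAC ler_wpM2r ?nrm_ge0//.
rewrite -nrm_cop; apply: le_trans (nrm_bop A _) _; rewrite -mulrA ler_wpM2l ?nrm_ge0//.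
by rewrite (mulrC (nrm e)); exact: nrm_crank1.
Qed.

(** For [A = lcomm P z] and a unit vector [e] in the range of [p i] this is the commutator of [z]
    and [p i], by [slice_lcomm]; yet it is defined, linear and bounded for all [A]. *)
Definition slice A e : 'B(H) := projT1 (cid (slice_ex A e)).

Lemma sliceE A e x : slice A e x = A (crank1 norm_dot x e) e.
Proof. by rewrite /slice; case: cid. Qed.

Lemma slice_lin (r : R[i]) A B e : slice (r *: A + B) e = r *: slice A e + slice B e.
Proof.
apply: bopP => x; rewrite [RHS]bopDE [X in _ = X + _]bopZE !sliceE.
exact: (copPE r (A (crank1 norm_dot x e)) (B (crank1 norm_dot x e)) e).
Qed.

Lemma nrm_slice A e : nrm e = 1 -> nrm (slice A e) <= nrm A.
Proof.
move=> e1; apply: nrm_bop_le => [|x]; first exact: nrm_ge0.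
rewrite sliceE; apply: le_trans (nrm_bop _ _) _; rewrite e1 mulr1.
rewrite -nrm_cop; apply: le_trans (nrm_bop A _) _; rewrite ler_wpM2l ?nrm_ge0//.
by have := nrm_crank1 x e; rewrite e1 mulr1.
Qed.

Variables (w : option nat) (p : nat -> 'B(H)) (P : 'B('K(H))).
Hypothesis p_family : projection_family dot w p.
Hypothesis P_pinching : pinching w p P.

Lemma slice_lcomm i (z : 'B(H)) e : idx w i -> p i e = e -> nrm e = 1 ->
  slice (lcomm P z) e = z ∙ p i - p i ∙ z.
Proof.
move=> ii pe e1; apply: bopP => x; rewrite sliceE.
have ee : dot e e = 1 by rewrite dot_nrm// e1 expr1n.
have -> : lcomm P z (crank1 norm_dot x e) e =
    z (P (crank1 norm_dot x e) e) - P (lmul z (crank1 norm_dot x e)) e by [].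
have -> : lmul z (crank1 norm_dot x e) = crank1 norm_dot (z x) e.
  by apply: val_inj; exact: comp_rank1.
rewrite !(P_rank1 norm_dot p_family P_pinching _ ii pe) !rank1E ee !scale1r.
by [].
Qed.

Lemma unit_in_range i : idx w i -> exists2 e, p i e = e & nrm e = 1.
Proof.
move=> ii; have [x px] : exists x, p i x <> 0.
  apply/not_existsP => px; apply: (proj_neq0 p_family ii).
  by apply: bopP => x; apply: contrapT; exact: px.
have n0 := nrm_gt0 px; exists ((nrm (p i x))^-1%:C *: p i x).
  by rewrite bopZ -(bop_compE (p i)) (proj_idem p_family ii).
by rewrite nrmZr ger0_norm ?invr_ge0 ?nrm_ge0// mulVf// lt0r_neq0.
Qed.

End Coefficients.

Lemma bop_sandwich {R : realType} {E : normedModType R[i]} (a b x y : 'B(E)) :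
  a ∙ (x - y) ∙ b = a ∙ x ∙ b - a ∙ y ∙ b.
Proof. by rewrite compBr compBl. Qed.

Lemma half_half (R : realType) : 2^-1 + 2^-1 = 1 :> R.
Proof. lra. Qed.

Section Complement.
Context {R : realType} {H : completeNormedModType R[i]}.
Variable dot : {dot H for Num.conj}.
Hypothesis norm_dot : forall x : H, `|x| ^+ 2 = dot x x.
Variables (N : nat) (p : nat -> 'B(H)) (P : 'B('K(H))).
Hypothesis p_family : projection_family dot (Some N) p.
Hypothesis P_pinching : pinching (Some N) p P.
Variable i0 : nat.
Hypothesis i0N : (i0 <= N)%N.
Hypothesis fin : forall j, (j <= N)%N -> j != i0 -> finite_dimensional (range (p j)).
Variable e : nat -> H.
Hypothesis pe : forall j, idx (Some N) j -> p j (e j) = e j.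
Hypothesis e1 : forall j, idx (Some N) j -> nrm (e j) = 1.
Implicit Types (A B : 'B('K(H))) (z : 'K(H)).

Let q := p i0.

Lemma proj_sum : \sum_(j < N.+1) p j = bop_id.
Proof.
apply: bopP => x; rewrite bop_sumE big_ord_recl /=.
have h : psum (Some N) p n x @[n --> \oo] --> \sum_(i < N) p i.+1 x.
  apply: (@cvg_eventually _ _ _ _ N) => n Nn.
  rewrite /psum bop_sumE (big_cat_nat _ (n := N.+1))//= [X in _ + X]big_nat_cond.
  rewrite [X in _ + X]big1 ?addr0; last first.
    by move=> i /andP[/andP[Ni _] /= iN]; move: (leq_trans Ni iN); rewrite ltnn.
  rewrite big_add1 /= big_mkord; apply: eq_bigl => i; exact: ltn_ord.
have := cvg_uniq h (@psum_cvg _ _ _ _ _ p_family x).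
by move=> ->; rewrite addrC subrK.
Qed.

(* For [A = lcomm z], the operator [column j A] is [z p_j - p_j z]; the case
   [j = 0] follows from [p_0 + ... + p_N = 1]. *)
Definition column j A : 'B(H) := if j is 0%N
  then - \sum_(1 <= i < N.+1 | idx (Some N) i) slice norm_dot A (e i)
  else slice norm_dot A (e j).

Lemma column_lin (r : R[i]) j A B :
  column j (r *: A + B) = r *: column j A + column j B.
Proof.
case: j => [|j]; last exact: slice_lin.
rewrite /column scalerN -opprD scaler_sumr -big_split /=; congr (- _).
by apply: eq_bigr => i _; exact: slice_lin.
Qed.

Lemma column_bound j A : idx (Some N) j \/ j = 0%N ->
  nrm (column j A) <= N.+1%:R * nrm A.
Proof.
have sl i : idx (Some N) i -> nrm (slice norm_dot A (e i)) <= nrm A.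
  by move=> ii; apply: nrm_slice; exact: e1.
case: j => [_|j [jN|//]].
  rewrite /column nrmN (le_trans (nrm_sum _ _ _))//.
  rewrite (le_trans (ler_sum _ sl))// big_mkcond /=.
  rewrite (le_trans (y := \sum_(1 <= i < N.+1) nrm A))//.
    by apply: ler_sum => i _; case: ifP => // _; exact: nrm_ge0.
  rewrite sumr_const_nat -[X in X <= _]mulr_natl ler_wpM2r ?nrm_ge0// ler_nat.
  by rewrite subn1 /=.
by rewrite (le_trans (sl _ jN))// ler_peMl ?nrm_ge0// ler1n.
Qed.

Lemma column_lcomm j (z : 'B(H)) : (j <= N)%N ->
  column j (lcomm P z) = z ∙ p j - p j ∙ z.
Proof.
have sl i : idx (Some N) i -> slice norm_dot (lcomm P z) (e i) = z ∙ p i - p i ∙ z.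
  by move=> ii; exact: (slice_lcomm norm_dot p_family P_pinching z ii (pe ii) (e1 ii)).
case: j => [_|j jN]; last exact: sl.
rewrite /column (eq_bigr _ sl) sumrB -comp_sumr -comp_suml.
have -> : \sum_(1 <= i < N.+1 | idx (Some N) i) p i = bop_id - p 0%N.
  rewrite -proj_sum big_ord_recl /= [p 0%N + _]addrC addrK big_add1 /= big_mkord.
  by apply: eq_bigl => i; rewrite /idx /= ltn_ord.
by rewrite compBr compBl comp1l comp1r subrACA subrr sub0r opprK.
Qed.

(* All the columns but the infinite rank one are kept. The blocks with both
   indices different from [i0] are halved, as they occur a second time in the
   adjoint; hence for a skew [z] the operator [dcol (lcomm z)] minus its
   adjoint is the off-diagonal part of [z]. *)
Definition dcol A : 'B(H) := \sum_(j < N.+1 | (j : nat) != i0)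
  ((2^-1 : R)%:C *: ((bop_id + q) ∙ (bop_id - p j) ∙ column j A)) ∙ p j.

Lemma dcol_lin (r : R[i]) A B : dcol (r *: A + B) = r *: dcol A + dcol B.
Proof.
rewrite /dcol scaler_sumr -big_split /=; apply: eq_bigr => j _.
rewrite column_lin; move: ((bop_id + q) ∙ (bop_id - p j)) => t.
by rewrite compDr compZr scalerDr compDl scalerA mulrC -scalerA compZl.
Qed.

Lemma dcol_bound : exists K : R, forall A, nrm (dcol A) <= K * nrm A.
Proof.
exists (\sum_(j < N.+1 | (j : nat) != i0)
  (2^-1 * nrm ((bop_id + q) ∙ (bop_id - p j)) * N.+1%:R * nrm (p j))) => A.
rewrite (le_trans (nrm_sum _ _ _))// mulr_suml; apply: ler_sum => j _.
rewrite (le_trans (nrm_comp _ _))// mulrAC ler_wpM2r ?nrm_ge0//.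
rewrite nrmZr ger0_norm ?invr_ge0// -!mulrA ler_wpM2l ?invr_ge0//.
rewrite (le_trans (nrm_comp _ _))// ler_wpM2l ?nrm_ge0//.
apply: column_bound; case: j => -[|j] jN; [by right|by left].
Qed.

(** Each summand ends with a [p j] of finite rank, so compactness holds for every [A] and not only
    for [A = lcomm P z]. This is where the ranks of the projections enter. *)
Lemma dcol_compact_adj A : compact_adj dot (dcol A).
Proof.
have jN (j : 'I_N.+1) : (j <= N)%N by rewrite -ltnS.
apply: compact_adj_sum => j ji; apply: (fin_rank norm_dot); last exact: (fin (jN j)).
exact: (family_adj norm_dot p_family (jN j)).
Qed.

Lemma dcol_adj A : is_adjoint dot (dcol A) (adjoint dot (dcol A)).
Proof. by apply: has_adjP; have [_ [b ab _]] := dcol_compact_adj A; exists b. Qed.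

Lemma skewpart_compact A : dcol A - adjoint dot (dcol A) \in compact_op.
Proof.
have [ac [b ab bc]] := dcol_compact_adj A.
by apply: rpredB => //; rewrite (adjointE ab).
Qed.

Definition skewpart A : 'K(H) := CompactOp (skewpart_compact A).

Lemma skewpart_skew A : is_adjoint dot (skewpart A) (- (skewpart A : 'B(H))).
Proof.
by rewrite /= opprB; apply: adjB; [exact: dcol_adj|apply: adj_sym; exact: dcol_adj].
Qed.

Lemma skewpart_lin (r : R) A B :
  skewpart (r%:C *: A + B) = r%:C *: (skewpart A : 'B(H)) + skewpart B :> 'B(H).
Proof.
rewrite /= dcol_lin adjoint_lin; last first.
- by exists (adjoint dot (dcol B)); exact: dcol_adj.
- by exists (adjoint dot (dcol A)); exact: dcol_adj.
by rewrite scalerBr opprD addrACA.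
Qed.

Lemma skewpart_bound : exists K : R, forall A, nrm (skewpart A : 'B(H)) <= K * nrm A.
Proof.
have [K KP] := dcol_bound; exists (2 * K) => A.
rewrite /= (le_trans (nrmB _ _))// -mulrA mulr_natl mulr2n.
by rewrite lerD// (le_trans (nrm_adj norm_dot (adj_sym (dcol_adj A)))).
Qed.

(** The weight of row [l] in [dcol]: half of [1 + q] acts as 1 on the range of [q] and as one half
    on the other ranges. *)
Let cf l : R := if l == i0 then 1 else 2^-1.

Lemma dcol_block (z : 'B(H)) l m : (l <= N)%N -> (m <= N)%N -> l != m ->
  p l ∙ dcol (lcomm P z) ∙ p m =
  (if m == i0 then 0 else (cf l)%:C) *: (p l ∙ z ∙ p m).
Proof.
move=> lN mN lm; rewrite /dcol comp_sumr comp_suml.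
have pp i j : (i <= N)%N -> (j <= N)%N -> i != j -> p i ∙ p j = 0.
  exact: (family_ortho norm_dot p_family).
have pi i : (i <= N)%N -> p i ∙ p i = p i.
  exact: (family_idem p_family).
have [mi0|mi0] := eqVneq m i0.
  rewrite scale0r big1// => j ji.
  rewrite -!compA pp ?comp0r//; first by rewrite /= -ltnS.
  by rewrite mi0.
rewrite (bigD1 (Ordinal (mN : (m < N.+1)%N)))//= big1 ?addr0; last first.
  move=> j /andP[ji jm]; rewrite -!compA pp ?comp0r//; by rewrite /= -ltnS.
rewrite column_lcomm// compZl compZr compZl.
have -> :
    p l ∙ ((bop_id + q) ∙ (bop_id - p m) ∙ (z ∙ p m - p m ∙ z) ∙ p m) ∙ p m =
    p l ∙ (bop_id + q) ∙ (bop_id - p m) ∙ z ∙ p m.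
  have pmm : (bop_id - p m) ∙ p m = 0 by rewrite compBl comp1l pi ?subrr.
  rewrite compBr -(compA _ (bop_id - p m) (p m ∙ z)) (compA _ (p m)).
  rewrite pmm comp0l comp0r subr0.
  by rewrite -!compA pi// pi.
have -> : p l ∙ (bop_id + q) ∙ (bop_id - p m) = p l ∙ (bop_id + q).
  have plm : p l ∙ p m = 0 by exact: pp.
  have qm : q ∙ p m = 0 by apply: pp => //; rewrite eq_sym.
  by rewrite compBr comp1r -compA compDl comp1l qm addr0 plm subr0.
rewrite /cf; case: eqVneq => [li|li].
  by rewrite compDr comp1r /q li pi// !compDl scalerDr -scalerDl -rmorphD /= half_half.
by rewrite compDr comp1r /q pp// addr0.
Qed.

(** The block comes once from [dcol] and once from its adjoint. The weights are 1 and 0 if one of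
    the indices is [i0], and twice one half otherwise. *)
Lemma skewpart_block z l m : is_adjoint dot z (- (z : 'B(H))) ->
  (l <= N)%N -> (m <= N)%N -> l != m ->
  p l ∙ skewpart (lcomm P z) ∙ p m = p l ∙ z ∙ p m.
Proof.
move=> zs lN mN lm; rewrite /= bop_sandwich dcol_block//.
have pa i : (i <= N)%N -> is_adjoint dot (p i) (p i).
  exact: (family_adj norm_dot p_family).
have h1 : is_adjoint dot (p m ∙ dcol (lcomm P z) ∙ p l)
    (p l ∙ adjoint dot (dcol (lcomm P z)) ∙ p m).
  rewrite -[X in is_adjoint _ _ X]compA; apply: adj_comp; last exact: pa.
  by apply: adj_comp; [exact: pa|exact: dcol_adj].
have h2 : is_adjoint dot (p m ∙ dcol (lcomm P z) ∙ p l)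
    (- ((if l == i0 then 0 else (cf m)%:C) *: (p l ∙ z ∙ p m))).
  rewrite dcol_block// 1?eq_sym//.
  have zz : is_adjoint dot (p m ∙ z ∙ p l) (- (p l ∙ z ∙ p m)).
    have -> : - (p l ∙ z ∙ p m) = p l ∙ (- (z : 'B(H)) ∙ p m).
      by rewrite compNl compNr compA.
    by apply: adj_comp; [apply: adj_comp => //|]; exact: pa.
  case: ifP => _; last by rewrite -scalerN; exact: adjZr.
  by rewrite !scale0r oppr0; exact: adj0.
rewrite (adj_uniq h1 h2) opprK -scalerDl -[RHS]scale1r; congr (_ *: _).
rewrite /cf; move: lm; case: (eqVneq m i0) => [->|mi] lm.
  by rewrite (negPf lm) add0r.
by case: (eqVneq l i0) => _; rewrite ?addr0// -rmorphD /= half_half.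
Qed.

(** The two operators have the same off-diagonal blocks, so their difference commutes with all the
    projections and is killed by [lcomm]. *)
Lemma skewpart_id z : is_adjoint dot z (- (z : 'B(H))) ->
  lcomm P (skewpart (lcomm P z)) = lcomm P z.
Proof.
move=> zs; apply/eqP; rewrite -subr_eq0 -lcommB; apply/eqP.
apply: (lcomm_commute P_pinching) => i /andP[_ /= iN].
set y := _ - _.
have yb l m : (l <= N)%N -> (m <= N)%N -> l != m -> p l ∙ y ∙ p m = 0.
  by move=> lN mN lm; rewrite bop_sandwich skewpart_block// subrr.
transitivity (p i ∙ y ∙ p i).
  rewrite -[LHS]comp1l -proj_sum comp_suml (bigD1 (Ordinal (iN : (i < N.+1)%N)))//=.
  rewrite big1 ?addr0 ?compA// => j ji; rewrite compA yb//; by rewrite -ltnS.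
rewrite -[RHS]comp1r -proj_sum comp_sumr (bigD1 (Ordinal (iN : (i < N.+1)%N)))//=.
rewrite big1 ?addr0// => j ji; rewrite yb//; first by rewrite -ltnS.
by rewrite eq_sym.
Qed.

Lemma tangent_complemented : complemented (unitary_orbit_tangent dot P).
Proof.
have [K KP] := skewpart_bound.
pose F A := lcomm P (skewpart A).
have Flin (r : R) A B : F (r%:C *: A + B) = r%:C *: F A + F B.
  by rewrite /F skewpart_lin lcommP.
apply: (@complemented_proj _ _ F (2 * nrm P * K)).
- exact: (tangent_closed norm_dot p_family P_pinching).
- by move=> A B; have := Flin 1 A B; rewrite !scale1r.
- move=> r A; have F0 : F 0 = 0.
    have := Flin 1 0 0; rewrite scaler0 addr0 scale1r => h.
    by apply: (addrI (F 0)); rewrite addr0; exact: esym h.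
  by rewrite -[r%:C *: A]addr0 Flin F0 addr0.
- move=> A; apply: le_trans (nrm_lcomm P _) _.
  by rewrite -[leRHS]mulrA ler_wpM2l ?mulr_ge0 ?nrm_ge0.
- by move=> A; apply/tangentP; exists (skewpart A) => //; exact: skewpart_skew.
- by move=> _ /tangentP[z zs ->]; exact: skewpart_id.
Qed.

End Complement.

Lemma addr_shift (V : zmodType) (u v a b z : V) :
  u + v + z = u + a + (v + b) + (z - (a + b)).
Proof.
apply/esym; rewrite (addrACA u) -(addrA (u + v) (a + b)) (addrC (a + b)).
by rewrite subrK.
Qed.

(** * Complements are boundedly complemented *)

Section OpenMapping.
Context {R : realType} {V : normedModType R[i]}.
Hypothesis cV : seq_complete V.

Lemma closed_seq (A : set V) (u : nat -> V) l : closed A ->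
  (forall n, A (u n)) -> u n @[n --> \oo] --> l -> A l.
Proof.
move=> cA Au /cvg_nrmP ul; apply/(closed_nrmP A).1 => // e /ul[N Nu].
by exists (u N) => //; exact: Nu.
Qed.

(* The library proves Baire's theorem for normed modules over a [realType]
   only, whereas here the scalars are complex. *)
Lemma baire_cover (F : nat -> set V) : (forall n, closed (F n)) ->
  (forall x, exists n, F n x) ->
  exists n x, exists2 r : R, 0 < r & forall y, nrm (y - x) < r -> F n y.
Proof.
move=> cF allF; apply: contrapT => noF.
(* Pairs are closed balls: [c] lies in [b], has at most half its radius and misses [F n]. The
   centres then converge to a point in no [F n]. *)
pose ok (n : nat) (b c : V * R) := [/\ 0 < c.2, c.2 <= b.2 / 2,
  nrm (c.1 - b.1) + c.2 <= b.2 & forall z, nrm (z - c.1) <= c.2 -> ~ F n z].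
have step (z : nat * (V * R)) : exists c, 0 < z.2.2 -> ok z.1 z.2 c.
  case: z => n [x r] /=; have [r0|r0] := leP r 0.
    by exists (x, r).
  have [y [yx nFy]] : exists y, nrm (y - x) < r / 2 /\ ~ F n y.
    apply: contrapT => nyx; apply: noF; exists n, x, (r / 2).
      by rewrite divr_gt0.
    by move=> y yx; apply: contrapT => nFy; apply: nyx; exists y.
  have [e [e0 eF]] : exists e : R, 0 < e /\ forall z, F n z -> e <= nrm (z - y).
    apply: contrapT => ne; apply: nFy; apply/(closed_nrmP (F n)).1; first exact: cF.
    move=> e e0; apply: contrapT => nz; apply: ne; exists e; split => // z Fz.
    by rewrite leNgt; apply/negP => zy; apply: nz; exists z.
  exists (y, Num.min (e / 2) (r / 2)) => _; split => /=.
  - by rewrite lt_min !divr_gt0.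
  - by rewrite ge_min lexx orbT.
  - have : Num.min (e / 2) (r / 2) <= r / 2 by rewrite ge_min lexx orbT.
    by move: (Num.min _ _) => m; lra.
  - move=> z zy Fz; have := eF z Fz.
    have : Num.min (e / 2) (r / 2) <= e / 2 by rewrite ge_min lexx.
    by move: (Num.min _ _) zy => m; lra.
have [f fP] := choice step.
pose b := fix b n := if n is m.+1 then f (m, b m) else ((0 : V), (1 : R)).
have b0 n : 0 < (b n).2.
  by elim: n => [|n IH] /=; [exact: ltr01|have [] := fP (n, b n) IH].
have bok n : ok n (b n) (b n.+1) by exact: (fP (n, b n) (b0 n)).
have b2 n : (b n).2 <= 2^-1 ^+ n.
  elim: n => [|n IH]; first by rewrite expr0.
  by have [_ h _ _] := bok n; rewrite exprS; lra.
have bd n m : nrm ((b (n + m)%N).1 - (b n).1) <= (b n).2.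
  suff : nrm ((b (n + m)%N).1 - (b n).1) + (b (n + m)%N).2 <= (b n).2.
    by have := b0 (n + m)%N; lra.
  elim: m => [|m IH]; first by rewrite addn0 subrr nrm0 add0r.
  rewrite addnS; have [_ _ h _] := bok (n + m)%N.
  by have := nrm_tri (b (n + m)%N).1 (b (n + m).+1).1 (b n).1; lra.
have [|l bl _] := geometric_limit (u := fun n => (b n).1) (c := 1) cV.
  move=> n; rewrite mul1r (le_trans _ (b2 n))//.
  by have := bd n 1%N; rewrite addn1.
have [n Fn] := allF l; have [_ _ _ /(_ l)] := bok n; apply => //.
have h : (b (n.+1 + m)%N).1 - (b n.+1).1 @[m --> \oo] --> l - (b n.+1).1.
  apply: cvgB; last exact: cvg_cst.
  apply/cvg_nrmP => e /(proj1 (cvg_nrmP _ _) bl)[N Nb]; exists N => m Nm.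
  by apply: Nb; rewrite (leq_trans Nm)// leq_addl.
exact: (nrm_lim_le (bd n.+1) h).
Qed.

(** The open mapping argument for the sum map on [S] and [T]. By Baire, decompositions with parts
    bounded by some [n] are dense in a ball; by scaling, every [y] is decomposed with bounded parts
    up to an error [nrm y / 2]. Iterating on the errors gives an exact decomposition, and [S] and
    [T] meet only in 0. *)
Lemma complement_bound (S T : set V) : closed_subspace S -> closed_subspace T ->
  S `&` T = [set 0] -> (forall x, exists s t, [/\ S s, T t & x = s + t]) ->
  exists2 M : R, 0 <= M & forall s t, S s -> T t -> nrm t <= M * nrm (s + t).
Proof.
move=> [[S0 SD SZ] cS] [[T0 TD TZ] cT] ST all.
have SN s : S s -> S (- s) by move=> /(SZ (-1)); rewrite rmorphN scaleN1r.
have TN s : T s -> T (- s) by move=> /(TZ (-1)); rewrite rmorphN scaleN1r.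
pose C (n : nat) x := exists s t,
  [/\ S s, T t, x = s + t, nrm s <= n%:R & nrm t <= n%:R].
pose F n := [set x | forall e : R, 0 < e -> exists2 y, C n y & nrm (y - x) < e].
have cF n : closed (F n).
  apply/closed_nrmP => x xF e e0.
  have [|y yF yx] := xF (e / 2); first by rewrite divr_gt0.
  have [|z Cz zy] := yF (e / 2); first by rewrite divr_gt0.
  by exists z => //; have := nrm_tri y z x; lra.
have [|n [x0 [r r0 x0F]]] := baire_cover cF.
  move=> x; have [s [t [Ss Tt ->]]] := all x.
  pose n := maxn (Num.bound (nrm s)) (Num.bound (nrm t)).
  exists n => e e0; exists (s + t); last by rewrite subrr nrm0.
  exists s, t; split => //.
    by rewrite (le_trans (ltW (archi_boundP (nrm_ge0 s))))// ler_nat leq_maxl.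
  by rewrite (le_trans (ltW (archi_boundP (nrm_ge0 t))))// ler_nat leq_maxr.
(* [y] is scaled to norm [r / 2], and [x0] as well as its translate by the scaled [y] are
   approximated up to [r / 8]. The difference has an error of at most [r / 4], half of that norm,
   and parts of norm at most [2 * n]; scaling back by [2 * nrm y / r] gives [K]. *)
pose K : R := 4 * n%:R / r.
have K0 : 0 <= K by rewrite divr_ge0 ?mulr_ge0// ltW.
have approx y : exists st : V * V, [/\ S st.1, T st.2, nrm st.1 <= K * nrm y,
    nrm st.2 <= K * nrm y & nrm (y - (st.1 + st.2)) <= nrm y / 2].
  have [->|/eqP/nrm_gt0 yp] := eqVneq y 0.
    by exists (0, 0); rewrite /= addr0 subrr nrm0 !mulr0 mul0r.
  pose c := r / (2 * nrm y); have c0 : 0 < c by rewrite divr_gt0 ?mulr_gt0.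
  have cy : nrm (c%:C *: y) = r / 2.
    by rewrite nrmZr gtr0_norm// /c; field; exact: lt0r_neq0.
  have r8 : 0 < r / 8 by rewrite divr_gt0.
  have [|_ [s [t [Ss Tt -> sn tn]]] ax] := x0F (x0 + c%:C *: y) _ _ r8.
    by rewrite addrC addKr cy; lra.
  have [|_ [s' [t' [Ss' Tt' -> sn' tn']]] bx] := x0F x0 _ _ r8.
    by rewrite subrr nrm0.
  have V0 : 0 < c^-1 by rewrite invr_gt0.
  have Kc : K * nrm y = c^-1 * (n%:R + n%:R).
    by rewrite /K /c; field; rewrite !lt0r_neq0.
  exists (c^-1%:C *: (s - s'), c^-1%:C *: (t - t')); split => /=.
  - by apply: SZ; apply: SD => //; exact: SN.
  - by apply: TZ; apply: TD => //; exact: TN.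
  - rewrite nrmZr gtr0_norm// Kc ler_pM2l//.
    by rewrite (le_trans (nrmB _ _))// lerD.
  - rewrite nrmZr gtr0_norm// Kc ler_pM2l//.
    by rewrite (le_trans (nrmB _ _))// lerD.
  have -> : y - (c^-1%:C *: (s - s') + c^-1%:C *: (t - t')) =
      c^-1%:C *: ((s' + t' - x0) - (s + t - (x0 + c%:C *: y))).
    rewrite -scalerDr addrACA -opprD -[in LHS](scale1r y).
    have -> : 1 = c^-1%:C * c%:C :> R[i] by rewrite -rmorphM mulVf ?lt0r_neq0.
    rewrite -scalerA -scalerBr; congr (_ *: _).
    by rewrite !opprB !addrA subrK; congr (_ - _); rewrite -addrA addrC.
  rewrite nrmZr gtr0_norm//.
  have -> : nrm y / 2 = c^-1 * (r / 8 + r / 8).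
    by rewrite /c; field; rewrite !lt0r_neq0.
  by rewrite ler_pM2l// (le_trans (nrmB _ _))// lerD// ltW.
have [g gP] := choice approx.
exists (2 * K); first by rewrite mulr_ge0.
move=> s t Ss Tt; set y := s + t.
pose z := fix z k := if k is j.+1 then z j - ((g (z j)).1 + (g (z j)).2) else y.
have zk k : nrm (z k) <= nrm y * 2^-1 ^+ k.
  elim: k => [|k IH] /=; first by rewrite expr0 mulr1.
  by have [_ _ _ _] := gP (z k); rewrite exprS; lra.
pose U k := \sum_(j < k) (g (z j)).1; pose W k := \sum_(j < k) (g (z j)).2.
have yE k : y = U k + W k + z k.
  elim: k => [|k IH]; first by rewrite /U /W !big_ord0 !add0r.
  by rewrite {1}IH /U /W !big_ord_recr; exact: addr_shift.
have gb j : nrm (g (z j)).1 <= K * nrm y * 2^-1 ^+ j /\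
    nrm (g (z j)).2 <= K * nrm y * 2^-1 ^+ j.
  have [_ _ h1 h2 _] := gP (z j).
  by split; [apply: le_trans h1 _|apply: le_trans h2 _]; rewrite -mulrA ler_wpM2l.
have [|u Uu _] := geometric_limit (u := U) (c := K * nrm y) cV.
  by move=> k; rewrite /U big_ord_recr /= addrAC subrr add0r; have [] := gb k.
have [|v Wv vb] := geometric_limit (u := W) (c := K * nrm y) cV.
  by move=> k; rewrite /W big_ord_recr /= addrAC subrr add0r; have [] := gb k.
have Su : S u.
  apply: (closed_seq cS _ Uu) => k.
  by apply: (big_ind S) => // j _; have [] := gP (z j).
have Tv : T v.
  apply: (closed_seq cT _ Wv) => k.
  by apply: (big_ind T) => // j _; have [] := gP (z j).
have yuv : y = u + v.
  apply: (@cvg_uniq _ _ (fun k => U k + W k)); last exact: cvgD.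
  apply/cvg_nrmP => e e0; have [N Ne] := half_exp_small (nrm y) e0.
  exists N => k Nk; rewrite nrmC {1}(yE k) addrAC subrr add0r (le_lt_trans (zk k))//.
  rewrite (le_lt_trans _ Ne)// ler_wpM2l ?nrm_ge0// ler_wiXn2l ?invr_ge0//.
  by rewrite invf_le1 ?ler1n.
have tv : t = v.
  have : (S `&` T) (s - u).
    split; first by apply: SD => //; exact: SN.
    have -> : s - u = v - t.
      by apply/eqP; rewrite subr_eq addrAC eq_sym subr_eq eq_sym addrC -yuv.
    by apply: TD => //; exact: TN.
  rewrite ST /= => /eqP; rewrite subr_eq0 => /eqP su.
  by move: yuv; rewrite /y su => /addrI.
by rewrite tv; move: vb; rewrite /W big_ord0 subr0 mulrA.
Qed.

End OpenMapping.

(** * Null sequences in bounded sequences *)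

Section Phillips.
Context {R : realType}.

(* Branches of the binary tree form an uncountable almost disjoint family of
   infinite sets of natural numbers. *)
Definition branch (x : nat -> bool) (k : nat) : bool :=
  `[< exists m, k = pickle (mkseq x m) >].

Lemma pickle_mkseq_inj (x : nat -> bool) : injective (fun m => pickle (mkseq x m)).
Proof.
move=> m n /(pcan_inj pickleK)/(congr1 size).
by rewrite !size_mkseq.
Qed.

Lemma injective_unbounded (f : nat -> nat) K : injective f -> exists m, (K <= f m)%N.
Proof.
move=> fi; apply: contrapT => nf.
have fK m : (f m < K)%N by rewrite ltnNge; apply/negP => Km; apply: nf; exists m.
pose g (i : 'I_K.+1) : 'I_K := Ordinal (fK i).
have gi : injective g by move=> i j [/fi ij]; exact: val_inj.
by have := leq_card g gi; rewrite !card_ord ltnn.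
Qed.

Lemma branch_infinite x K : exists k, (K <= k)%N /\ branch x k.
Proof.
have [m Km] := injective_unbounded K (@pickle_mkseq_inj x).
by exists (pickle (mkseq x m)); split => //; apply/asboolP; exists m.
Qed.

(** A common element encodes a common prefix, whose length is at most an index [j] where [x] and [y]
    differ; there are finitely many of these. *)
Lemma branch_disjoint x y : x <> y ->
  exists K, forall k, (K <= k)%N -> branch x k -> ~~ branch y k.
Proof.
move=> xy; have [j xj] : exists j, x j != y j.
  apply: contrapT => nj; apply: xy; apply/funext => j; apply/eqP.
  by apply: contrapT => /negP nxj; apply: nj; exists j.
exists (\max_(m < j.+1) pickle (mkseq x m)).+1 => k Kk /asboolP[m km].
apply/negP => /asboolP[n kn]; move: (kn); rewrite km.
move/(pcan_inj pickleK) => mn.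
have mnE : m = n by have := congr1 size mn; rewrite !size_mkseq.
have mj : (m < j.+1)%N.
  rewrite ltnNge; apply/negP => jm; move/negP: xj; apply; apply/eqP.
  have := congr1 (fun s => nth false s j) mn.
  by rewrite !nth_mkseq// -?mnE.
have := leq_bigmax (F := fun m : 'I_j.+1 => pickle (mkseq x m)) (Ordinal mj).
by rewrite /= -km leqNgt Kk.
Qed.

Definition vanishes_eventually (a : nat -> R) :=
  exists K, forall k, (K <= k)%N -> a k = 0.
Definition bounded_seq (a : nat -> R) := exists M : R, forall k, `|a k| <= M.

(** These will be the coordinates of a projection onto a hypothetical complement of the tangent
    space, evaluated at copies of bounded sequences; sequences vanishing eventually give tangent
    vectors, which it kills. *)
Variables (phi : nat -> (nat -> R) -> R) (C : R).
Hypothesis phi_lin : forall n (r : R) a b, bounded_seq a -> bounded_seq b ->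
  phi n (fun k => r * a k + b k) = r * phi n a + phi n b.
Hypothesis phi_fin : forall n a, vanishes_eventually a -> phi n a = 0.
Hypothesis phi_bound : forall n a, (forall k, `|a k| <= 1) -> `|phi n a| <= C.

Let ind x : nat -> R := fun k => (branch x k)%:R.

Let ind_bounded x : bounded_seq (ind x).
Proof. by exists 1 => k; rewrite /ind normr_nat lern1 leq_b1. Qed.

(** The signs make [phi n] of this sum equal to the sum of the absolute values of the
    [phi n (ind x)]. *)
Let comb n (s : seq (nat -> bool)) : nat -> R :=
  foldr (fun x a => fun k => Num.sg (phi n (ind x)) * ind x k + a k) (fun=> 0) s.

Let comb_bounded n s : bounded_seq (comb n s).
Proof.
elim: s => [|x s [M aM]] /=; first by exists 0 => k; rewrite normr0.
exists (1 + M) => k; rewrite (le_trans (ler_normD _ _))// lerD//.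
rewrite normrM; have h1 : `|ind x k| <= 1 by rewrite /ind normr_nat lern1 leq_b1.
rewrite -[leRHS]mulr1 ler_pM//.
by rewrite normr_sg; case: (_ != 0).
Qed.

Let phi_comb n s : phi n (comb n s) = \sum_(x <- s) `|phi n (ind x)|.
Proof.
elim: s => [|x s IH] /=.
  by rewrite big_nil phi_fin//; exists 0%N.
by rewrite big_cons phi_lin//= IH -normrEsg.
Qed.

(** Far enough out, the branches in [s] are pairwise disjoint and at most one term is nonzero. The
    claim on the support carries the induction. *)
Let comb_tail n (s : seq (nat -> bool)) : uniq s -> exists K, forall k, (K <= k)%N ->
  `|comb n s k| <= 1 /\ (comb n s k <> 0 -> exists2 x, x \in s & branch x k).
Proof.
elim: s => [_|x s IH] /=; first by exists 0%N => k _; rewrite normr0; split.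
move=> /andP[xs /IH[K KP]].
have [K' K'P] : exists K', forall k, (K' <= k)%N -> branch x k ->
    forall y, y \in s -> ~~ branch y k.
  elim: s xs {IH KP} => [|y s IH]; first by exists 0%N.
  rewrite in_cons negb_or => /andP[/eqP xy /IH[K1 K1P]].
  have [K2 K2P] := branch_disjoint xy.
  exists (maxn K1 K2) => k; rewrite geq_max => /andP[k1 k2] xk z.
  by rewrite in_cons => /orP[/eqP ->|/K1P]; [exact: K2P|exact].
exists (maxn K K') => k; rewrite geq_max => /andP[k1 k2].
have [c1 c2] := KP k k1; case: (boolP (branch x k)) => xk; last first.
  rewrite /ind (negPf xk) mulr0 add0r; split => // /c2[y ys yk].
  by exists y => //; rewrite in_cons ys orbT.
have c0 : comb n s k = 0.
  by apply: contrapT => /c2[y ys yk]; have := K'P k k2 xk y ys; rewrite yk.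
rewrite c0 addr0 /ind xk mulr1 normr_sg; split; first by case: (_ != 0).
by move=> _; exists x => //; rewrite in_cons eqxx.
Qed.

(** Cut the signed sum at [K]: [phi n] kills the head, and the tail is bounded by 1. *)
Let sum_bound n s : uniq s -> \sum_(x <- s) `|phi n (ind x)| <= C.
Proof.
move=> us; rewrite -phi_comb; have [K KP] := comb_tail n us.
pose hd k := if (k < K)%N then comb n s k else 0.
pose tl k := if (k < K)%N then 0 else comb n s k.
have tl1 k : `|tl k| <= 1.
  by rewrite /tl; case: ltnP => [_|/KP[]//]; rewrite normr0.
have -> : comb n s = (fun k => 1 * hd k + tl k).
  by apply/funext => k; rewrite /hd /tl; case: ltnP => _; rewrite mul1r ?addr0 ?add0r.
have [M aM] := comb_bounded n s; have M0 : 0 <= M by exact: le_trans (aM 0%N).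
rewrite phi_lin; last by exists 1.
  rewrite phi_fin ?mulr0 ?add0r; last first.
    by exists K => k Kk; rewrite /hd ltnNge Kk.
  exact: le_trans (ler_norm _) (phi_bound _ tl1).
by exists M => k; rewrite /hd; case: ifP => _; rewrite ?normr0.
Qed.

(* Modulo sequences vanishing eventually, a signed sum of distinct branches is
   bounded by 1. Hence for each [n] and [k] at most [C * k] branches satisfy
   [`|phi n x| * k >= 1], and a diagonal argument avoids all of them. *)
Lemma phillips : exists x, forall n, phi n (fun k => (branch x k)%:R) = 0.
Proof.
apply: contrapT => nx.
pose G (z : nat * nat) (x : nat -> bool) := `|phi z.1 (ind x)| * z.2%:R >= 1.
have GT x : exists z, G z x.
  have [n pn] : exists n, phi n (ind x) != 0.
    apply: contrapT => nn; apply: nx; exists x => n; apply/eqP.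
    by apply: contrapT => /negP pn; apply: nn; exists n.
  have p0 : 0 < `|phi n (ind x)| by rewrite normr_gt0.
  exists (n, Num.bound `|phi n (ind x)|^-1) => /=; rewrite /G /= mulrC -ler_pdivrMr//.
  by rewrite div1r ltW// archi_boundP// invr_ge0.
have C0 : 0 <= C.
  by rewrite (le_trans _ (phi_bound 0%N (a := fun=> 0) _))// => k; rewrite normr0.
have L z : exists s : seq (nat -> bool), forall x, G z x -> x \in s.
  pose Q m := `[< exists s : seq (nat -> bool), [/\ uniq s,
    (forall x, x \in s -> G z x) & size s = m] >].
  have Q0 : exists m, Q m by exists 0%N; apply/asboolP; exists [::].
  have QB m : Q m -> (m <= Num.bound (C * z.2%:R))%N.
    move=> /asboolP[s [us sG <-]]; rewrite -(ler_nat R).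
    rewrite (le_trans _ (ltW (archi_boundP _))) ?mulr_ge0//.
    rewrite (le_trans _ (ler_wpM2r _ (sum_bound z.1 us)))//.
    rewrite mulr_suml -sum1_size natr_sum big_seq [leRHS]big_seq.
    by apply: ler_sum => x /sG.
  have [m /asboolP[s [us sG sm]] mmax] := ex_maxnP Q0 QB.
  exists s => x xG; apply: contrapT => /negP xs.
  suff /mmax : Q m.+1 by rewrite ltnn.
  apply/asboolP; exists (x :: s); split; rewrite /= ?xs ?sm//.
  by move=> y; rewrite in_cons => /orP[/eqP ->|/sG].
have [l lP] := choice L.
(* [d] differs from the [i]-th member of [l z] at position [pickle (z, i)], so it is in none of the
   lists; but [GT d] puts it in one. *)
pose d k : bool := if unpickle k is Some (z, i) then
  ~~ nth (fun=> false) (l z) i k else false.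
have [z dz] := GT d; have dl := lP z d dz.
have := nth_index (fun=> false) dl.
move=> /(congr1 (fun f => f (pickle (z, index d (l z))))).
by rewrite [RHS]/d pickleK; case: (nth _ _ _ _).
Qed.

End Phillips.

(** * Diagonal operators between orthonormal sequences *)

Section Orthonormal.
Context {R : realType} {H : completeNormedModType R[i]}.
Variable dot : {dot H for Num.conj}.
Hypothesis norm_dot : forall x : H, `|x| ^+ 2 = dot x x.
Implicit Types (x y : H) (e f g : nat -> H) (a b : nat -> R).

Definition orthonormal_seq e := forall i j, dot (e i) (e j) = (i == j)%:R.

Lemma orthonormal_nrm e i : orthonormal_seq e -> nrm (e i) = 1.
Proof.
move=> oe; have := dot_nrm norm_dot (e i); rewrite oe eqxx.
move=> /(congr1 (@complex.Re R)) /= h.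
by apply/eqP; rewrite -(@eqrXn2 _ 2)// ?nrm_ge0// -h expr1n.
Qed.

Lemma orthonormal_sum_sq e (c : nat -> R[i]) m n : orthonormal_seq e ->
  nrm (\sum_(m <= i < n) c i *: e i) ^+ 2 = \sum_(m <= i < n) cabs (c i) ^+ 2.
Proof.
move=> oe; elim: n => [|n IH]; first by rewrite !big_geq// nrm0 expr0n.
have [mn|nm] := leqP m n; last by rewrite !big_geq// nrm0 expr0n.
rewrite !big_nat_recr//= (pythagoras norm_dot).
  by rewrite IH nrmZ (orthonormal_nrm _ oe) mulr1.
rewrite dot_suml big_nat big1// => i /andP[_ ni].
by rewrite dotZl dotZr oe ltn_eqF// !mulr0.
Qed.

Lemma bessel e x n : orthonormal_seq e ->
  \sum_(0 <= i < n) cabs (dot x (e i)) ^+ 2 <= nrm x ^+ 2.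
Proof.
move=> oe; rewrite -(orthonormal_sum_sq (fun i => dot x (e i)) 0 n oe).
set y := \sum_(0 <= i < n) _.
have o : dot (x - y) y = 0.
  rewrite {2}/y dot_sumr big_nat big1// => i /andP[_ ni].
  rewrite dotZr dotBl {1}/y dot_suml (bigD1_seq i) ?iota_uniq ?mem_index_iota//=.
  rewrite dotZl oe eqxx mulr1 big1 ?addr0 ?subrr ?mulr0// => j ji.
  by rewrite dotZl oe (negPf ji) mulr0.
by rewrite -[in leRHS](subrK y x) (pythagoras norm_dot o) lerDr sqr_ge0.
Qed.

Lemma bessel_tail e x (d : R) : orthonormal_seq e -> 0 < d ->
  exists K, forall m n, (K <= m)%N -> \sum_(m <= i < n) cabs (dot x (e i)) ^+ 2 < d.
Proof.
move=> oe d0; pose S n := \sum_(0 <= i < n) cabs (dot x (e i)) ^+ 2.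
have Sm : nondecreasing_seq S.
  move=> m n mn; rewrite /S (big_cat_nat _ (m := 0%N) (n := m) (p := n))//= lerDl.
  by apply: sumr_ge0 => i _; exact: sqr_ge0.
have /cvg_ex[l /= Sl] : cvgn S.
  apply: nondecreasing_is_cvgn => //; exists (nrm x ^+ 2) => _ [n _ <-].
  exact: bessel.
have d2 : 0 < d / 2 by rewrite divr_gt0.
have /cvgrPdist_lt/(_ _ d2)[K _ KP] := Sl.
exists K => m n Km; have [mn|nm] := leqP m n; last by rewrite big_geq// ltnW.
have -> : \sum_(m <= i < n) cabs (dot x (e i)) ^+ 2 = S n - S m.
  by rewrite /S (big_cat_nat _ (m := 0%N) (n := m) (p := n))//= addrAC subrr add0r.
have := KP m Km; have := KP n (leq_trans Km mn); rewrite /=.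
have := ler_norm (l - S m); have := ler_norm (- (l - S n)); rewrite normrN.
lra.
Qed.

Lemma bessel_small e x (d : R) : orthonormal_seq e -> 0 < d ->
  exists K, forall n, (K <= n)%N -> cabs (dot x (e n)) < d.
Proof.
move=> oe d0; have [K KP] := bessel_tail x oe (exprn_gt0 2 d0).
exists K => n /(KP n n.+1); rewrite big_nat1 ltr_sqr// ?nnegrE ?cabs_ge0//.
exact: ltW.
Qed.

(** The vectors [z (f n)] stay within [d / 2] of a finite set, and the coefficient at [g n] of each
    vector of this set tends to 0 by Bessel's inequality. *)
Lemma compact_offdiag_small (z : 'K(H)) f g (d : R) : orthonormal_seq f ->
  orthonormal_seq g -> 0 < d ->
  exists K, forall n, (K <= n)%N -> cabs (dot (z (f n)) (g n)) < d.
Proof.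
move=> of_ og d0; have d2 : 0 < d / 2 by rewrite divr_gt0.
have [s sz] := compact_op_tb (cop_compact z) d2.
have [K KP] : exists K, forall n, (K <= n)%N -> forall y, y \in s ->
    cabs (dot y (g n)) < d / 2.
  elim: s {sz} => [|y s [K KP]]; first by exists 0%N.
  have [K' K'P] := bessel_small y og d2; exists (maxn K K') => n.
  rewrite geq_max => /andP[k k'] t; rewrite in_cons => /orP[/eqP ->|ts].
    exact: K'P.
  exact: KP.
exists K => n Kn; have [|y ys zy] := sz (z (f n)).
  by exists (f n) => //=; rewrite le1_nrm (orthonormal_nrm _ of_).
rewrite -(subrK y (z (f n))) dotDl (le_lt_trans (cabsD _ _))//.
have := cauchy_schwarz norm_dot (z (f n) - y) (g n).
rewrite (orthonormal_nrm _ og) mulr1; have := KP n Kn y ys; lra.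
Qed.

Definition dpart a e f n x : H :=
  \sum_(0 <= i < n) ((a i)%:C * dot x (e i)) *: f i.

Lemma dpart_sq a e f (M : R) m n x : orthonormal_seq f -> (forall i, `|a i| <= M) ->
  nrm (\sum_(m <= i < n) ((a i)%:C * dot x (e i)) *: f i) ^+ 2 <=
  M ^+ 2 * \sum_(m <= i < n) cabs (dot x (e i)) ^+ 2.
Proof.
move=> of_ aM; rewrite orthonormal_sum_sq// mulr_sumr; apply: ler_sum => i _.
rewrite cabsM cabs_real exprMn ler_wpM2r ?sqr_ge0//.
by rewrite ler_sqr ?nnegrE// (le_trans _ (aM i)).
Qed.

Definition is_diag_op a e f (W : 'B(H)) :=
  forall x, dpart a e f n x @[n --> \oo] --> W x.

(** Bessel's inequality controls the tails of the series at each [x]; the convergence is strong, in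
    general not in norm. *)
Lemma diag_op_ex a e f : orthonormal_seq e -> orthonormal_seq f -> bounded_seq a ->
  exists W, is_diag_op a e f W.
Proof.
move=> oe of_ [M aM]; have M0 : 0 <= M by exact: le_trans (aM 0%N).
have bd n x : nrm (dpart a e f n x) <= M * nrm x.
  rewrite -ler_sqr ?nnegrE ?mulr_ge0 ?nrm_ge0//.
  rewrite (le_trans (dpart_sq _ _ _ _ of_ aM))// exprMn ler_wpM2l ?sqr_ge0//.
  exact: bessel.
have lin n : linear (dpart a e f n).
  move=> k x y; rewrite /dpart scaler_sumr -big_split /=; apply: eq_bigr => i _.
  by rewrite dotDl dotZl mulrDr scalerDl scalerA mulrCA.
have cx x : exists l : H, dpart a e f n x @[n --> \oo] --> l.
  apply: complete_seq_complete => d d0.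
  have c0 : 0 < d ^+ 2 / (M ^+ 2 + 1).
    by rewrite divr_gt0 ?exprn_gt0// ltr_wpDl ?sqr_ge0.
  have [K KP] := bessel_tail x oe c0.
  have main m n : (K <= m)%N -> (m <= n)%N ->
      nrm (dpart a e f n x - dpart a e f m x) < d.
    move=> Km mn; rewrite -ltr_sqr ?nnegrE ?nrm_ge0 ?(ltW d0)//.
    have -> : dpart a e f n x - dpart a e f m x =
        \sum_(m <= i < n) ((a i)%:C * dot x (e i)) *: f i.
      rewrite /dpart (big_cat_nat _ (m := 0%N) (n := m) (p := n))//=.
      by rewrite addrAC subrr add0r.
    rewrite (le_lt_trans (dpart_sq _ _ _ _ of_ aM))//.
    have := KP m n Km; rewrite ltr_pdivlMr ?ltr_wpDl ?sqr_ge0// mulrC.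
    apply: le_lt_trans; rewrite ler_wpM2r ?lerDl//.
    by apply: sumr_ge0 => i _; exact: sqr_ge0.
  exists K => m n Km Kn; have [mn|/ltnW nm] := leqP m n; last exact: main.
  by rewrite nrmC; exact: main.
have [l lP] := choice cx.
have [W WE] : exists W : 'B(H), forall x, W x = l x.
  apply: (@bop_of_linear _ _ _ l M) => [k x y|x]; last first.
    by apply: nrm_lim_le (lP x) => n; exact: bd.
  apply: cvg_uniq (lP (k *: x + y)) _.
  have -> : (fun n => dpart a e f n (k *: x + y)) =
      (fun n => k *: dpart a e f n x + dpart a e f n y).
    by apply/funext => n; rewrite lin.
  by apply: cvgD; [apply: cvgZr|]; exact: lP.
by exists W => x; rewrite WE; exact: lP.
Qed.

(** For orthonormal [e], [f] and bounded [a] the default value is excluded by [diag_op_ex]. *)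
Definition diag_op a e f : 'B(H) := xget 0 [set W | is_diag_op a e f W].

Lemma diag_opP a e f : orthonormal_seq e -> orthonormal_seq f -> bounded_seq a ->
  is_diag_op a e f (diag_op a e f).
Proof.
move=> oe of_ ba; have [W WP] := diag_op_ex oe of_ ba.
by rewrite /diag_op; case: xgetP => // /(_ W).
Qed.

Lemma is_diag_op_uniq a e f W W' : is_diag_op a e f W -> is_diag_op a e f W' -> W = W'.
Proof. by move=> h h'; apply: bopP => x; exact: cvg_uniq (h x) (h' x). Qed.

Lemma diag_opE a e f W : is_diag_op a e f W -> diag_op a e f = W.
Proof.
move=> h; apply: is_diag_op_uniq (h).
by rewrite /diag_op; case: xgetP => // /(_ W).
Qed.

Variables (f g : nat -> H).
Hypothesis of_ : orthonormal_seq f.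
Hypothesis og : orthonormal_seq g.
Hypothesis fg : forall i j, dot (f i) (g j) = 0.

(* A copy of the bounded real sequences in the skew-adjoint bounded
   operators, in which vanishing sequences correspond to compact operators. *)
Definition rot a : 'B(H) := diag_op a f g - diag_op a g f.

Lemma rot_lin (r : R) a b : bounded_seq a -> bounded_seq b ->
  rot (fun k => r * a k + b k) = r%:C *: rot a + rot b.
Proof.
move=> ba bb; have lin e e' : orthonormal_seq e -> orthonormal_seq e' ->
    diag_op (fun k => r * a k + b k) e e' = r%:C *: diag_op a e e' + diag_op b e e'.
  move=> oe oe'; apply: diag_opE => x; rewrite bopDE bopZE.
  have -> : (fun n => dpart (fun k => r * a k + b k) e e' n x) =
      (fun n => r%:C *: dpart a e e' n x + dpart b e e' n x).
    apply/funext => n; rewrite /dpart scaler_sumr -big_split /=.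
    apply: eq_bigr => i _.
    by rewrite rmorphD rmorphM /= mulrDl scalerDl scalerA mulrA.
  by apply: cvgD; [apply: cvgZr|]; exact: diag_opP.
by rewrite /rot !lin// scalerBr opprD addrACA.
Qed.

Lemma nrm_rot a (M : R) : (forall i, `|a i| <= M) -> nrm (rot a) <= M + M.
Proof.
move=> aM; have M0 : 0 <= M by exact: le_trans (aM 0%N).
have ba : bounded_seq a by exists M.
have bd e e' : orthonormal_seq e -> orthonormal_seq e' -> nrm (diag_op a e e') <= M.
  move=> oe oe'; apply: nrm_bop_le => // x.
  apply: nrm_lim_le (diag_opP oe oe' ba (x := x)) => n.
  rewrite -ler_sqr ?nnegrE ?mulr_ge0 ?nrm_ge0//.
  rewrite (le_trans (dpart_sq _ _ _ _ oe' aM))// exprMn ler_wpM2l ?sqr_ge0//.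
  exact: bessel.
by rewrite (le_trans (nrmB _ _))// lerD// bd.
Qed.

Lemma rot_adj a : bounded_seq a -> is_adjoint dot (rot a) (- rot a).
Proof.
move=> ba; rewrite /rot opprB.
have ad e e' : orthonormal_seq e -> orthonormal_seq e' ->
    is_adjoint dot (diag_op a e e') (diag_op a e' e).
  move=> oe oe' x y.
  apply: (dot_lim norm_dot _ (diag_opP oe oe' ba (x := x))
    (diag_opP oe' oe ba (x := y))) => n.
  rewrite /dpart dot_suml dot_sumr; apply: eq_bigr => i _.
  have ca : Num.conj ((a i)%:C : R[i]) = (a i)%:C := conjc_real (a i).
  rewrite dotZl dotZr rmorphM /= ca -!mulrA; congr (_ * _).
  by rewrite mulrC; congr (_ * _); exact: dotC.
by apply: adjB; exact: ad.
Qed.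

Lemma dpart_select a e e' k n : orthonormal_seq e -> (k < n)%N ->
  dpart a e e' n (e k) = (a k)%:C *: e' k.
Proof.
move=> oe kn; rewrite /dpart (bigD1_seq k) ?iota_uniq ?mem_index_iota//=.
rewrite oe eqxx mulr1 big1 ?addr0// => i ik.
by rewrite oe eq_sym (negPf ik) mulr0 scale0r.
Qed.

Lemma rot_coeff a k : bounded_seq a -> dot (rot a (f k)) (g k) = (a k)%:C.
Proof.
move=> ba; rewrite /rot bopDE bopNE.
have -> : diag_op a f g (f k) = (a k)%:C *: g k.
  apply: cvg_uniq (diag_opP of_ og ba (x := f k)) _.
  apply: (@cvg_eventually _ _ _ _ k.+1) => n kn.
  exact: dpart_select.
have -> : diag_op a g f (f k) = 0.
  apply: cvg_uniq (diag_opP og of_ ba (x := f k)) _.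
  apply: (@cvg_eventually _ _ _ _ 0%N) => n _.
  by rewrite /dpart big1// => i _; rewrite fg mulr0 scale0r.
by rewrite subr0 dotZl og eqxx mulr1.
Qed.

Lemma rot_compact a : vanishes_eventually a -> rot a \in compact_op.
Proof.
move=> [K aK].
have fin e e' : diag_op a e e' =
    \sum_(0 <= i < K) rank1 norm_dot ((a i)%:C *: e' i) (e i).
  apply: diag_opE => x; apply: (@cvg_eventually _ _ _ _ K) => n Kn.
  rewrite /dpart (big_cat_nat _ (m := 0%N) (n := K) (p := n))//=.
  rewrite [X in _ + X]big_nat [X in _ + X]big1 ?addr0; last first.
    by move=> i /andP[Ki _]; rewrite aK// mul0r scale0r.
  rewrite bop_sumE; apply: eq_bigr => i _.
  by rewrite rank1E scalerA mulrC.
by apply: rpredB; rewrite fin; apply: rpred_sum => i _; exact: rank1_compact.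
Qed.

End Orthonormal.

Lemma vanishing_bounded {R : realType} (a : nat -> R) :
  vanishes_eventually a -> bounded_seq a.
Proof.
move=> [K aK]; exists (\sum_(i < K) `|a i|) => k.
have [kK|/aK ->] := ltnP k K; last by rewrite normr0 sumr_ge0.
by rewrite (bigD1 (Ordinal kK))//= lerDl sumr_ge0.
Qed.

(** * Absence of a complement *)

Section NotComplemented.
Context {R : realType} {H : completeNormedModType R[i]}.
Variable dot : {dot H for Num.conj}.
Hypothesis norm_dot : forall x : H, `|x| ^+ 2 = dot x x.
Variables (w : option nat) (p : nat -> 'B(H)) (P : 'B('K(H))).
Hypothesis p_family : projection_family dot w p.
Hypothesis P_pinching : pinching w p P.
(** Indices varying with [n] cover both cases: they are constant for two projections of infinite
    rank, and run through the family if [w] is infinite. The [m n] are nonzero because test vectors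
    have to lie in ranges seen by [P]; [l n] may be 0. *)
Variables (f g : nat -> H) (m l : nat -> nat).
Hypothesis of_ : orthonormal_seq dot f.
Hypothesis og : orthonormal_seq dot g.
Hypothesis fg : forall i j, dot (f i) (g j) = 0.
Hypothesis mw : forall n, idx w (m n).
Hypothesis lw : forall n, index_le (l n) w.
Hypothesis lm : forall n, m n != l n.
Hypothesis pf : forall n, p (m n) (f n) = f n.
Hypothesis pg : forall n, p (l n) (g n) = g n.
Implicit Types (A B : 'B('K(H))).

(* The coefficient at [(n, n)] of the [(l n, m n)] block of [z], read off from
   [A = lcomm z]. *)
Let coef n A : R := complex.Re (dot (slice norm_dot A (f n) (f n)) (g n)).

Let coef_lin n (r : R) A B : coef n (r%:C *: A + B) = r * coef n A + coef n B.
Proof.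
rewrite /coef slice_lin bopDE bopZE dotDl dotZl raddfD /=; congr (_ + _).
by case: (dot _ _) => a b; rewrite /= mul0r subr0.
Qed.

Let coef_bound n A : `|coef n A| <= nrm A.
Proof.
apply: le_trans (Re_le_cabs _) _; apply: le_trans (cauchy_schwarz norm_dot _ _) _.
rewrite (orthonormal_nrm norm_dot _ og) mulr1; apply: le_trans (nrm_bop _ _) _.
rewrite (orthonormal_nrm norm_dot _ of_) mulr1.
exact: (nrm_slice norm_dot A (orthonormal_nrm norm_dot n of_)).
Qed.

(** In the commutator of [z] and [p (m n)] one term drops out, as [p (m n)] fixes [f n] and kills
    [g n]. *)
Let coef_lcomm n (z : 'B(H)) : coef n (lcomm P z) = complex.Re (dot (z (f n)) (g n)).
Proof.
rewrite /coef (slice_lcomm norm_dot p_family P_pinching z (mw n) (pf n)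
  (orthonormal_nrm norm_dot n of_)).
rewrite bopDE bopNE !bop_compE pf dotBl (proj_adj p_family (mw n)).
rewrite -pg -(bop_compE (p (m n))) (family_ortho norm_dot p_family)//.
  by rewrite bop0E dot0r subr0 pg.
by have /andP[] := mw n.
Qed.

(** [rot a] need not be compact, so [X a] need not be a tangent vector; it is one if [a] vanishes
    eventually. *)
Let X (a : nat -> R) := lcomm P (rot dot f g a).

(** Let [t] be the projection onto a complement. By [phillips] some branch has an indicator sequence
    [a] for which all the coefficients of [t (X a)] vanish. So [X a] has the coefficients of its
    tangent part [lcomm P z]: the real part of [dot (z (f n)) (g n)] is [a n], which is 1 infinitely
    often although [z] is compact. *)
Lemma tangent_not_complemented : ~ complemented (unitary_orbit_tangent dot P).
Proof.
move=> [cS [T [cT ST all]]]; set S := unitary_orbit_tangent dot P in cS ST all.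
have cV : seq_complete 'B('K(H)) by exact/seq_complete_bop/seq_complete_cop.
have [M M0 MP] := complement_bound cV cS cT ST all.
have [[S0 SD SZ] _] := cS; have [[T0 TD TZ] _] := cT.
have /choice[t tP] : forall A, exists t, exists2 s, S s & T t /\ A = s + t.
  by move=> A; have [s [t [Ss Tt ->]]] := all A; exists t, s.
have uniq_t s s' t1 t2 : S s -> S s' -> T t1 -> T t2 -> s + t1 = s' + t2 -> t1 = t2.
  move=> Ss Ss' Tt Tt' e.
  have SN s1 : S s1 -> S (- s1) by move=> /(SZ (-1)); rewrite rmorphN scaleN1r.
  have TN s1 : T s1 -> T (- s1) by move=> /(TZ (-1)); rewrite rmorphN scaleN1r.
  have e' : s - s' = t2 - t1.
    by apply/eqP; rewrite subr_eq addrAC eq_sym subr_eq eq_sym addrC e addrC.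
  have : (S `&` T) (s - s').
    by split; [apply: SD => //; exact: SN|rewrite e'; apply: TD => //; exact: TN].
  by rewrite ST /= e' => /eqP; rewrite subr_eq0 => /eqP.
have t_lin (r : R) A B : t (r%:C *: A + B) = r%:C *: t A + t B.
  have [s1 Ss1 [Tt1 e1]] := tP (r%:C *: A + B).
  have [s2 Ss2 [Tt2 e2]] := tP A; have [s3 Ss3 [Tt3 e3]] := tP B.
  apply: (uniq_t s1 (r%:C *: s2 + s3)) => //.
  - by apply: SD => //; exact: SZ.
  - by apply: TD => //; exact: TZ.
  by rewrite -e1 {1}e2 {1}e3 scalerDr addrACA.
have t_S A : S A -> t A = 0.
  move=> SA; have [s Ss [Tt e]] := tP A.
  by apply: (uniq_t s A) => //; rewrite -e addr0.
have t_bound A : nrm (t A) <= M * nrm A.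
  by have [s Ss [Tt e]] := tP A; rewrite {2}e; exact: MP.
(* The bound is the product of those for [t], [lcomm] and [rot]. *)
have [|||x xP] := @phillips R (fun n a => coef n (t (X a))) (M * (2 * nrm P * (1 + 1))).
- move=> n r a b ba bb; rewrite /X (rot_lin norm_dot of_ og r ba bb).
  by rewrite lcommP t_lin coef_lin.
- move=> n a va; rewrite t_S.
    by rewrite /coef (_ : slice norm_dot 0 (f n) = 0) ?bop0E ?dot0l//;
      apply: bopP => y; rewrite sliceE.
  apply/tangentP; exists (CompactOp (rot_compact norm_dot f g va)) => //.
  exact: (rot_adj norm_dot of_ og (vanishing_bounded va)).
- move=> n a a1; apply: le_trans (coef_bound n _) _.
  apply: le_trans (t_bound _) _; rewrite ler_wpM2l//.
  apply: le_trans (nrm_lcomm P _) _; rewrite ler_wpM2l ?mulr_ge0 ?nrm_ge0//.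
  exact: (nrm_rot norm_dot of_ og a1).
pose a k : R := (branch x k)%:R.
have ba : bounded_seq a by exists 1 => k; rewrite /a normr_nat lern1 leq_b1.
have [s /tangentP[z zs sz] [Tt e]] := tP (X a).
have az n : a n = complex.Re (dot (z (f n)) (g n)).
  have := coef_lcomm n (rot dot f g a).
  rewrite (rot_coeff norm_dot of_ og fg n ba) /= => <-.
  rewrite -/(X a) {1}e -[s]scale1r (coef_lin n 1) xP addr0 mul1r sz.
  exact: coef_lcomm.
have [K KP] := compact_offdiag_small norm_dot z of_ og ltr01.
have [k [Kk xk]] := branch_infinite x K.
have := le_lt_trans (Re_le_cabs _) (KP k Kk).
by rewrite -az /a xk normr1 ltxx.
Qed.

End NotComplemented.

(** * Orthonormal sequences in the ranges of projections *)

Section InfiniteRank.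
Context {R : realType} {H : completeNormedModType R[i]}.
Variable dot : {dot H for Num.conj}.
Hypothesis norm_dot : forall x : H, `|x| ^+ 2 = dot x x.

Lemma fin_dim_sum (a b : 'B(H)) : finite_dimensional (range a) ->
  finite_dimensional (range b) -> finite_dimensional (range (a + b)).
Proof.
move=> [n [v av]] [k [u bu]].
exists (n + k)%N, (fun i => match fintype.split i with inl j => v j | inr j => u j end).
move=> _ [x _ <-]; have [|c ac] := av (a x); first by exists x.
have [|d bd] := bu (b x); first by exists x.
exists (fun i => match fintype.split i with inl j => c j | inr j => d j end).
rewrite big_split_ord bopDE ac bd; congr (_ + _); apply: eq_bigr => i _.
  by rewrite (unsplitK (inl i)).
by rewrite (unsplitK (inr i)).
Qed.

(** Orthogonality to one more vector [x] costs at most one dimension: a vector [u] of [A] not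
    orthogonal to [x] spans [A] together with the vectors of [A] that are. *)
Lemma ortho_vector (A : set H) (s : seq H) :
  (forall (k : R[i]) x y, A x -> A y -> A (k *: x + y)) -> ~ finite_dimensional A ->
  exists2 v, A v & v <> 0 /\ forall x, x \in s -> dot v x = 0.
Proof.
elim: s A => [|x s IH] A Alin Ainf.
  apply: contrapT => nv; apply: Ainf; exists 0%N, (fun=> 0) => y Ay.
  exists (fun=> 0); rewrite big_ord0; apply: contrapT => y0; apply: nv.
  by exists y.
have [||y [Ay yx] [y0 ys]] := IH [set v | A v /\ dot v x = 0].
- move=> k u v [Au ux] [Av vx]; split; first exact: Alin.
  by rewrite dotDl dotZl ux vx mulr0 addr0.
- move=> [n [v Av]]; apply: Ainf.
  have [[u Au ux]|nu] := pselect (exists2 u, A u & dot u x != 0); last first.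
    exists n, v => y Ay; apply: Av; split => //; apply/eqP/negPn/negP => yx.
    by apply: nu; exists y.
  exists n.+1, (fun i => if unlift ord0 i is Some j then v j else u) => y Ay.
  pose k := dot y x / dot u x.
  have [|c yc] := Av (y - k *: u).
    split; first by rewrite addrC -scaleNr; exact: Alin.
    by rewrite dotBl dotZl divfK// subrr.
  exists (fun i => if unlift ord0 i is Some j then c j else k).
  rewrite big_ord_recl unlift_none (eq_bigr (fun i => c i *: v i)).
    by rewrite -yc addrC subrK.
  by move=> i _; rewrite liftK.
by exists y => //; split=> // z; rewrite in_cons => /orP[/eqP ->|/ys].
Qed.

Lemma ortho_sequence (q : 'B(H)) : q ∙ q = q -> infinite_rank q ->
  exists2 e : nat -> H, orthonormal_seq dot e & forall n, q (e n) = e n.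
Proof.
move=> qq qinf; have next (s : seq H) : exists v, [/\ q v = v, nrm v = 1 &
    forall x, x \in s -> dot v x = 0].
  have [|_ [u _ <-] [v0 vs]] := @ortho_vector (range q) s _ qinf.
    by move=> k _ _ [x _ <-] [y _ <-]; exists (k *: x + y) => //; rewrite linearP.
  exists ((nrm (q u))^-1%:C *: q u); split.
  - by rewrite bopZ -(bop_compE q) qq.
  - rewrite nrmZr ger0_norm ?invr_ge0 ?nrm_ge0// mulVf//.
    by rewrite lt0r_neq0//; exact: nrm_gt0.
  - by move=> x /vs qx; rewrite dotZl qx mulr0.
have [v vP] := choice next.
pose s := fix s n := if n is k.+1 then rcons (s k) (v (s k)) else [::].
pose e n := v (s n).
have es i j : (i < j)%N -> e i \in s j.
  elim: j => // j IH; rewrite ltnS leq_eqVlt /= mem_rcons in_cons.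
  by move=> /orP[/eqP ->|/IH ->]; rewrite ?eqxx ?orbT.
exists e => [i j|n]; last by have [] := vP (s n).
have lt i' j' : (i' < j')%N -> dot (e j') (e i') = 0.
  by move=> /es ij; have [_ _] := vP (s j'); exact.
case: (ltngtP i j) => [/lt ij|/lt//|->].
  exact: dot_eq0C.
by have [_ e1 _] := vP (s j); rewrite (dot_nrm norm_dot) e1 expr1n.
Qed.

End InfiniteRank.

Section Families.
Context {R : realType} {H : completeNormedModType R[i]}.
Variable dot : {dot H for Num.conj}.
Hypothesis norm_dot : forall x : H, `|x| ^+ 2 = dot x x.
Variables (w : option nat) (p : nat -> 'B(H)) (P : 'B('K(H))).
Hypothesis p_family : projection_family dot w p.
Hypothesis P_pinching : pinching w p P.

Let dot_ranges i j x y : index_le i w -> index_le j w -> i != j ->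
  p i x = x -> p j y = y -> dot x y = 0.
Proof.
move=> iw jw ij <- <-; rewrite (family_adj norm_dot p_family iw).
by rewrite -(bop_compE (p i)) (family_ortho norm_dot p_family)// bop0E dot0r.
Qed.

Lemma two_infinite_not_complemented i j : index_le i w -> index_le j w -> i != j ->
  infinite_rank (p i) -> infinite_rank (p j) ->
  ~ complemented (unitary_orbit_tangent dot P).
Proof.
(* One of two distinct indices is nonzero; it has to be the index on the side of [f]. *)
wlog i0 : i j / (0 < i)%N.
  move=> IH iw jw ij ii jj; case: (posnP i) => [i0|ip]; last exact: (IH i j).
  have j0 : (0 < j)%N by rewrite lt0n eq_sym -i0.
  by rewrite eq_sym in ij; exact: (IH j i j0 jw iw ij jj ii).
move=> iw jw ij ii jj.
have [f of_ pf] := ortho_sequence norm_dot (family_idem p_family iw) ii.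
have [g og pg] := ortho_sequence norm_dot (family_idem p_family jw) jj.
apply: (@tangent_not_complemented _ _ _ norm_dot w p P p_family P_pinching f g
  (fun=> i) (fun=> j)) => // [a b|_].
  exact: dot_ranges (pf a) (pg b).
by rewrite /idx i0.
Qed.

(** One unit vector in each range is enough, whatever the ranks: the projections of odd index supply
    [f], those of even index supply [g]. *)
Lemma infinite_family_not_complemented : w = None ->
  ~ complemented (unitary_orbit_tangent dot P).
Proof.
move=> wN; have iw i : index_le i w by rewrite wN.
have ii i : idx w i.+1 by rewrite /idx iw.
have /choice[e eP] : forall i, exists e, p i.+1 e = e /\ nrm e = 1.
  by move=> i; have [e pe e1] := unit_in_range p_family (ii i); exists e.
have oe (h : nat -> nat) : injective h -> orthonormal_seq dot (fun n => e (h n)).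
  move=> hi i j; have [->|ij] := eqVneq i j.
    by rewrite (dot_nrm norm_dot) (eP _).2 expr1n.
  apply: (@dot_ranges (h i).+1 (h j).+1) => //; last 2 first.
  - exact: (eP _).1.
  - exact: (eP _).1.
  by rewrite eqSS (inj_eq hi).
apply: (@tangent_not_complemented _ _ _ norm_dot w p P p_family P_pinching
  (fun n => e n.*2) (fun n => e n.*2.+1) (fun n => n.*2.+1) (fun n => n.*2.+2)) => //.
- exact: (oe double double_inj).
- by apply: (oe (fun n => n.*2.+1)) => i j [] /double_inj.
- move=> i j; apply: (@dot_ranges i.*2.+1 j.*2.+2) => //; last 2 first.
  + exact: (eP _).1.
  + exact: (eP _).1.
  by rewrite eqSS; apply/eqP => /(congr1 odd); rewrite /= !odd_double.
- by move=> n; rewrite eqSS ltn_eqF.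
- by move=> n; exact: (eP _).1.
- by move=> n; exact: (eP _).1.
Qed.

End Families.

(** * From the base point to the whole orbit, and the characterization *)

Section Main.
Context {R : realType} {H : completeNormedModType R[i]}.
Variable dot : {dot H for Num.conj}.
Hypothesis norm_dot : forall x : H, `|x| ^+ 2 = dot x x.
Variables (w : option nat) (p : nat -> 'B(H)) (P : 'B('K(H))).
Hypothesis p_family : projection_family dot w p.
Hypothesis P_pinching : pinching w p P.

(* Conjugation by [L_u] maps the tangent space at [P] onto the one at
   [L_u P L_{u^*}]. *)
Lemma tangent_orbit (K : set 'B('K(H)) -> Prop) :
  (forall (C D : 'B('B('K(H)))) S, C ∙ D = bop_id -> D ∙ C = bop_id ->
    K S -> K (C @^-1` S)) ->
  K (unitary_orbit_tangent dot P) ->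
  forall Q, unitary_orbit dot P Q -> K (unitary_orbit_tangent dot Q).
Proof.
move=> KC KP _ [u /unitary_pairP uu' <-].
have [C CE] := conj_op norm_dot uu'.
have [D DE] := conj_op norm_dot (unitary_pair_sym uu').
have -> : unitary_orbit_tangent dot (unitary_orbit_map dot P u) =
    C @^-1` unitary_orbit_tangent dot P.
  apply/seteqP; split=> A; rewrite /preimage /= CE => /tangent_conj; exact.
apply: (KC C D) => //; apply: bopP => A; rewrite bop_compE CE DE.
  rewrite !compA (lmulK (unitary_pair_sym uu')) comp1l -compA.
  by rewrite (lmulK (unitary_pair_sym uu')) comp1r.
by rewrite !compA (lmulK uu') comp1l -compA (lmulK uu') comp1r.
Qed.

Lemma orbit_base : unitary_orbit dot P P.
Proof.
exists bop_id; first exact: unitary_pair_unitary (unitary_pair1 dot).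
by rewrite (orbit_mapE P (unitary_pair1 dot)) lmul1 comp1l comp1r.
Qed.

End Main.

Lemma finite_sum_range {R : realType} {V : completeNormedModType R[i]}
    n (a : 'I_n -> 'B(V)) :
  (forall i, finite_dimensional (range (a i))) ->
  finite_dimensional (range (\sum_(i < n) a i)).
Proof.
move=> fa; elim/big_ind : _ => //; last exact: fin_dim_sum.
exists 0%N, (fun=> 0) => _ [x _ <-]; exists (fun=> 0).
by rewrite big_ord0.
Qed.

Theorem theorem3p16 (R : realType) (H : completeNormedModType R[i])
    (dot : {dot H for Num.conj})
    (norm_dot : forall x : H, `|x| ^+ 2 = dot x x)
    (H_infinite : ~ finite_dimensional [set: H])
    (H_separable : separable H)
    (w : option nat) (w_ge1 : index_le 1 w)
    (p : nat -> 'B(H)) (p_family : projection_family dot w p)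
    (P : 'B('K(H))) (P_pinching : pinching w p P) :
  quasi_submanifold (unitary_orbit dot P) (unitary_orbit_open dot P)
    (unitary_orbit_tangent dot) /\
  (submanifold (unitary_orbit dot P) (unitary_orbit_open dot P)
    (unitary_orbit_tangent dot) <->
   w <> None /\ exists! i, index_le i w /\ infinite_rank (p i)).
Proof.
have top := orbit_topology norm_dot p_family P_pinching.
split.
  split=> //; apply: (tangent_orbit norm_dot) => [C D S _ _|].
    exact: preimage_closed_subspace.
  exact: (tangent_closed norm_dot p_family P_pinching).
split=> [[_ /(_ P (orbit_base dot P)) cP]|].
  case: w w_ge1 p_family P_pinching {top} => [N|] w1 pN PN; last first.
    by have := infinite_family_not_complemented norm_dot pN PN erefl.
  split=> //.
  (* Otherwise the identity, a finite sum of the [p i], would have finite rank, against the infinite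
     dimension of [H]. *)
  have [i [iN ii]] : exists i, index_le i (Some N) /\ infinite_rank (p i).
    apply: contrapT => ni; apply: H_infinite.
    have -> : [set: H] = range (bop_id : 'B(H)).
      by apply/seteqP; split=> x // _; exists x.
    rewrite -(proj_sum pN); apply: finite_sum_range => i; apply: contrapT => ii.
    by apply: ni; exists i; split => //; rewrite /= -ltnS.
  exists i; split=> // j [jN jj]; apply: contrapT => /eqP ij.
  exact: (two_infinite_not_complemented norm_dot pN PN iN jN ij ii jj cP).
move=> [wN [i [[iw ii] iu]]]; split=> //.
apply: (tangent_orbit norm_dot) => [C D S CD DC|].
  exact: (preimage_complemented CD DC).
case: w wN iw iu p_family P_pinching {top w_ge1} => [N _|[]//] iN iu pN PN.
have /choice[e eP] j : exists x, idx (Some N) j -> p j x = x /\ nrm x = 1.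
  have [jN|jN] := pselect (idx (Some N) j); last by exists 0 => /jN.
  by have [x px x1] := unit_in_range pN jN; exists x.
apply: (@tangent_complemented _ _ _ norm_dot N p P pN PN i iN _ e).
- move=> j jN /eqP ji; apply: contrapT => jj; apply: ji; apply/esym/iu.
  by split.
- by move=> j /eP[].
- by move=> j /eP[].
Qed.
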